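(* Assume $d/p\le k$. Let $L:\dot V_p^k\to L_\infty(Q^d)$ be the linear map sending a function to its equivalence class in $L_\infty(Q^d)$. (a) $\operatorname{range}(L)=\dot V_{p\infty}^k$ and the operator $L:\dot V_p^k\to\dot V_{p\infty}^k$ has norm $1$. (b) $\ker(L)=\ker(P)=\ell_p\subset\dot V_p^k$. (c) $L$ maps $N\dot V_p^k$ isometrically onto $\dot V_{p\infty}^k$.
   Context: Fix $d,k\in\mathbb N$, $1\le p<\infty$, and let $Q^d:=[0,1]^d$. A cube is a closed cube in $\mathbb R^d$ homothetic to $Q^d$. A packing is a family of cubes with pairwise disjoint interiors; $\Pi$ is the set of finite packings consisting of cubes contained in $Q^d$. $\mathcal P_{k-1}^d$ is the space of real polynomials on $\mathbb R^d$ of degree at most $k-1$. $\ell_\infty(Q^d)$ is the space of all bounded functions $f:Q^d\to\mathbb R$, and $\ell_p=\ell_p(Q^d)$ is the space of all $f:Q^d\to\mathbb R$ with $(\sum_{x\in Q^d}|f(x)|^p)^{1/p}<\infty$. For a cube $Q\subset Q^d$, $E_k(f;Q):=\inf_{m\in\mathcal P_{k-1}^d}\sup_Q|f-m|$. The space $\dot V_p^k$ consists of all $f\in\ell_\infty(Q^d)$ such that $$|f|_{V_p^k}:=\sup_{\pi\in\Pi}\Big(\sum_{Q\in\pi}E_k(f;Q)^p\Big)^{1/p}<\infty,$$ with seminorm $|\cdot|_{V_p^k}$. Functions in $\dot V_p^k$ are Lebesgue measurable (they have at most countably many discontinuities). The space $\dot V_{p\infty}^k$ consists of all $f\in L_\infty(Q^d)$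 such that $$|f|_{V_{p\infty}^k}:=\sup_{\pi\in\Pi}\Big(\sum_{Q\in\pi}E_{k\infty}(f;Q)^p\Big)^{1/p}<\infty,\qquad E_{k\infty}(f;Q):=\inf_{m\in\mathcal P_{k-1}^d}\|f-m\|_{L_\infty(Q)}.$$ The projection $P$ on $\dot V_p^k$ is given by $Pf=\hat f$, where: if $d\ge2$, $\hat f(x):=\lim_{y\to x}f(y)$, $x\in Q^d$; if $d=1$, $\hat f(x):=\frac12(f(x^-)+f(x^+))$ for $0<x<1$, $\hat f(0):=f(0^+)$, $\hat f(1):=f(1^-)$ (these limits exist for $f\in\dot V_p^k$). $N\dot V_p^k:=P(\dot V_p^k)$, with the seminorm $|\cdot|_{V_p^k}$. Norms and isometry are with respect to the seminorm $|\cdot|_{V_p^k}$ on $\dot V_p^k$ and $N\dot V_p^k$ and the seminorm $|\cdot|_{V_{p\infty}^k}$ on $\dot V_{p\infty}^k$. *)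

(* Defs.v *)
From HB Require Import structures.
From mathcomp Require Import all_boot all_order all_algebra.
From mathcomp Require Import all_classical all_reals all_analysis.
(* Without the notations of mpoly, which clash with those of MathComp-Analysis. *)
From mathcomp Require Import (canonicals, coercions) mpoly.

Set Implicit Arguments.
Unset Strict Implicit.
Unset Printing Implicit Defensive.

Import Order.TTheory GRing.Theory Num.Theory.
Import numFieldNormedType.Exports.

Local Open Scope classical_set_scope.
Local Open Scope ring_scope.

(* The cube a + r [0,1]^d. *)
Definition cube (R : realType) (d : nat) (a : 'rV[R]_d) (r : R) :
    set 'rV[R]_d :=
  [set x | forall i, a 0 i <= x 0 i <= a 0 i + r].

Definition is_cube (R : realType) (d : nat) (Q : set 'rV[R]_d) : Prop :=
  exists (a : 'rV[R]_d) (r : R), 0 < r /\ Q = cube a r.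

Definition unit_cube (R : realType) (d : nat) : set 'rV[R]_d := cube 0 1.
Arguments unit_cube : clear implicits.

(* Q^d as a type, with the topology induced by R^d; functions on Q^d are
   functions with this domain. *)
Definition Qd (R : realType) (d : nat) : Type := set_type (unit_cube R d).

Definition Qd_val (R : realType) (d : nat) (x : Qd R d) : 'rV[R]_d := \val x.
Coercion Qd_val : Qd >-> matrix.

Lemma unit_cube0 (R : realType) (d : nat) : (0 : 'rV[R]_d) \in unit_cube R d.
Proof. by rewrite inE => i; rewrite !mxE add0r lexx ler01. Qed.

HB.instance Definition _ (R : realType) (d : nat) :=
  Topological.copy (Qd R d) (set_type (unit_cube R d)).
HB.instance Definition _ (R : realType) (d : nat) :=
  isPointed.Build (Qd R d) (exist _ 0 (unit_cube0 R d)).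

Section lebesgue_outer_measure.
Context (R : realType) (d : nat).
Local Open Scope ereal_scope.

Definition cube_cover (A : set 'rV[R]_d) (C : set ('rV[R]_d * R)) : Prop :=
  [/\ countable C, (forall c, C c -> (0 < c.2)%R) &
      A `<=` \bigcup_(c in C) cube c.1 c.2].

Definition lebesgue_outer (A : set 'rV[R]_d) : \bar R :=
  ereal_inf [set \esum_(c in C) (c.2 ^+ d)%:E | C in cube_cover A].

Lemma lebesgue_outer_ge0 A : 0 <= lebesgue_outer A.
Proof.
apply: le_ereal_inf_tmp => _ [C [_ C0 _] <-]; apply: esum_ge0 => c /C0 c0.
by rewrite lee_fin exprn_ge0 // ltW.
Qed.

Lemma lebesgue_outer0 : lebesgue_outer set0 = 0.
Proof.
apply/eqP; rewrite eq_le lebesgue_outer_ge0 andbT.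
apply: ereal_inf_lbound; exists set0; last by rewrite esum_set0.
by split => //; exact: countable0.
Qed.

Lemma le_lebesgue_outer : {homo lebesgue_outer : A B / A `<=` B >-> A <= B}.
Proof.
move=> A B AB; apply: ereal_inf_le_tmp => _ [C [cC C0 BC] <-]; exists C => //.
by split=> //; exact: subset_trans BC.
Qed.

Lemma lebesgue_outer_sigma_subadditive : sigma_subadditive lebesgue_outer.
Proof.
move=> A; have [[i ioo]|] := pselect (exists i, lebesgue_outer (A i) = +oo).
  rewrite (eseries_pinfty _ _ ioo) ?leey// => n _.
  by rewrite -ltNye (lt_le_trans _ (lebesgue_outer_ge0 _)).
rewrite -forallNE => Aoo; apply/lee_addgt0Pr => e e0.
apply: (le_trans _ (epsilon_trick _ _ (ltW e0))); last first.
  by move=> n; exact: lebesgue_outer_ge0.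
have [C PC] : {C : nat -> set ('rV[R]_d * R) & forall n,
    cube_cover (A n) (C n) /\ \esum_(c in C n) (c.2 ^+ d)%:E <=
    lebesgue_outer (A n) + (e / (2 ^ n.+1)%:R)%:E}.
  apply: (@choice _ _ (fun n C => cube_cover (A n) C /\
    \esum_(c in C) (c.2 ^+ d)%:E <=
    lebesgue_outer (A n) + (e / (2 ^ n.+1)%:R)%:E)) => n.
  have en : (0 < e / (2 ^ n.+1)%:R)%R by rewrite divr_gt0// ltr0n expn_gt0.
  have : lebesgue_outer (A n) \is a fin_num.
    by rewrite ge0_fin_numE ?lebesgue_outer_ge0// ltey; exact/eqP/Aoo.
  move=> /(lb_ereal_inf_adherent en)[x [D DA <-] xlt].
  by exists D; split => //; exact/ltW.
have C0 c n : C n c -> 0 <= (c.2 ^+ d)%:E.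
  move=> Cnc; have [[_ /(_ _ Cnc) c0 _] _] := PC n.
  by rewrite lee_fin exprn_ge0 // ltW.
apply: (@le_trans _ _ (\esum_(c in \bigcup_n C n) (c.2 ^+ d)%:E)).
  apply: ereal_inf_lbound; exists (\bigcup_n C n) => //; split.
  - by apply: bigcup_countable => // n _; case: (PC n) => -[].
  - by move=> c [n _ Cnc]; case: (PC n) => -[_ /(_ _ Cnc)].
  - move=> x [n _ Anx]; case: (PC n) => -[_ _ /(_ _ Anx)[c Cc xc]] _.
    by exists c => //; exists n.
rewrite seqDU_bigcup_eq esum_bigcup; last 2 first.
- exact: sub_trivIset (@trivIset_seqDU _ C).
- by move=> c [n _ [Cnc _]]; exact: (C0 _ n).
have D0 n : 0 <= \esum_(c in seqDU C n) (c.2 ^+ d)%:E.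
  by apply: esum_ge0 => c [Cnc _]; exact: (C0 _ n).
rewrite -nneseries_esumT //; apply: lee_nneseries => // n _.
apply: le_trans (PC n).2.
rewrite [leLHS]esum_mkcond [leRHS]esum_mkcond; apply: le_esum => c _.
case: ifPn => [|_]; first by rewrite inE => -[Cnc _]; rewrite mem_set.
by case: ifPn => //; rewrite inE => /C0.
Qed.

HB.instance Definition _ := isOuterMeasure.Build R 'rV[R]_d lebesgue_outer
  lebesgue_outer0 lebesgue_outer_ge0 le_lebesgue_outer
  lebesgue_outer_sigma_subadditive.

Definition lebesgue_outer_Qd (A : set (Qd R d)) : \bar R :=
  lebesgue_outer ((@Qd_val R d) @` A).

Lemma lebesgue_outer_Qd0 : lebesgue_outer_Qd set0 = 0.
Proof. by rewrite /lebesgue_outer_Qd image_set0 lebesgue_outer0. Qed.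

Lemma lebesgue_outer_Qd_ge0 A : 0 <= lebesgue_outer_Qd A.
Proof. exact: lebesgue_outer_ge0. Qed.

Lemma le_lebesgue_outer_Qd :
  {homo lebesgue_outer_Qd : A B / A `<=` B >-> A <= B}.
Proof. by move=> A B AB; apply: le_lebesgue_outer; exact: image_subset. Qed.

Lemma lebesgue_outer_Qd_sigma_subadditive :
  sigma_subadditive lebesgue_outer_Qd.
Proof.
move=> A; rewrite /lebesgue_outer_Qd image_bigcup.
exact: lebesgue_outer_sigma_subadditive.
Qed.

HB.instance Definition _ := isOuterMeasure.Build R (Qd R d) lebesgue_outer_Qd
  lebesgue_outer_Qd0 lebesgue_outer_Qd_ge0 le_lebesgue_outer_Qd
  lebesgue_outer_Qd_sigma_subadditive.

End lebesgue_outer_measure.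

Definition leb_outer (R : realType) (d : nat) :
  {outer_measure set (Qd R d) -> \bar R} := @lebesgue_outer_Qd R d.

(* Q^d with the sigma-algebra of its Lebesgue measurable subsets, obtained by
   Caratheodory's criterion (hence complete), and the Lebesgue measure on it. *)
Definition QdL (R : realType) (d : nat) : Type :=
  caratheodory_type (leb_outer R d).

HB.instance Definition _ (R : realType) (d : nat) :=
  Measurable.on (QdL R d).

Definition leb (R : realType) (d : nat) : {measure set (QdL R d) -> \bar R} :=
  (leb_outer R d : set (caratheodory_type (leb_outer R d)) -> \bar R).
Arguments leb : clear implicits.

(* The functions x |-> m(x) on Q^d with m in P_{k-1}^d; msize is 1 + degree. *)
Definition Pk (R : realType) (d k : nat) : set (Qd R d -> R) :=
  [set q | exists2 m : mpoly.mpoly d R, (mpoly.msize m <= k)%N &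
     q = fun x : Qd R d => mpoly.meval (fun i => Qd_val x 0 i) m].

Definition packing (R : realType) (d : nat) (pi : set (set 'rV[R]_d)) : Prop :=
  [/\ finite_set pi,
      (forall Q, pi Q -> is_cube Q /\ Q `<=` unit_cube R d) &
      trivIset pi (fun Q => Q°)].

(* The classes, modulo equality almost everywhere, of Lebesgue measurable
   functions on Q^d. A class coerces to one of its elements. *)
Notation aeclass R d := {mfun_ (leb R d), QdL R d >-> measurableTypeR R}.

Definition Linfty (R : realType) (d : nat) : set (aeclass R d) :=
  [set u | finite_norm (leb R d) +oo u].

Definition to_mfun (R : realType) (d : nat) (f : Qd R d -> R) :
    {mfun QdL R d >-> measurableTypeR R} :=
  match pselect (measurable_fun [set: QdL R d] (f : QdL R d -> measurableTypeR R)) with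
  | left mf => @mfun_Sub _ _ (QdL R d) (measurableTypeR R) f (mem_set mf)
  | right _ => cst 0
  end.

(* The class of f when f is Lebesgue measurable; for other f, the junk value is
   the class of 0. *)
Definition L (R : realType) (d : nat) (f : Qd R d -> R) : aeclass R d :=
  (\pi_(aeclass R d) (to_mfun f))%qT.

Section spaces.
Context (R : realType) (d k : nat) (p : R).
Local Open Scope ereal_scope.

Definition E_sup (f : Qd R d -> R) (Q : set 'rV[R]_d) : \bar R :=
  ereal_inf [set ereal_sup [set `|f x - q x|%:E | x in [set x | Q (Qd_val x)]]
            | q in @Pk R d k].

Definition E_esssup (f : QdL R d -> R) (Q : set 'rV[R]_d) : \bar R :=
  ereal_inf [set 'N[leb R d]_+oo[
                   (EFin \o (f \- q)%R) \_ [set x : QdL R d | Q (Qd_val x)]]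
            | q in @Pk R d k].

Definition packing_sup (E : set 'rV[R]_d -> \bar R) : \bar R :=
  ereal_sup [set (\sum_(Q \in pi) E Q `^ p) `^ p^-1 | pi in @packing R d].

Definition V_seminorm (f : Qd R d -> R) : \bar R := packing_sup (E_sup f).

Definition V : set (Qd R d -> R) :=
  [set f | [bounded f x | x in setT] /\ V_seminorm f < +oo].

Definition Vinf_seminorm (u : aeclass R d) : \bar R :=
  packing_sup (E_esssup u).

Definition Vinf : set (aeclass R d) :=
  [set u | @Linfty R d u /\ Vinf_seminorm u < +oo].

Definition ellp : set (Qd R d -> R) :=
  [set f | (\esum_(x in [set: Qd R d]) (`|f x| `^ p)%:E) `^ p^-1 < +oo].

End spaces.

(* One-sided limits; used for d = 1 only. *)
Definition left_lim (R : realType) (d : nat) (f : Qd R d -> R) (x : Qd R d) : R :=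
  lim (f @ within [set y | forall i, Qd_val y 0 i < Qd_val x 0 i] (nbhs x)).

Definition right_lim (R : realType) (d : nat) (f : Qd R d -> R) (x : Qd R d) : R :=
  lim (f @ within [set y | forall i, Qd_val x 0 i < Qd_val y 0 i] (nbhs x)).

Definition P (R : realType) (d : nat) (f : Qd R d -> R) (x : Qd R d) : R :=
  if (2 <= d)%N then lim (f @ x^')
  else if [forall i, Qd_val x 0 i == 0] then right_lim f x
  else if [forall i, Qd_val x 0 i == 1] then left_lim f x
  else (left_lim f x + right_lim f x) / 2.

Definition NV (R : realType) (d k : nat) (p : R) : set (Qd R d -> R) :=
  @P R d @` @V R d k p.

Definition kerP (R : realType) (d k : nat) (p : R) : set (Qd R d -> R) :=
  [set f | V k p f /\ P f = cst 0].

Definition kerL (R : realType) (d k : nat) (p : R) : set (Qd R d -> R) :=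
  [set f | V k p f /\ L f = L (cst 0)].

Definition L_norm (R : realType) (d k : nat) (p : R) : \bar R :=
  ereal_sup [set Vinf_seminorm k p (L f)
            | f in [set f : Qd R d -> R | V k p f /\ (V_seminorm k p f <= 1)%E]].

(* Main.v *)
Require Import Defs.
From HB Require Import structures.
From mathcomp Require Import all_boot all_order all_algebra.
From mathcomp Require Import all_classical all_reals all_analysis.
From mathcomp Require Import (canonicals, coercions) mpoly.
From mathcomp Require Import finmap zify lra ring.

Set Implicit Arguments.
Unset Strict Implicit.
Unset Printing Implicit Defensive.

Import Order.TTheory GRing.Theory Num.Theory.
Import numFieldNormedType.Exports.

Local Open Scope classical_set_scope.
Local Open Scope ring_scope.

(** Why the theorem holds.

    Call an error small on a cube if some polynomial of degree less than [k] is uniformly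
    close to the function there, everywhere for [V] and almost everywhere for [Vinf]. Both
    cases are treated at once by a filter of subsets of the unit cube, [sure] or [almost];
    all that matters ([thick]) is that its members are dense and that it is closed under
    countable intersections.

    One-sided limits. A finite variation forces the errors to vanish along cubes that
    shrink to a point without containing it ([E_vanishes]), since otherwise infinitely many
    disjoint cubes would carry a large error. On such a cube the function is close to a
    bounded polynomial, and a bounded polynomial of bounded degree is Lipschitz at the
    scale of the cube ([Pk_lipschitz]). So the function is nearly constant on a half ball
    ([side_oscillation]) and has limits along all the half balls at every point
    ([side_lim_exists]). In dimension at least two, half balls in different directions
    overlap and the limits at a point agree. The projection [P] replaces the values by the
    means of these limits ([P_side_mean]). By compactness of the unit cube only finitely
    many points carry a jump above a given size, so the discontinuities are countable,
    functions in [V] are measurable, and a function agrees with its normalisation up to a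
    countable set, or almost everywhere in the case of [Vinf] ([side_mean_eqF]). For the
    measure theory one needs that countable sets are null, that cubes have positive outer
    measure ([outer_cube_ge]) and that open sets are measurable ([outer_cube_split]).

    Isometry. For a normalised function the seminorm of [V] is at most that of [Vinf]. In
    dimension at least two the function is continuous and the errors agree cube by cube. In
    dimension one the value at an end point of an interval also depends on the limit from
    outside. Here a normalised function is the pointwise limit of the means of its
    compositions with the two contractions [x + t (1 - x)] and [(1 - t) x] as [t] tends to
    zero. The error is lower semicontinuous under bounded pointwise convergence
    ([E_sup_lsc]), the contractions map packings to packings, the jumps at the images of
    the end points vanish in the limit, and the power [p] is convex; this bounds every sum
    over a packing ([isometry_dim1]). Consequently the normalised representative of a class
    in [Vinf] lies in [V], which gives the surjectivity of [L] and the isometry on [NV].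

    Kernels. The functions with [P f = 0] or with [L f = 0] are those whose side limits all
    vanish. On a cube containing [x] the error of such a function is at least half of its
    value at [x], and disjoint cubes around finitely many points give a bound in [ell_p];
    conversely a point lies in at most [2 ^ d] cubes of a packing, so a function in [ell_p]
    has finite variation.

    Norm. The norm of [L] is at most one because the essential errors are at most the
    errors. It is attained at a multiple of [x_1 ^ k]: its error on a cube of side [r] is
    at most [r ^ k], where [r ^ (k p) <= r ^ d] because [d / p <= k], and the volumes of
    the cubes of a packing have bounded sum; its error on the unit cube is positive. *)

(** * Cubes and half balls in the unit cube *)

Section geometry.
Context (R : realType) (d : nat).
Implicit Types (x y : Qd R d) (v a : 'rV[R]_d) (s : 'I_d -> bool).

Lemma exists_le_all (I : finType) (g : I -> R) : (forall i, 0 < g i) ->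
  exists2 e, 0 < e & forall i, e <= g i.
Proof.
move=> g0; exists (\big[Order.min/1]_i g i); first by apply/lt_bigmin.
by move=> i; exact: bigmin_le.
Qed.

Definition mkQd v (h : unit_cube R d v) : Qd R d := exist _ v (mem_set h).

Lemma mkQdE v (h : unit_cube R d v) : Qd_val (mkQd h) = v.
Proof. by []. Qed.

Lemma Qd_in x : unit_cube R d (Qd_val x).
Proof. by case: x => v h; exact: set_mem h. Qed.

Lemma Qd01 x i : 0 <= x 0 i <= 1.
Proof. by have := Qd_in x i; rewrite !mxE add0r. Qed.

Lemma Qd_inj x y : (forall i, x 0 i = y 0 i) -> x = y.
Proof.
move=> xy; apply/val_inj => /=; apply/rowP => i; exact: xy.
Qed.

Lemma Qd_neq x y : x <> y -> exists i, x 0 i != y 0 i.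
Proof.
move=> xy; apply: contrapT => h; apply: xy; apply: Qd_inj => i.
by apply: contrapT => /eqP hi; apply: h; exists i.
Qed.

Definition qball x (t : R) := [set y : Qd R d | forall j, `|y 0 j - x 0 j| < t].

(** Half balls bounded by a coordinate hyperplane, rather than orthants: in dimension at
    least two those in different coordinate directions overlap, which is what makes the
    limits along them agree. *)
Definition hball (i : 'I_d) (b : bool) x (t : R) :=
  [set y | qball x t y /\ (if b then x 0 i < y 0 i else y 0 i < x 0 i)].

Definition valid (i : 'I_d) (b : bool) x := if b then x 0 i < 1 else 0 < x 0 i.

Lemma valid_exists i x : exists b, valid i b x.
Proof.
have /andP[x0 x1] := Qd01 x i.
have [h|h] := ltP (x 0 i) 1; first by exists true.
by exists false; rewrite /valid; lra.
Qed.

Lemma valid_hball i b x t y : hball i b x t y -> valid i b x.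
Proof.
by case=> _; rewrite /valid; have := Qd01 y i; case: b => /andP[y0 y1] h; lra.
Qed.

Lemma neq_hball x y t : qball x t y -> y <> x -> exists i b, hball i b x t y.
Proof.
move=> xy /Qd_neq[i]; rewrite neq_lt => /orP[h|h].
  by exists i, false.
by exists i, true.
Qed.

Lemma hball_neq i b x t y : hball i b x t y -> y <> x.
Proof. by move=> [_ +] yx; rewrite yx; case: b; rewrite ltxx. Qed.

Lemma qball_le x t t' : t <= t' -> qball x t `<=` qball x t'.
Proof. by move=> tt y xy j; exact: lt_le_trans tt. Qed.

Lemma hball_le i b x t t' : t <= t' -> hball i b x t `<=` hball i b x t'.
Proof. by move=> tt y [xy h]; split => //; exact: qball_le xy. Qed.

Lemma qballxx x t : 0 < t -> qball x t x.
Proof. by move=> t0 j; rewrite subrr normr0. Qed.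

Lemma nbhs_QdP x (A : set (Qd R d)) :
  nbhs x A <-> exists2 t, 0 < t & qball x t `<=` A.
Proof.
split.
  rewrite nbhsE => -[U [[B oB BU] Ux] UA].
  have : nbhs (Qd_val x) B.
    by apply: open_nbhs_nbhs; split => //; rewrite -BU in Ux.
  move=> /nbhs_ballP[t /= t0 tB]; exists t => // y xy; apply: UA.
  rewrite -BU; apply: tB; split => // i j; rewrite ord1 /ball /= distrC; exact: xy.
move=> [t t0 tA]; rewrite nbhsE.
exists ((@Qd_val R d) @^-1` (ball (Qd_val x) t)°); last first.
  move=> y /= /interior_subset xy; apply: tA => j.
  by have [_ /(_ 0 j)] := xy; rewrite /ball /= distrC.
split; first by exists (ball (Qd_val x) t)° => //; exact: open_interior.
exact: (nbhsx_ballx (Qd_val x) _ t0).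
Qed.

Lemma hball_open i b x t y : hball i b x t y ->
  exists2 e, 0 < e & qball y e `<=` hball i b x t.
Proof.
move=> [xy h].
have [e e0 he] : exists2 e, 0 < e & forall j, e <= t - `|y 0 j - x 0 j|.
  by apply: exists_le_all => j; rewrite subr_gt0.
have [e' e'0 he'] : exists2 e', 0 < e' & e' <= (if b then y 0 i - x 0 i else x 0 i - y 0 i).
  by exists (if b then y 0 i - x 0 i else x 0 i - y 0 i) => //; case: b h {he}; lra.
exists (Num.min e e'); first by rewrite lt_min e0.
move=> z yz; split => [j|].
  have := yz j; rewrite lt_min => /andP[zj _]; have := he j.
  have := ler_normD (z 0 j - y 0 j) (y 0 j - x 0 j).
  by rewrite [_ + _](_ : _ = z 0 j - x 0 j); [lra|ring].
have := yz i; rewrite lt_min => /andP[_]; rewrite ltr_norml => /andP[z1 z2].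
by case: b h he' {he}; lra.
Qed.

(** The lower corner of a cube of side [r] that lies within distance [2 * r] of [v],
    inside the open orthant of vertex [v] with signs [s]; such cubes show that sets which
    meet all cubes accumulate at [v] from every direction. *)
Definition corner s v (r : R) : 'rV[R]_d :=
  \row_j (if s j then v 0 j + r else v 0 j - 2 * r).

Definition points_in s v a (r : R) :=
  forall j, if s j then v 0 j < a 0 j + r else a 0 j < v 0 j.

Lemma corner_sub s v a r : 0 < r -> cube a r v -> points_in s v a r ->
  exists2 e, 0 < e & forall e', 0 < e' <= e -> cube (corner s v e') e' `<=` cube a r.
Proof.
move=> r0 av sv.
have [e e0 he] : exists2 e, 0 < e & forall j, e <= (if s j then a 0 j + r - v 0 j else v 0 j - a 0 j) / 2.
  by apply: exists_le_all => j; have := sv j; case: (s j); lra.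
exists e => // e' /andP[e'0 ee'] w hw j.
have := hw j; have := he j; have := av j; rewrite !mxE.
by case: (s j) => /andP[? ?] ? /andP[? ?]; lra.
Qed.

Lemma corner_side s v r w : 0 < r -> cube (corner s v r) r w -> forall j,
  `|w 0 j - v 0 j| <= 2 * r /\ (if s j then v 0 j < w 0 j else w 0 j < v 0 j).
Proof.
move=> r0 h j; have := h j; rewrite !mxE ler_norml.
by case: (s j) => /andP[? ?]; split; lra.
Qed.

Lemma points_in_exists v a r : 0 < r -> cube a r v -> exists s, points_in s v a r.
Proof.
move=> r0 av; exists (fun j => v 0 j < a 0 j + r) => j.
by have /andP[? ?] := av j; case: ltP => //; lra.
Qed.

Lemma points_in_exists1 v a r i b : 0 < r -> cube a r v ->
  (if b then v 0 i < a 0 i + r else a 0 i < v 0 i) ->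
  exists2 s, points_in s v a r & s i = b.
Proof.
move=> r0 av hb.
exists (fun j => if j == i then b else v 0 j < a 0 j + r); last by rewrite eqxx.
move=> j; case: eqP => [->//|_].
by have /andP[? ?] := av j; case: ltP => //; lra.
Qed.

Lemma cubexx a r : 0 <= r -> cube a r a.
Proof. by move=> r0 j; lra. Qed.

Lemma unit_cubeE a r : 0 < r -> cube a r `<=` unit_cube R d ->
  forall j, 0 <= a 0 j /\ a 0 j + r <= 1.
Proof.
move=> r0 h j; split.
  by have /(_ j) := h _ (cubexx a (ltW r0)); rewrite !mxE => /andP[].
have /(_ j) : unit_cube R d (\row_j (a 0 j + r)).
  by apply: h => k; rewrite !mxE; lra.
by rewrite !mxE add0r => /andP[].
Qed.

Lemma cube_sub_unit a r : (forall j, 0 <= a 0 j /\ a 0 j + r <= 1) ->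
  cube a r `<=` unit_cube R d.
Proof.
move=> h v av j; have := h j; have := av j; rewrite !mxE add0r.
by move=> /andP[? ?] [? ?]; lra.
Qed.

Lemma cube_side_le1 (i : 'I_d) a r : 0 < r -> cube a r `<=` unit_cube R d -> r <= 1.
Proof. by move=> r0 /(unit_cubeE r0)/(_ i)[? ?]; lra. Qed.

Lemma interior_small_cube (A : set 'rV[R]_d) v : A° v ->
  exists a r, [/\ 0 < r & cube a r `<=` A].
Proof.
move=> /nbhs_ballP[t /= t0 tA]; exists v, (t / 2); split; first by lra.
move=> w vw; apply: tA; split => // i j; rewrite ord1 /ball /= distrC ger0_norm.
  by have /andP[? ?] := vw j; lra.
by have /andP[? ?] := vw j; lra.
Qed.

Lemma center_interior (A : set 'rV[R]_d) a r : 0 < r -> cube a r `<=` A ->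
  A° (\row_j (a 0 j + r / 2)).
Proof.
move=> r0 aA; apply/nbhs_ballP; exists (r / 2) => /=; first by lra.
move=> w [_ vw]; apply: aA => j; have := vw 0 j; rewrite /ball /= !mxE ltr_norml.
by move=> /andP[? ?]; lra.
Qed.

(** Two cubes whose interiors meet share a small cube; in this form the disjointness of
    interiors is easy to use and to transport. *)
Lemma packing_eq (pi : set (set 'rV[R]_d)) Q Q' a r : packing pi -> pi Q -> pi Q' ->
  0 < r -> cube a r `<=` Q -> cube a r `<=` Q' -> Q = Q'.
Proof.
move=> [_ _ tpi] hQ hQ' r0 aQ aQ'; apply: tpi => //.
by exists (\row_j (a 0 j + r / 2)); split; exact: center_interior aQ || exact: center_interior aQ'.
Qed.

End geometry.

(** * Outer measures of unions and of cubes *)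

Section outer_sums.
Context (R : realType) (T : Type) (mu : {outer_measure set T -> \bar R}).
Local Open Scope ereal_scope.

Lemma outer_bigcup_countable (I : choiceType) (C : set I) (A : I -> set T) :
  countable C -> mu (\bigcup_(c in C) A c) <= \esum_(c in C) mu (A c).
Proof.
move=> /countable_injP[f injf].
pose J n := C `&` f @^-1` [set n].
have CJ : C = \bigcup_n J n.
  apply/seteqP; split => [c Cc|c [n _ []]//]; by exists (f c).
have tJ : trivIset setT J by move=> m n _ _ [c [[_ /= <-] [_ /= <-]]].
have mu0 c : 0 <= mu (A c) by exact: outer_measure_ge0.
rewrite [in leRHS]CJ esum_bigcupT// -nneseries_esumT; last first.
  by move=> n; exact: esum_ge0.
apply: (@le_trans _ _ (\sum_(n <oo) mu (\bigcup_(c in J n) A c))).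
  apply: le_trans (outer_measure_sigma_subadditive mu _).
  apply: le_outer_measure => x [c Cc Ax]; exists (f c) => //.
  by exists c.
apply: lee_nneseries => [n _ _|n _]; first exact: outer_measure_ge0.
have [[c Jc]|nJ] := pselect (exists c, J n c).
  rewrite (_ : J n = [set c]) ?bigcup_set1 ?esum_set1//.
  apply/seteqP; split=> [c' [Cc' fc']|_ ->//]; case: Jc => Cc fc.
  apply: injf; [exact: mem_set|exact: mem_set|].
  by rewrite (fc : f c = n) (fc' : f c' = n).
rewrite (_ : J n = set0); last by rewrite -subset0 => c Jc; apply: nJ; exists c.
by rewrite bigcup_set0 outer_measure0 esum_set0.
Qed.

Lemma outer_bigcup_finite (I : finType) (P : pred I) (A : I -> set T) (X : set T) :
  (forall x, X x -> exists2 i, P i & A i x) -> mu X <= \sum_(i | P i) mu (A i).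
Proof.
move=> XA; apply: (@le_trans _ _ (mu [set x | exists2 i, i \in index_enum I & P i /\ A i x])).
  by apply: le_outer_measure => x /XA[i Pi Ai]; exists i => //; rewrite mem_index_enum.
elim: (index_enum I) => [|i s IH].
  rewrite big_nil [X in mu X](_ : _ = set0) ?outer_measure0//.
  by rewrite -subset0 => x [].
rewrite big_cons; apply: (@le_trans _ _ (mu ((if P i then A i else set0) `|`
    [set x | exists2 i, i \in s & P i /\ A i x]))).
  apply: le_outer_measure => x [j]; rewrite in_cons => /orP[/eqP ->|js] [Pj Aj].
    by left; rewrite Pj.
  by right; exists j.
apply: le_trans (outer_measureU2 mu _ _) _.
by case: ifP => _; rewrite ?outer_measure0 ?add0e// leeD2l.
Qed.

End outer_sums.

Section grid.
Context (R : realType).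

Lemma count_itv (N : nat) (h lo l : R) : 0 < h -> 0 <= l ->
  \sum_(n < N | lo <= h * n%:R <= lo + l) (1 : R) <= l / h + 1.
Proof.
move=> h0 l0.
suff [] : \sum_(n < N | lo <= h * n%:R <= lo + l) (1 : R) <= l / h + 1 /\
  \sum_(n < N | lo <= h * n%:R <= lo + l) (1 : R) <= Num.max 0 (N%:R - lo / h) by [].
have lh0 : 0 <= l / h by rewrite divr_ge0 // ltW.
elim: N => [|N [IH1 IH2]].
  by rewrite big_ord0; split; [lra|rewrite le_max lexx].
rewrite big_mkcond big_ord_recr -big_mkcond /=.
case: ifP => [/andP[h1 h2]|_]; last first.
  rewrite addr0; split => //; apply: le_trans IH2 _.
  by rewrite ge_max !le_max lexx /=; apply/orP; right; rewrite -natr1; lra.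
have h3 : lo / h <= N%:R by rewrite ler_pdivrMr // mulrC.
have h4 : N%:R <= lo / h + l / h by rewrite -mulrDl ler_pdivlMr // mulrC.
have IH3 : \sum_(n < N | lo <= h * n%:R <= lo + l) (1 : R) <= N%:R - lo / h.
  by apply: le_trans IH2 _; rewrite ge_max lexx andbT; lra.
split; first by lra.
by rewrite le_max; apply/orP; right; rewrite -natr1; lra.
Qed.

Lemma grid_point (h x : R) (n : nat) : 0 < h -> (0 < n)%N -> 0 <= x <= h * n%:R ->
  exists k : 'I_n, h * k%:R <= x <= h * (k%:R + 1).
Proof.
move=> h0; case: n => // n _; elim: n => [|n IH] /andP[x0 x1].
  by exists ord0; rewrite /= mulr0 x0 add0r.
have [xn|xn] := leP x (h * n.+1%:R).
  have [|k hk] := IH; first by rewrite x0.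
  by exists (widen_ord (leqnSn _) k).
by exists ord_max; rewrite /= (ltW xn) /=; rewrite natr1.
Qed.

Lemma natr_truncn_le (x : R) : 0 <= x -> exists2 n : nat, (0 < n)%N & x < n%:R.
Proof. by move=> x0; exists (Num.truncn x).+1 => //; exact: truncnS_gt. Qed.

End grid.

Section cubes_outer.
Context (R : realType) (d : nat).
Implicit Types (a v : 'rV[R]_d) (r s : R).
Local Open Scope ereal_scope.

Notation mu := (@lebesgue_outer R d).

Lemma outer_cube_le a r : (0 < r)%R -> mu (cube a r) <= (r ^+ d)%:E.
Proof.
move=> r0; apply: ereal_inf_lbound; exists [set (a, r)].
  split; [exact: countable1|by move=> _ ->|by move=> v av; exists (a, r)].
by rewrite esum_set1 // lee_fin exprn_ge0 // ltW.
Qed.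

(** Counting the points of a fine grid in a cube that they fill and in the cubes of
    a finite cover bounds the volume of the cover from below. *)
Lemma outer_cube_ge a r : (0 < r)%R -> ((r / 4) ^+ d)%:E <= mu (cube a r).
Proof.
move=> r0; apply: le_ereal_inf_tmp => _ [C [_ C0 aC] <-].
pose e (c : 'rV[R]_d * R) : set 'rV[R]_d :=
  cube (\row_j (c.1 0 j - c.2 / 2))%R (2 * c.2)%R.
have : compact (cube a r).
  have h := @rV_compact R d (fun j => `[a 0%R j, (a 0 j + r)%R]%classic)
    (fun j => @segment_compact _ _ _).
  suff -> : cube a r =
    [set v | forall j, `[a 0%R j, (a 0 j + r)%R]%classic (v ord0 j)] by exact: h.
  by apply/seteqP; split => v av j; have := av j; rewrite /= in_itv.
rewrite compact_cover => /(_ _ C (fun c => (e c)°) (fun c _ => open_interior _))[].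
  move=> v /aC[c Cc cv]; exists c => //; apply/nbhs_ballP.
  exists (c.2 / 2)%R => /=; first by rewrite divr_gt0 // C0.
  move=> w [_ vw] j; have /andP[v1 v2] := cv j; have := vw 0%R j.
  by rewrite /ball /= !mxE ltr_norml => /andP[v3 v4]; lra.
move=> D DC aD; apply: esum_ge; exists [set` D].
  by split; [exact: finite_fset|move=> c /DC /set_mem].
rewrite fsbig_finite //= set_fsetK sumEFin lee_fin.
have [h h0 hD] : exists2 h, (0 < h)%R & forall c, c \in D -> (h <= c.2)%R.
  have [h h0 hD] := @exists_le_all R D (fun c => (val c).2)
    (fun c => C0 _ (set_mem (DC _ (valP c)))).
  by exists h => // c cD; exact: (hD [` cD]%fset).
have [N N0 hN] := natr_truncn_le (divr_ge0 (ltW r0) (ltW h0)).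
have N0' : (0 < N%:R :> R)%R by rewrite ltr0n.
pose s : R := (r / N%:R)%R; have s0 : (0 < s)%R by rewrite divr_gt0.
have sD c : c \in D -> (s <= c.2)%R.
  move=> /hD; apply: le_trans; rewrite /s ler_pdivrMr // mulrC -ler_pdivrMr //.
  exact: ltW.
pose inD (c : 'rV[R]_d * R) (z : {ffun 'I_d -> 'I_N}) := [forall j,
  (c.1 0 j - c.2 / 2 - a 0 j <= s * (z j)%:R <= c.1 0 j - c.2 / 2 - a 0 j + 2 * c.2)%R].
have count c : c \in D -> (\sum_(z | inD c z) 1 <= (4 * c.2 / s) ^+ d :> R)%R.
  move=> cD; have c0 : (0 < c.2)%R by apply: lt_le_trans (sD _ cD).
  pose Q j := [pred n : 'I_N | (c.1 0 j - c.2 / 2 - a 0 j <= s * n%:R <= c.1 0 j - c.2 / 2 - a 0 j + 2 * c.2)%R].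
  have -> : (\sum_(z | inD c z) 1 = \sum_(z in family Q) \prod_(j < d) 1 :> R)%R.
    by apply: eq_big => [z|z _]; rewrite ?big1 //; apply/forallP/familyP.
  rewrite -(bigA_distr_big_dep Q (fun _ _ => 1%R)) /= -[X in (_ ^+ X)%R]card_ord -prodr_const.
  apply: ler_prod => j _; rewrite sumr_ge0 //=.
  apply: le_trans (count_itv _ _ s0 _) _; first by lra.
  suff : (1 <= c.2 / s)%R by lra.
  by rewrite ler_pdivlMr // mul1r sD.
have : (N%:R ^+ d <= \sum_(c <- D) (4 * c.2 / s) ^+ d :> R)%R.
  rewrite big_seq; apply: (le_trans _ (ler_sum _ (fun c cD => count c cD))).
  rewrite -big_seq.
  under eq_bigr do rewrite big_mkcond.
  rewrite exchange_big /=.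
  have -> : (N%:R ^+ d = \sum_(z : {ffun 'I_d -> 'I_N}) 1 :> R)%R.
    by rewrite sumr_const card_ffun !card_ord natrX.
  apply: ler_sum => z _.
  have [c cD cz] : exists2 c, c \in D & inD c z.
    have [|c cD /interior_subset cz] := aD (\row_j (a 0 j + s * (z j)%:R))%R.
      move=> j; rewrite mxE.
      have z0 : (0 <= s * (z j)%:R)%R by rewrite mulr_ge0 // ltW.
      have z1 : (s * (z j)%:R <= r)%R.
        rewrite /s mulrAC ler_pdivrMr // ler_pM2l // ler_nat.
        by rewrite ltnW.
      by apply/andP; split; lra.
    exists c => //; apply/forallP => j; have := cz j; rewrite !mxE.
    by move=> /andP[? ?]; apply/andP; split; lra.
  rewrite (big_rem c) //= cz lerDl sumr_ge0 // => c' _.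
  by case: ifP.
have -> : (\sum_(c <- D) (4 * c.2 / s) ^+ d = (4 / s) ^+ d * \sum_(c <- D) c.2 ^+ d :> R)%R.
  by rewrite mulr_sumr; apply: eq_bigr => c _; rewrite -exprMn; congr (_ ^+ _)%R; ring.
rewrite -ler_pdivrMl ?exprn_gt0 ?divr_gt0 // -exprVn -exprMn; apply: le_trans.
by rewrite le_eqVlt; apply/orP; left; apply/eqP; congr (_ ^+ _)%R; rewrite /s; field; lra.
Qed.

End cubes_outer.

(** * Measurability of open sets *)

Section half_spaces.
Context (R : realType) (d : nat).
Implicit Types (a v : 'rV[R]_d) (r s : R).
Local Open Scope ereal_scope.

Notation mu := (@lebesgue_outer R d).

Lemma outer_point (hd : (0 < d)%N) v : mu [set v] = 0.
Proof.
apply/eqP; rewrite eq_le lebesgue_outer_ge0 andbT; apply/lee_addgt0Pr => e e0.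
rewrite add0e; pose r : R := Num.min e 1%R.
have r0 : (0 < r)%R by rewrite lt_min e0 ltr01.
apply: (@le_trans _ _ (mu (cube v r))).
  by apply: le_lebesgue_outer => w ->; apply: cubexx; exact: ltW.
apply: le_trans (outer_cube_le _ r0) _; rewrite lee_fin.
apply: (@le_trans _ _ r); last by rewrite ge_min lexx.
by apply: ler_iXnr => //; [exact: ltW|rewrite ge_min lexx orbT].
Qed.

Definition box a (i : 'I_d) r s : set 'rV[R]_d :=
  [set v | forall j, (a 0 j <= v 0 j <= a 0 j + (if j == i then s else r))%R].

(** Cover the box by a grid of cubes of side [r / N], the last layer of which may stick
    out in the direction [i]. *)
Lemma outer_box_le a i r s (N : nat) : (0 < r)%R -> (0 <= s)%R -> (0 < N)%N ->
  mu (box a i r s) <= (r ^+ d.-1 * (s + r / N%:R))%:E.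
Proof.
move=> r0 s0 N0; have N0' : (0 < N%:R :> R)%R by rewrite ltr0n.
pose h : R := (r / N%:R)%R; have h0 : (0 < h)%R by rewrite divr_gt0.
have sh0 : (0 <= s / h)%R by rewrite divr_ge0 // ltW.
pose m := (Num.truncn (s / h)).+1.
have /andP[m1 m2] := truncn_itv sh0.
have hm1 : (s <= h * m%:R)%R by rewrite mulrC -ler_pdivrMr // ltW.
have hm2 : (h * m%:R <= s + h)%R.
  have : (h * (Num.truncn (s / h))%:R <= s)%R by rewrite mulrC -ler_pdivlMr.
  by rewrite /m -natr1; lra.
pose n (j : 'I_d) := if j == i then m else N.
pose K := maxn m N.
have nK j : (n j <= K)%N by rewrite /n /K; case: ifP => _; rewrite ?leq_maxl ?leq_maxr.
have n0 j : (0 < n j)%N by rewrite /n; case: ifP.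
have hn j : ((if j == i then s else r) <= h * (n j)%:R)%R.
  rewrite /n; case: ifP => _ //; rewrite /h -mulrA mulVf ?mulr1 //; lra.
pose Q (j : 'I_d) := [pred k : 'I_K | (k < n j)%N].
pose c (z : {ffun 'I_d -> 'I_K}) : 'rV[R]_d := (\row_j (a 0 j + h * (z j)%:R))%R.
apply: (@le_trans _ _ (\sum_(z in family Q) mu (cube (c z) h))).
  apply: (@outer_bigcup_finite _ _ mu _ _ (fun z => cube (c z) h)) => v av.
  have /(_ _)/cid z j : exists k : 'I_(n j), (h * k%:R <= v 0 j - a 0 j <= h * (k%:R + 1))%R.
    apply: grid_point => //; have /andP[? ?] := av j; have := hn j.
    by case: ifP (av j) => _ /andP[? ?] ?; apply/andP; split; lra.
  exists [ffun j => widen_ord (nK j) (sval (z j))].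
    by apply/familyP => j; rewrite ffunE inE /= ltn_ord.
  move=> j; rewrite !mxE ffunE /=; case: (z j) => k /= /andP[? ?].
  by apply/andP; split; lra.
apply: (@le_trans _ _ (\sum_(z in family Q) (h ^+ d)%:E)).
  by apply: lee_sum => z _; exact: outer_cube_le.
rewrite sumEFin lee_fin.
have -> : (\sum_(z in family Q) h ^+ d = \sum_(z in family Q) \prod_(j < d) h :> R)%R.
  by apply: eq_bigr => z _; rewrite prodr_const card_ord.
rewrite -(bigA_distr_big_dep Q (fun _ _ => h)) /=.
have -> : (\prod_(j < d) \sum_(k < K | Q j k) h = \prod_(j < d) (h * (n j)%:R) :> R)%R.
  apply: eq_bigr => j _; rewrite sumr_const -[LHS]mulr_natr; congr (h * GRing.natmul _ _)%R.
  rewrite -[RHS]card_ord -(fintype.card_image (f := widen_ord (nK j))); last first.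
    by move=> x y /(congr1 val) /= /val_inj.
  apply: eq_card => k; apply/idP/fintype.imageP => [kn|[x _ ->]].
    by exists (Ordinal kn) => //; apply: val_inj.
  exact: (ltn_ord x).
rewrite (bigD1 i) //= /n eqxx mulrC.
rewrite (eq_bigr (fun=> r)); last first.
  by move=> j /negbTE ->; rewrite /h -mulrA mulVf ?mulr1 //; lra.
rewrite prodr_const cardC1 card_ord ler_wpM2l // exprn_ge0 //; exact: ltW.
Qed.

(** A hyperplane orthogonal to an axis splits a cube into two boxes whose outer
    measures add up to the volume of the cube, because boxes can be filled with small
    cubes. *)
Lemma outer_cube_split a i r (c : R) : (0 < r)%R ->
  mu (cube a r `&` [set v | v 0 i < c]%R) + mu (cube a r `&` [set v | c <= v 0 i]%R)
  <= (r ^+ d)%:E.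
Proof.
move=> r0; have [ca|ac] := leP c (a 0%R i).
  rewrite [X in mu X](_ : _ = set0); last first.
    by rewrite -subset0 => v [/(_ i)/andP[? _] /= ?]; lra.
  rewrite lebesgue_outer0 add0e; apply: le_trans (outer_cube_le a r0).
  by apply: le_lebesgue_outer => v [].
have [ca|car] := ltP (a 0 i + r)%R c.
  rewrite addeC [X in mu X](_ : _ = set0); last first.
    by rewrite -subset0 => v [/(_ i)/andP[_ ?] /= ?]; lra.
  rewrite lebesgue_outer0 add0e; apply: le_trans (outer_cube_le a r0).
  by apply: le_lebesgue_outer => v [].
pose b : 'rV[R]_d := (\row_j (if j == i then c else a 0 j))%R.
apply/lee_addgt0Pr => e e0.
have d0 : (0 < d)%N by case: i {b ac car} => m; exact: leq_ltn_trans.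
have rd : (r ^+ d = r ^+ d.-1 * r)%R by rewrite -exprSr prednK.
have r1 : (0 < r ^+ d.-1)%R by rewrite exprn_gt0.
have [N N0 hN] := natr_truncn_le (divr_ge0 (mulr_ge0 (ler0n R 2) (exprn_ge0 d (ltW r0))) (ltW e0)).
have N0' : (0 < N%:R :> R)%R by rewrite ltr0n.
have h1 : mu (cube a r `&` [set v | v 0 i < c]%R) <= (r ^+ d.-1 * (c - a 0 i + r / N%:R))%:E.
  apply: le_trans (outer_box_le a i r0 _ N0); last by lra.
  apply: le_lebesgue_outer => v [av /= vc] j; have /andP[? ?] := av j.
  by case: eqP => [ji|_]; apply/andP; split => //; rewrite ji; lra.
have h2 : mu (cube a r `&` [set v | c <= v 0 i]%R) <= (r ^+ d.-1 * (a 0 i + r - c + r / N%:R))%:E.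
  apply: le_trans (outer_box_le b i r0 _ N0); last by lra.
  apply: le_lebesgue_outer => v [av /= vc] j; have /andP[? ?] := av j.
  by rewrite mxE; case: eqP => [ji|_]; [subst j|]; apply/andP; split => //; lra.
apply: le_trans (leeD h1 h2) _; rewrite -!EFinD lee_fin -mulrDr.
have -> : (c - a 0 i + r / N%:R + (a 0 i + r - c + r / N%:R) = r + 2 * r / N%:R)%R by ring.
rewrite mulrDr rd lerD2l mulrA ler_pdivrMr // mulrCA -rd.
by move: hN; rewrite ltr_pdivrMr // [(_ * e)%R]mulrC => /ltW.
Qed.

End half_spaces.

Section measurable_Qd.
Context (R : realType) (d : nat).
Local Open Scope ereal_scope.

Lemma measurable_coord_lt (i : 'I_d) (c : R) :
  measurable ([set x : Qd R d | (x 0 i < c)%R] : set (QdL R d)).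
Proof.
apply: le_caratheodory_measurable => X.
rewrite /leb_outer /= /lebesgue_outer_Qd.
apply: le_ereal_inf_tmp => _ [C [cC C0 XC] <-].
apply: (@le_trans _ _ (\esum_(k in C) lebesgue_outer (cube k.1 k.2 `&` [set v | v 0 i < c]%R) +
  \esum_(k in C) lebesgue_outer (cube k.1 k.2 `&` [set v | c <= v 0 i]%R))).
  apply: leeD.
    apply: le_trans (outer_bigcup_countable _ _ cC).
    apply: le_lebesgue_outer => _ [x [Xx xc] <-].
    have [k Ck kx] := XC _ (ex_intro2 _ _ x Xx erefl).
    by exists k.
  apply: le_trans (outer_bigcup_countable _ _ cC).
  apply: le_lebesgue_outer => _ [x [Xx /= /negP xc] <-].
  have [k Ck kx] := XC _ (ex_intro2 _ _ x Xx erefl).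
  by exists k => //; split => //=; rewrite leNgt.
rewrite -esumD; [|by move=> *; exact: lebesgue_outer_ge0..].
by apply: le_esum => k /C0 k0; exact: outer_cube_split.
Qed.

(** An open set is the union of the cells of the grids of mesh [1 / n] that it contains. *)
Lemma measurable_open_Qd (A : set (Qd R d)) :
  (forall x, A x -> exists2 t, (0 < t)%R & qball x t `<=` A) ->
  measurable (A : set (QdL R d)).
Proof.
move=> oA.
pose B (n : nat) (z : {ffun 'I_d -> 'I_n.+1}) : set (Qd R d) :=
  \big[setI/setT]_j ([set x : Qd R d | (x 0 j < ((z j)%:R + 1) / n%:R)%R] `\`
    [set x : Qd R d | (x 0 j < (z j)%:R / n%:R)%R]).
have BE n z x : B n z x <-> forall j, ((z j)%:R / n%:R <= x 0 j < ((z j)%:R + 1) / n%:R)%R.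
  rewrite /B -bigcap_seq; split.
    by move=> h j; have [/= -> /negP] := h j (mem_index_enum j); rewrite -leNgt => ->.
  by move=> h j _; have /andP[h1 h2] := h j; split => //; apply/negP; rewrite -leNgt.
have mB n z : measurable (B n z : set (QdL R d)).
  by apply: bigsetI_measurable => j _; apply: measurableD; exact: measurable_coord_lt.
rewrite (_ : A = \bigcup_(n in [set: nat])
    \bigcup_(z in [set z | `[< B n z `<=` A >]]) B n z); last first.
  apply/seteqP; split => [x Ax|x [n _ [z /= /asboolP zA Bx]]]; last exact: zA.
  have [t t0 tA] := oA x Ax.
  have [n n0 hn] : exists2 n : nat, (0 < n)%N & (1 / t < n%:R)%R.
    by apply: natr_truncn_le; rewrite divr_ge0 // ltW.
  have n0' : (0 < n%:R :> R)%R by rewrite ltr0n.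
  have nt : (1 / n%:R < t)%R by move: hn; rewrite !ltr_pdivrMr // mulrC.
  have x01 j : (0 <= x 0 j * n%:R)%R by rewrite mulr_ge0 //; have /andP[] := Qd01 x j.
  have zn j : (Num.truncn (x 0 j * n%:R)%R < n.+1)%N.
    rewrite ltnS truncn_le_nat; have /andP[_ ?] := Qd01 x j.
    by rewrite -natr1; have : (x 0 j * n%:R <= n%:R)%R; [rewrite ler_piMl // ltW|lra].
  pose z := [ffun j => Ordinal (zn j)].
  have Bx : B n z x.
    apply/BE => j; rewrite ffunE /= ler_pdivrMr // ltr_pdivlMr // natr1.
    exact: truncn_itv.
  exists n => //; exists z => //; apply/asboolP => y /BE By; apply: tA => j.
  have /andP[y1 y2] := By j; have /andP[x1 x2] := (BE n z x).1 Bx j.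
  move: y1 y2 x1 x2 nt; rewrite mulrDl; set q := (_ / _)%R; set q' := (1 / _)%R.
  by move=> *; rewrite ltr_norml; apply/andP; split; lra.
apply: bigcup_measurable => n _; apply: fin_bigcup_measurable => [|z _]; last exact: mB.
exact: (finite_finpred (fun z => `[< B n z `<=` A >])).
Qed.

End measurable_Qd.

(** * Sets of full measure and uniform approximation *)

Section thick_filters.
Context (R : realType) (d : nat).
Implicit Types (A : set (Qd R d)) (F : set_system (Qd R d)).

(** The common features of everywhere and almost everywhere that the arguments about
    one-sided limits need, so that one argument serves [V] and [Vinf]. *)
Record thick F : Prop := Thick {
  thick_filter : Filter F;
  thick_meet : forall A, F A -> forall a r, 0 < r -> cube a r `<=` unit_cube R d ->
    exists2 y : Qd R d, A y & cube a r (Qd_val y);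
  thick_bigcap : forall A : nat -> set (Qd R d), (forall n, F (A n)) ->
    F (\bigcap_n A n) }.

Definition sure : set_system (Qd R d) := [set A | forall x, A x].

Definition almost : set_system (Qd R d) := almost_everywhere (leb R d).

Lemma thick_sure : thick sure.
Proof.
split.
- constructor; [by []|move=> A B hA hB x|move=> A B AB hA x].
    by split.
  exact: AB.
- move=> A hA a r r0 ar; have aQ := ar _ (cubexx a (ltW r0)).
  by exists (mkQd aQ) => //; apply: cubexx; exact: ltW.
- by move=> A hA x n _; exact: hA.
Qed.

Lemma outer_null_measurable A : leb_outer R d A = 0%E ->
  measurable (A : set (QdL R d)).
Proof.
move=> A0; apply: le_caratheodory_measurable => X.
have -> : leb_outer R d (X `&` A) = 0%E.
  apply/eqP; rewrite eq_le outer_measure_ge0 andbT -A0.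
  by apply: le_outer_measure => x [].
by rewrite add0e; apply: le_outer_measure => x [].
Qed.

Lemma outer_null_almost A : leb_outer R d A = 0%E -> almost (~` A).
Proof.
move=> A0; exists A; split => //; first exact: outer_null_measurable.
by rewrite setCK.
Qed.

Lemma outer_countable (hd : (0 < d)%N) A : countable A -> leb_outer R d A = 0%E.
Proof.
move=> cA; apply/eqP; rewrite eq_le outer_measure_ge0 andbT.
have -> : A = \bigcup_(x in A) [set x].
  by apply/seteqP; split=> [x Ax|x [y Ay ->//]]; exists x.
apply: le_trans (outer_bigcup_countable _ _ cA) _.
rewrite esum1 // => x _ /=.
by rewrite /lebesgue_outer_Qd image_set1 outer_point.
Qed.

Lemma leb_QdT_gt0 : (0 < leb R d setT)%E.
Proof.
rewrite /leb /= /lebesgue_outer_Qd.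
apply: (@lt_le_trans _ _ ((1 / 4) ^+ d)%:E); first by rewrite lte_fin exprn_gt0.
apply: le_trans (outer_cube_ge 0 ltr01) _; apply: le_lebesgue_outer => v hv.
by exists (mkQd hv).
Qed.

Lemma thick_almost : thick almost.
Proof.
split; first exact: (@ae_filter_ringOfSetsType _ (QdL R d) R (leb R d)).
- move=> A [B [mB B0 AB]] a r r0 ar; apply: contrapT => hA.
  suff : (((r / 4) ^+ d)%:E <= leb R d B)%E.
    by rewrite B0 lee_fin leNgt exprn_gt0 // divr_gt0.
  apply: le_trans (outer_cube_ge a r0) _.
  rewrite /leb /= /lebesgue_outer_Qd; apply: le_lebesgue_outer => v av.
  exists (mkQd (ar _ av)) => //; apply: AB => Av.
  by apply: hA; exists (mkQd (ar _ av)).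
- move=> A hA; have := ae_foralln hA.
  by apply: filterS => x hx n _; exact: hx.
Qed.

Lemma sure_almost A : sure A -> almost A.
Proof. by move=> hA; exact: (@aeW _ (QdL R d) _ (leb R d)). Qed.

Lemma thickT F A : thick F -> sure A -> F A.
Proof.
move=> tF hA; have ? := thick_filter tF.
by apply: (@filterS _ F _ setT) => //; exact: filterT.
Qed.

Lemma thickI F A B : thick F -> F A -> F B -> F (A `&` B).
Proof. by move=> tF; have ? := thick_filter tF; exact: filterI. Qed.

Lemma thickS F A B : thick F -> A `<=` B -> F A -> F B.
Proof. by move=> tF; have ? := thick_filter tF; exact: filterS. Qed.

Lemma qball_open (x : Qd R d) t y : qball x t y ->
  exists2 e, 0 < e & qball y e `<=` qball x t.
Proof.
move=> xy; have [e e0 he] : exists2 e, 0 < e & forall j, e <= t - `|y 0 j - x 0 j|.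
  by apply: exists_le_all => j; rewrite subr_gt0.
exists e => // z yz j; have := yz j; have := he j.
have := ler_normD (z 0 j - y 0 j) (y 0 j - x 0 j).
by rewrite [_ + _](_ : _ = z 0 j - x 0 j); [lra|ring].
Qed.

(** A sublevel set is the union of its interior and of points of discontinuity. *)
Lemma measurable_countable_discontinuities (hd : (0 < d)%N) (f : Qd R d -> R) (J : set (Qd R d)) :
  countable J ->
  (forall x, ~ J x -> forall e, 0 < e ->
    exists2 t, 0 < t & forall y, qball x t y -> `|f y - f x| < e) ->
  measurable_fun [set: QdL R d] (f : QdL R d -> R).
Proof.
move=> cJ fJ.
apply: (measurability _ (measurable_realfun.RGenInftyO.measurableE R)).
move=> _ [_ [a ->] <-]; rewrite setTI.
pose O : set (Qd R d) := [set x | exists2 t, 0 < t & qball x t `<=` f @^-1` `]-oo, a[].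
rewrite (_ : f @^-1` _ = O `|` ((f @^-1` `]-oo, a[) `&` J)); last first.
  apply/seteqP; split => [x fx|x [[t t0 tO]|[]//]]; last first.
    by apply: tO; exact: qballxx.
  have [Jx|Jx] := pselect (J x); first by right.
  left; have := fx; rewrite /= in_itv /= => fa.
  have [t t0 ht] := fJ x Jx (a - f x) (ltac:(lra)).
  exists t => // y /ht; rewrite /= in_itv /= ltr_norml => /andP[? ?]; lra.
apply: measurableU.
  apply: measurable_open_Qd => x [t t0 tO].
  exists t => // y /qball_open[e e0 he]; exists e => // z /he; exact: tO.
apply: outer_null_measurable; apply: outer_countable => //.
by apply: sub_countable cJ; apply: subset_card_le => x [].
Qed.

End thick_filters.

Section approximation.
Context (R : realType) (d k : nat).
Implicit Types (f : Qd R d -> R) (Q : set 'rV[R]_d) (F : set_system (Qd R d)).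

(** The real-valued form in which bounds on the errors [E_sup] and [E_esssup] are used. *)
Definition near_Pk F f Q (e : R) :=
  exists2 q, @Pk R d k q & F [set x | Q (Qd_val x) -> `|f x - q x| <= e].

Lemma E_sup_near_Pk f Q e : (E_sup k f Q < e%:E)%E -> near_Pk (@sure R d) f Q e.
Proof.
move=> /ereal_inf_lt[_ [q Pq <-] he]; exists q => // x Qx; rewrite -lee_fin.
by apply: le_trans (ltW he); apply: ereal_sup_ubound; exists x.
Qed.

Lemma near_Pk_E_sup f Q e : near_Pk (@sure R d) f Q e -> (E_sup k f Q <= e%:E)%E.
Proof.
move=> [q Pq he]; apply: ereal_inf_le.
exists (ereal_sup [set `|f x - q x|%:E | x in [set x | Q (Qd_val x)]]); first by exists q.
by apply: ge_ereal_sup => _ [x Qx <-]; rewrite lee_fin; exact: he.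
Qed.

Lemma E_sup_ge0 f Q : (exists x : Qd R d, Q (Qd_val x)) -> (0 <= E_sup k f Q)%E.
Proof.
move=> [x Qx]; apply: le_ereal_inf_tmp => _ [q Pq <-].
by apply: ereal_sup_ge; exists (`|f x - q x|%:E); [exists x|rewrite lee_fin].
Qed.

Lemma Lnorm_infty_le (g : Qd R d -> R) Q e : 0 <= e ->
  ('N[leb R d]_+oo[(EFin \o g) \_ [set x : QdL R d | Q (Qd_val x)]] <= e%:E)%E <->
  almost [set x | Q (Qd_val x) -> `|g x| <= e].
Proof.
move=> e0; rewrite unlock /Lnorm leb_QdT_gt0.
split => [/ess_sup_inf.ess_supP|h].
  apply: (thickS (@thick_almost R d)) => x /= + Qx.
  by rewrite /patch mem_set.
apply/ess_sup_inf.ess_supP; apply: (thickS (@thick_almost R d) _ h) => x /= hx.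
rewrite /patch; case: ifPn => [/set_mem Qx|_] /=; last by rewrite normr0 lee_fin.
by rewrite lee_fin; exact: hx.
Qed.

Lemma E_esssup_near_Pk f Q e : (E_esssup k f Q < e%:E)%E -> near_Pk (@almost R d) f Q e.
Proof.
move=> /ereal_inf_lt[_ [q Pq <-] he]; exists q => //.
have e0 : 0 <= e by rewrite -lee_fin; apply: le_trans (ltW he); exact: Lnorm_ge0.
by apply/(@Lnorm_infty_le (fun x => f x - q x)) => //; exact: ltW.
Qed.

Lemma near_Pk_E_esssup f Q e : 0 <= e -> near_Pk (@almost R d) f Q e ->
  (E_esssup k f Q <= e%:E)%E.
Proof.
move=> e0 [q Pq /(@Lnorm_infty_le (fun x => f x - q x) _ _ e0) he].
by apply: ereal_inf_le; exists ('N[leb R d]_+oo[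
  (EFin \o (f \- q)%R) \_ [set x : QdL R d | Q (Qd_val x)]])%E => //; exists q.
Qed.

Lemma E_esssup_ge0 f Q : (0 <= E_esssup k f Q)%E.
Proof. by apply: le_ereal_inf_tmp => _ [q Pq <-]; exact: Lnorm_ge0. Qed.

End approximation.

(** * Polynomials of bounded degree *)

Section polynomials.
Context (R : realType).
Implicit Types (p : {poly R}).

Lemma poly_bounded_lipschitz p : exists2 C, 0 <= C & forall s t : R,
  0 <= s <= 1 -> 0 <= t <= 1 -> `|p.[s]| <= C /\ `|p.[s] - p.[t]| <= C * `|s - t|.
Proof.
elim/poly_ind: p => [|p c [C C0 hC]].
  by exists 0 => // s t _ _; rewrite !horner0 subrr normr0 mul0r.
exists (2 * C + `|c|); first by rewrite addr_ge0 // mulr_ge0.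
move=> s t hs ht; have [h1 h2] := hC s t hs ht; have [h3 _] := hC t s ht hs.
rewrite !hornerE; have /andP[s0 s1] := hs; split.
  apply: le_trans (ler_normD _ _) _; rewrite lerD2r normrM (ger0_norm s0).
  have : `|p.[s]| * s <= `|p.[s]| by rewrite ler_piMr.
  by lra.
have -> : p.[s] * s + c - (p.[t] * t + c) = (p.[s] - p.[t]) * s + p.[t] * (s - t).
  by ring.
apply: le_trans (ler_normD _ _) _; rewrite !normrM (ger0_norm s0).
have h4 : `|p.[s] - p.[t]| * s <= C * `|s - t|.
  by apply: le_trans h2; rewrite ler_piMr.
have h5 : `|p.[t]| * `|s - t| <= C * `|s - t| by rewrite ler_wpM2r.
have h6 : 0 <= `|c| * `|s - t| by rewrite mulr_ge0.
by rewrite !mulrDl; lra.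
Qed.

Definition node (n j : nat) : R := j%:R / n%:R.

Lemma node_inj n : (0 < n)%N -> injective (node n).
Proof.
move=> n0 i j /(congr1 (fun x => x * n%:R)).
rewrite /node -!mulrA mulVf ?mulr1; last by rewrite pnatr_eq0 -lt0n.
by move=> /eqP; rewrite eqr_nat => /eqP.
Qed.

Lemma node01 n (j : 'I_n) : 0 <= node n j <= 1.
Proof.
have n0 : (0 < n)%N by case: n j => // -[].
rewrite /node divr_ge0 //= ler_pdivrMr ?ltr0n // mul1r ler_nat.
exact: ltnW.
Qed.

Notation lag n j := (tnth (qpoly.lagrange n (node n)) j).

Lemma poly_interpolation n p : (0 < n)%N -> (size p <= n)%N ->
  p = \sum_(j < n) (p.[node n j])%:P * lag n j.
Proof. by move=> n0 pn; apply: qpoly.lagrange_gen => //; exact: node_inj. Qed.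

Lemma horner_interpolation n p x : (0 < n)%N -> (size p <= n)%N ->
  p.[x] = \sum_(j < n) p.[node n j] * (lag n j : {poly R}).[x].
Proof.
move=> n0 pn; rewrite [in LHS](poly_interpolation n0 pn) horner_sum.
by apply: eq_bigr => j _; rewrite hornerM hornerC.
Qed.

(** A polynomial of bounded degree is a combination of fixed Lagrange polynomials with
    its own values as coefficients, so a bound on these values bounds everything. *)
Lemma poly_lipschitz n : (0 < n)%N -> exists2 C, 0 <= C & forall p M,
  (size p <= n)%N -> (forall s, 0 <= s <= 1 -> `|p.[s]| <= M) ->
  forall s t, 0 <= s <= 1 -> 0 <= t <= 1 -> `|p.[s] - p.[t]| <= C * M * `|s - t|.
Proof.
move=> n0.
have /(_ _)/cid2 C j := poly_bounded_lipschitz (lag n j : {poly R}).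
exists (\sum_(j < n) s2val (C j)); first by apply: sumr_ge0 => j _; case: (C j).
move=> p M pn pM s t hs ht.
rewrite !(horner_interpolation _ n0 pn) -sumrB.
apply: le_trans (ler_norm_sum _ _ _) _; rewrite !mulr_suml; apply: ler_sum => j _.
rewrite -mulrBr normrM mulrAC mulrC.
case: (C j) => c /= c0 hc; apply: ler_pM => //; first by have [] := hc s t hs ht.
exact/pM/node01.
Qed.

(** [s ^ k] stays away from the polynomials of degree less than [k], since its top
    coefficient is a combination of its sampled values. *)
Lemma monomial_far k : exists2 c : R, 0 < c & forall p, (size p <= k)%N ->
  exists2 s, 0 <= s <= 1 & c <= `|s ^+ k - p.[s]|.
Proof.
pose S := \sum_(j < k.+1) `|(lag k.+1 j : {poly R})`_k|.
exists (1 / (S + 1)); first by rewrite divr_gt0 // ltr_wpDl // sumr_ge0.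
move=> p pk; apply: contrapT => h.
have {}h s : 0 <= s <= 1 -> `|s ^+ k - p.[s]| < 1 / (S + 1).
  by move=> hs; rewrite ltNge; apply/negP => hc; apply: h; exists s.
have S0 : 0 <= S by apply: sumr_ge0.
have sq : (size ('X^k - p)%R <= k.+1)%N.
  by rewrite (leq_trans (size_polyD _ _)) // geq_max size_polyXn leqnn size_polyN leqW.
have := congr1 (fun q : {poly R} => q`_k) (poly_interpolation (ltn0Sn k) sq).
rewrite coef_sum coefB coefXn eqxx [p`_k]nth_default // subr0 => e1.
suff : 1 <= S / (S + 1).
  by rewrite ler_pdivlMr; lra.
rewrite [leLHS]e1 /S mulr_suml; apply: le_trans (ler_norm _) _.
apply: le_trans (ler_norm_sum _ _ _) _; apply: ler_sum => j _.
rewrite coefCM normrM mulrC ler_wpM2l //.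
rewrite hornerD hornerN hornerXn -[_^-1]mul1r; apply: ltW; apply: h; exact: node01.
Qed.

Lemma size_comp_affine n p (a b : R) : (0 < n)%N -> (size p <= n)%N ->
  (size (p \Po (a *: 'X + b%:P))%R <= n)%N.
Proof.
move=> n0 pn; apply: leq_trans (size_comp_poly_leq _ _) _.
have : (size (a *: 'X + b%:P : {poly R})%R <= 2)%N.
  apply: leq_trans (size_polyD _ _) _; rewrite geq_max size_polyC.
  apply/andP; split; last by case: (_ != 0).
  by apply: leq_trans (size_scale_leq _ _) _; rewrite size_polyX.
move: (size p) pn (size _) => sp spn sr sr2.
apply: (@leq_trans (sp.-1 * 1).+1); last by lia.
by rewrite ltnS leq_mul2l; lia.
Qed.

End polynomials.

Section Pk_theory.
Context (R : realType) (d k : nat).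
Implicit Types (m : mpoly.mpoly d R) (v w : 'rV[R]_d) (q : Qd R d -> R).

Definition evalm m v : R := mpoly.meval (fun i => v 0 i) m.

Lemma size_prod_predn (I : Type) (s : seq I) (P : pred I) (g : I -> {poly R}) :
  ((size (\prod_(i <- s | P i) g i)%R).-1 <= \sum_(i <- s | P i) (size (g i)).-1)%N.
Proof.
elim: s => [|i s IH]; first by rewrite !big_nil size_poly1.
rewrite !big_cons; case: ifP => // _.
apply: leq_trans (leq_add (leqnn _) IH); move: (\prod_(j <- s | P j) g j)%R => h.
by have := size_polyMleq (g i) h; lia.
Qed.

(** The degree of each monomial bounds the degree of its restriction to a line. *)
Lemma evalm_line m v w : (mpoly.msize m <= k)%N ->
  exists2 p : {poly R}, (size p <= k)%N & forall s, evalm m (v + s *: w) = p.[s].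
Proof.
move=> mk.
pose line i : {poly R} := (v 0 i)%:P + w 0 i *: 'X.
exists (\sum_(e <- mpoly.msupp m) mpoly.mcoeff e m *: \prod_i line i ^+ e i).
  rewrite big_seq; apply: (leq_trans (size_sum _ _ _)).
  apply/bigmax_leqP_seq => e em _; apply: leq_trans (size_scale_leq _ _) _.
  apply: leq_trans mk; apply: leq_trans (mpoly.msize_mdeg_lt em).
  rewrite mpoly.mdegE; apply: leq_trans (leqSpred _) _; rewrite ltnS.
  apply: leq_trans (size_prod_predn _ _ _) _; apply: leq_sum => i _.
  have : (size (line i) <= 2)%N.
    apply: leq_trans (size_polyD _ _) _; rewrite geq_max size_polyC.
    apply/andP; split; first by case: (_ != 0).
    by apply: leq_trans (size_scale_leq _ _) _; rewrite size_polyX.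
  by have := size_poly_exp_leq (line i) (e i); nia.
move=> s; rewrite /evalm mpoly.mevalE horner_sum; apply: eq_bigr => e _.
rewrite hornerZ horner_prod; congr (_ * _); apply: eq_bigr => i _.
by rewrite horner_exp !mxE /line !hornerE mulrC.
Qed.


Lemma Pk_evalm q : @Pk R d k q -> exists2 m, (mpoly.msize m <= k)%N &
  forall x : Qd R d, q x = evalm m (Qd_val x).
Proof. by move=> [m mk ->]; exists m. Qed.

Lemma Pk_lincomb (a b : R) q q' : @Pk R d k q -> @Pk R d k q' ->
  @Pk R d k (fun x => a * q x + b * q' x).
Proof.
move=> [m mk ->] [m' mk' ->]; exists (a *: m + b *: m').
  apply: leq_trans (mpoly.msizeD_le _ _) _; rewrite geq_max.
  apply/andP; split; first exact: leq_trans (mpoly.msizeZ_le _ _) mk.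
  exact: leq_trans (mpoly.msizeZ_le _ _) mk'.
by apply/funext => x; rewrite mpoly.mevalD !mpoly.mevalZ.
Qed.

Lemma Pk_coord (i : 'I_d) (p : {poly R}) : (size p <= k)%N ->
  @Pk R d k (fun x => p.[Qd_val x 0 i]).
Proof.
move=> pk; pose X := mpoly.mpolyX R (mpoly.mnm1 i).
exists (\sum_(j < size p) p`_j *: mpoly.mpolyX R (mpoly.mnm_muln (mpoly.mnm1 i) j)).
  apply: leq_trans (mpoly.msize_sum _ _ _) _; apply/bigmax_leqP => j _.
  apply: leq_trans (mpoly.msizeZ_le _ _) _; rewrite mpoly.msizeX.
  rewrite mpoly.mdegMn mpoly.mdeg1 mul1n.
  exact: leq_trans (ltn_ord j) pk.
apply/funext => x; rewrite horner_coef raddf_sum /=; apply: eq_bigr => j _.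
rewrite mpoly.mevalZ mpoly.mevalX; congr (_ * _).
rewrite (bigD1 i) //= big1 ?mulr1 => [|i' /negbTE ii'].
  by rewrite mpoly.mulmnE mpoly.mnm1E eqxx mul1n.
by rewrite mpoly.mulmnE mpoly.mnm1E eq_sym ii' mul0n expr0.
Qed.

Lemma evalm_bounded m : exists M, forall v, unit_cube R d v -> `|evalm m v| <= M.
Proof.
exists (\sum_(e <- mpoly.msupp m) `|mpoly.mcoeff e m|) => v hv.
rewrite /evalm mpoly.mevalE; apply: le_trans (ler_norm_sum _ _ _) _.
apply: ler_sum => e _; rewrite normrM ler_piMr // normr_prod.
apply: prodr_ile1 => i _; rewrite normr_ge0 normrX /= exprn_ile1 //.
by have := hv i; rewrite !mxE add0r ler_norml => /andP[? ?]; apply/andP; split; lra.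
Qed.

(** Move from [v] to [w] one coordinate at a time: each step stays on a segment
    parallel to an axis that crosses the whole cube. *)
Lemma Pk_lipschitz (hk : (0 < k)%N) : exists2 C, 0 <= C & forall q a r M e,
  @Pk R d k q -> 0 < r -> cube a r `<=` unit_cube R d ->
  (forall y : Qd R d, cube a r (Qd_val y) -> `|q y| <= M) ->
  forall y z : Qd R d, cube a r (Qd_val y) -> cube a r (Qd_val z) ->
  (forall j, `|y 0 j - z 0 j| <= e) -> `|q y - q z| <= C * M * (e / r).
Proof.
have [C C0 hC] := poly_lipschitz R hk.
exists (d%:R * C); first by rewrite mulr_ge0.
move=> q a r M e /Pk_evalm[m mk qE] r0 ar qM y z ay az yz.
have M0 : 0 <= M by apply: le_trans (qM y ay).
have {}qM v : cube a r v -> `|evalm m v| <= M.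
  by move=> av; have := qM (mkQd (ar _ av)) av; rewrite qE.
pose hyb (n : nat) : 'rV[R]_d := \row_j (if (j < n)%N then z 0 j else y 0 j).
have ah n : cube a r (hyb n).
  by move=> j; rewrite mxE; case: ifP => _; [exact: az|exact: ay].
have step n : (n < d)%N -> `|evalm m (hyb n) - evalm m (hyb n.+1)| <= C * M * (e / r).
  move=> nd; pose i := Ordinal nd.
  pose b : 'rV[R]_d := \row_j (if j == i then a 0 i else hyb n 0 j).
  have [p pk pE] := evalm_line b (delta_mx 0 i) mk.
  pose p' := p \Po (r *: 'X + 0%:P).
  have p'E s : p'.[s] = evalm m (b + (s * r) *: delta_mx 0 i).
    by rewrite horner_comp hornerD hornerZ hornerX hornerC addr0 pE mulrC.
  have p'k : (size p' <= k)%N by exact: size_comp_affine.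
  have cE (c : 'rV[R]_d) (s : R) : c 0 i = a 0 i + s * r ->
      (forall j, j != i -> c 0 j = hyb n 0 j) -> evalm m c = p'.[s].
    move=> ci cj; rewrite p'E; congr evalm; apply/rowP => j; rewrite !mxE eqxx /=.
    case: (eqVneq j i) => [->|ji]; first by rewrite mulr1.
    by rewrite mulr0 addr0 cj // !mxE.
  have p'M s : 0 <= s <= 1 -> `|p'.[s]| <= M.
    move=> /andP[s0 s1].
    rewrite -(cE (\row_j (if j == i then a 0 i + s * r else hyb n 0 j))).
    - apply: qM => j; rewrite !mxE; case: eqP => [->|_]; last first.
        by have := ah n j; rewrite !mxE.
      have : 0 <= s * r by rewrite mulr_ge0 // ltW.
      have : s * r <= r by rewrite ler_piMl // ltW.
      by move=> *; apply/andP; split; lra.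
    - by rewrite mxE eqxx.
    - by move=> j /negbTE ji; rewrite !mxE ji.
  pose s1 := (y 0 i - a 0 i) / r; pose s2 := (z 0 i - a 0 i) / r.
  have s01 u : cube a r u -> 0 <= (u 0 i - a 0 i) / r <= 1.
    move=> /(_ i)/andP[u1 u2]; rewrite ler_pdivlMr // ler_pdivrMr // mul0r mul1r.
    by apply/andP; split; lra.
  rewrite (cE (hyb n) s1) //; last by rewrite mxE ltnn /s1 divfK ?gt_eqF //; ring.
  rewrite (cE (hyb n.+1) s2); last 2 first.
  - by rewrite mxE ltnSn /s2 divfK ?gt_eqF //; ring.
  - move=> j ji; rewrite !mxE ltnS leq_eqVlt.
    by rewrite [_ == n](_ : _ = (j == i)) // (negbTE ji).
  apply: le_trans (hC p' M p'k p'M s1 s2 (s01 _ ay) (s01 _ az)) _.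
  rewrite ler_wpM2l ?mulr_ge0 // /s1 /s2 -mulrBl normrM normfV (ger0_norm (ltW r0)).
  rewrite ler_pM2r ?invr_gt0 //.
  by have := yz i; rewrite (_ : y 0 i - a 0 i - (z 0 i - a 0 i) = y 0 i - z 0 i) //; ring.
have all n : (n <= d)%N -> `|evalm m (hyb 0) - evalm m (hyb n)| <= n%:R * (C * M * (e / r)).
  elim: n => [_|n IH nd]; first by rewrite subrr normr0 mul0r.
  have := step n nd; have := IH (ltnW nd).
  have := ler_normD (evalm m (hyb 0) - evalm m (hyb n)) (evalm m (hyb n) - evalm m (hyb n.+1)).
  rewrite [_ + _](_ : _ = evalm m (hyb 0) - evalm m (hyb n.+1)); last by ring.
  by rewrite -natr1 mulrDl mul1r; lra.
have := all d (leqnn d); rewrite !qE.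
have -> : hyb 0%N = Qd_val y by apply/rowP => j; rewrite mxE.
have -> : hyb d = Qd_val z by apply/rowP => j; rewrite mxE ltn_ord.
by rewrite !mulrA.
Qed.

End Pk_theory.

(** * Density, continuity of polynomials, sums over packings *)

Section thick_density.
Context (R : realType) (d : nat).
Implicit Types (x y : Qd R d) (F : set_system (Qd R d)).

Lemma thick_near F A x a r (s : 'I_d -> bool) t : thick F -> F A -> 0 < r ->
  cube a r `<=` unit_cube R d -> cube a r (Qd_val x) -> points_in s (Qd_val x) a r ->
  0 < t -> exists y, [/\ A y, qball x t y, cube a r (Qd_val y) &
    forall j, if s j then x 0 j < y 0 j else y 0 j < x 0 j].
Proof.
move=> tF FA r0 ar ax sx t0.
have [e e0 he] := corner_sub r0 ax sx.
pose e' := Num.min e (t / 4).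
have e'0 : 0 < e' by rewrite lt_min e0 divr_gt0.
have e'e : e' <= e by rewrite ge_min lexx.
have e't : e' <= t / 4 by rewrite ge_min lexx orbT.
have sub := he e' (introT andP (conj e'0 e'e)).
have [y Ay hy] := thick_meet tF FA e'0 (subset_trans sub ar).
exists y; split => //; last by move=> j; have [] := corner_side e'0 hy j.
  by move=> j; have [h _] := corner_side e'0 hy j; lra.
exact: sub.
Qed.

Lemma unit_cube_sub : cube 0 1 `<=` unit_cube R d. Proof. by []. Qed.

Lemma thick_hball F A i b x t : thick F -> F A -> valid i b x -> 0 < t ->
  exists2 y, A y & hball i b x t y.
Proof.
move=> tF FA vx t0.
have [|s sx si] := @points_in_exists1 R d (Qd_val x) 0 1 i b ltr01 (Qd_in x).
  by case: b vx => vx; rewrite /valid !mxE ?add0r in vx *.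
have [y [Ay xy _ hy]] := thick_near tF FA ltr01 unit_cube_sub (Qd_in x) sx t0.
by exists y => //; split => //; have := hy i; rewrite si.
Qed.

Lemma thick_cube_closure F (g : Qd R d -> R) a r x M : thick F -> 0 < r ->
  cube a r `<=` unit_cube R d -> cube a r (Qd_val x) ->
  (forall e, 0 < e -> exists2 t, 0 < t & forall y, qball x t y -> g x - e < g y) ->
  F [set y | cube a r (Qd_val y) -> g y <= M] -> g x <= M.
Proof.
move=> tF r0 ar ax gx FM; apply/ler_addgt0Pr => e e0.
have [t t0 ht] := gx e e0.
have [s sx] := points_in_exists r0 ax.
have [y [My xy ay _]] := thick_near tF FM r0 ar ax sx t0.
by have := ht y xy; have := My ay; lra.
Qed.

Lemma cube_missed (a w : 'rV[R]_d) r : ~ cube a r w ->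
  exists2 u, 0 < u & forall v, cube a r v -> ~ forall j, `|v 0 j - w 0 j| < u.
Proof.
move=> hw; have [j /negP] : exists j, ~ (a 0 j <= w 0 j <= a 0 j + r).
  by apply: contrapT => h; apply: hw => j; apply: contrapT => hj; apply: h; exists j.
rewrite negb_and -!ltNge => /orP[wj|wj].
  exists (a 0 j - w 0 j); first by lra.
  move=> v av /(_ j); have /andP[? ?] := av j.
  by rewrite ltr_norml => /andP[? ?]; lra.
exists (w 0 j - (a 0 j + r)); first by lra.
move=> v av /(_ j); have /andP[? ?] := av j.
by rewrite ltr_norml => /andP[? ?]; lra.
Qed.

End thick_density.

Section Pk_continuity.
Context (R : realType) (d k : nat).
Implicit Types (q : Qd R d -> R).

Lemma Pk_continuous (hk : (0 < k)%N) q (x : Qd R d) e : @Pk R d k q -> 0 < e ->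
  exists2 t, 0 < t & forall y, qball x t y -> `|q y - q x| < e.
Proof.
move=> Pq e0; have [C C0 hC] := Pk_lipschitz R d hk.
have [M hM] : exists M, forall y, `|q y| <= M.
  have [m _ qE] := Pk_evalm Pq; have [M hM] := evalm_bounded m.
  by exists M => y; rewrite qE; apply: hM; exact: Qd_in.
have M0 : 0 <= M by apply: le_trans (hM x).
have K0 : 0 < C * M + 1 by rewrite ltr_wpDl // mulr_ge0.
exists (e / (C * M + 1)); first by rewrite divr_gt0.
move=> y xy.
have := hC q 0 1 M (e / (C * M + 1)) Pq ltr01 (@unit_cube_sub R d)
  (fun z _ => hM z) y x (Qd_in y) (Qd_in x) (fun j => ltW (xy j)).
move=> /le_lt_trans; apply; rewrite divr1 mulrA ltr_pdivrMr // mulrC ltr_pM2l //.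
by rewrite ltrDl.
Qed.

Lemma thick_Pk_bound (hk : (0 < k)%N) F q a r M : thick F -> @Pk R d k q -> 0 < r ->
  cube a r `<=` unit_cube R d -> F [set y | cube a r (Qd_val y) -> `|q y| <= M] ->
  forall y, cube a r (Qd_val y) -> `|q y| <= M.
Proof.
move=> tF Pq r0 ar FM y ay; apply: (thick_cube_closure (g := fun y => `|q y|) tF r0 ar ay _ FM).
move=> e e0; have [t t0 ht] := Pk_continuous hk y Pq e0; exists t => // z /ht.
by have := lerB_dist (q y) (q z); rewrite distrC; lra.
Qed.

End Pk_continuity.

Section packing_sums.
Context (R : realType) (d : nat) (p : R) (hp : 1 <= p).
Implicit Types (E : set 'rV[R]_d -> \bar R) (pi : set (set 'rV[R]_d)).
Local Open Scope ereal_scope.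

Let pge0 : (0 <= p)%R. Proof. exact: le_trans ler01 hp. Qed.

Let p0 : (p != 0)%R. Proof. by apply/negP => /eqP p0; move: hp; rewrite p0; lra. Qed.

Lemma packing_sup_ge0 E : 0 <= packing_sup p E.
Proof.
apply: ereal_sup_ge; exists ((\sum_(Q \in set0) E Q `^ p) `^ p^-1).
  exists set0 => //; split; [exact: finite_set0|by []|by move=> Q Q' []].
exact: poweR_ge0.
Qed.

Lemma poweR_le_pos (x y : \bar R) (s : R) : (0 <= s)%R -> 0 <= x -> x <= y ->
  x `^ s <= y `^ s.
Proof.
move=> s0 x0 xy; apply: gt0_ler_poweR => //; rewrite in_itv /= leey andbT //.
exact: le_trans xy.
Qed.

Lemma poweRK (x : \bar R) : 0 <= x -> (x `^ p) `^ p^-1 = x.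
Proof. by move=> x0; rewrite -poweRrM mulfV // poweRe1. Qed.

Lemma poweRVK (x : \bar R) : 0 <= x -> (x `^ p^-1) `^ p = x.
Proof. by move=> x0; rewrite -poweRrM mulVf // poweRe1. Qed.

Lemma packing_sum_le E pi : packing pi ->
  \sum_(Q \in pi) E Q `^ p <= packing_sup p E `^ p.
Proof.
move=> hpi.
rewrite -[leLHS]poweRVK; last by apply: fsume_ge0 => Q _; exact: poweR_ge0.
apply: poweR_le_pos; [exact: pge0|exact: poweR_ge0|].
by apply: ereal_sup_ubound; exists pi.
Qed.

Lemma packing_sup_le E B : 0 <= B ->
  (forall pi, packing pi -> \sum_(Q \in pi) E Q `^ p <= B `^ p) -> packing_sup p E <= B.
Proof.
move=> B0 h; apply: ge_ereal_sup => _ [pi hpi <-].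
rewrite -[leRHS]poweRK //; apply: poweR_le_pos; last exact: h.
  by rewrite invr_ge0.
by apply: fsume_ge0 => Q _; exact: poweR_ge0.
Qed.

Lemma packing_sup_mono E E' :
  (forall a r, (0 < r)%R -> cube a r `<=` unit_cube R d ->
    0 <= E (cube a r) /\ E (cube a r) <= E' (cube a r)) ->
  packing_sup p E <= packing_sup p E'.
Proof.
move=> EE; apply: packing_sup_le; first exact: packing_sup_ge0.
move=> pi hpi; apply: le_trans (packing_sum_le E' hpi).
have [fpi cpi _] := hpi; apply: lee_fsum => // Q /cpi[[a [r [r0 ->]]] ar].
by have [? ?] := EE a r r0 ar; apply: poweR_le_pos => //; lra.
Qed.

Lemma packing1 a r : (0 < r)%R -> cube a r `<=` unit_cube R d -> packing [set cube a r].
Proof.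
move=> r0 ar; split; first exact: finite_set1.
  by move=> _ ->; split => //; exists a, r.
by move=> Q Q' -> ->.
Qed.

Lemma E_le_packing_sup E a r : (0 < r)%R -> cube a r `<=` unit_cube R d ->
  0 <= E (cube a r) -> E (cube a r) <= packing_sup p E.
Proof.
move=> r0 ar E0; have := packing_sum_le E (packing1 r0 ar).
rewrite fsbig_set1 => h; rewrite -[leLHS]poweRK // -[leRHS]poweRK ?packing_sup_ge0 //.
by apply: poweR_le_pos => //; [rewrite invr_ge0|exact: poweR_ge0].
Qed.

(** Sums over families indexed by something else than the packing itself: the points in
    the cubes, or the cubes before a contraction. *)
Lemma nonoverlapping_sum_le E (I : choiceType) (D : set I) (Q : I -> set 'rV[R]_d) :
  finite_set D -> (forall i, D i -> is_cube (Q i) /\ Q i `<=` unit_cube R d) ->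
  (forall i j a r, D i -> D j -> (0 < r)%R -> cube a r `<=` Q i -> cube a r `<=` Q j ->
    i = j) ->
  \sum_(i \in D) E (Q i) `^ p <= packing_sup p E `^ p.
Proof.
move=> fD cD dD.
have injQ : {in D &, injective Q}.
  move=> i j /set_mem Di /set_mem Dj Qij.
  have [[a [r [r0 Qi]]] _] := cD i Di.
  by apply: (dD i j a r) => //; rewrite -?Qij Qi.
rewrite -(reindex_fsbig Q D (Q @` D) (fun S => E S `^ p)); last first.
  by split; [move=> i Di; exists i|exact: injQ|].
apply: packing_sum_le; split.
- exact: finite_image.
- by move=> _ [i Di <-]; exact: cD.
- move=> _ _ [i Di <-] [j Dj <-] [v [vi vj]].
  have : (Q i `&` Q j)° v by rewrite interiorI.
    move=> /interior_small_cube[a [r [r0]]]; rewrite subsetI => -[ai aj].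
  by rewrite (dD i j a r).
Qed.

Lemma disjoint_sum_le E (I : choiceType) (D : set I) (Q : I -> set 'rV[R]_d) :
  finite_set D -> (forall i, D i -> is_cube (Q i) /\ Q i `<=` unit_cube R d) ->
  (forall i j, D i -> D j -> i <> j -> Q i `&` Q j = set0) ->
  \sum_(i \in D) E (Q i) `^ p <= packing_sup p E `^ p.
Proof.
move=> fD cD dD; apply: nonoverlapping_sum_le => // i j a r Di Dj r0 ai aj.
apply: contrapT => /(dD _ _ Di Dj) /seteqP[/(_ a) + _]; apply.
by split; [apply: ai|apply: aj]; apply: cubexx; exact: ltW.
Qed.

(** A finite variation forces the error to vanish along cubes that shrink to [x]
    without containing [x]: from cubes with a large error one could extract an
    infinite sequence of disjoint ones. *)
Lemma E_vanishes E (x : Qd R d) (e : R) : packing_sup p E < +oo ->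
  (0 < e)%R -> exists2 t, (0 < t)%R & forall a r, (0 < r)%R ->
    cube a r `<=` unit_cube R d -> ~ cube a r (Qd_val x) ->
    (forall v, cube a r v -> forall j, `|v 0%R j - x 0%R j| < t)%R ->
    E (cube a r) < e%:E.
Proof.
move=> supE e0; apply: contrapT => hE.
have {hE} /choice[f hf] (t : R) : exists ar : 'rV[R]_d * R, (0 < t)%R ->
    [/\ (0 < ar.2)%R, cube ar.1 ar.2 `<=` unit_cube R d, ~ cube ar.1 ar.2 (Qd_val x),
    (forall v, cube ar.1 ar.2 v -> forall j, `|v 0%R j - x 0%R j| < t)%R &
    e%:E <= E (cube ar.1 ar.2)].
  apply: contrapT => ht; apply: hE; exists t.
    by rewrite ltNge; apply/negP => t0; apply: ht; exists (0%R, 0%R); rewrite ltNge t0.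
  move=> a r r0 ar xar art; rewrite ltNge; apply/negP => Ee; apply: ht.
  by exists (a, r).
pose Q t := cube (f t).1 (f t).2.
have /choice[g hg] (t : R) : exists u : R, (0 < u)%R /\ ((0 < t)%R ->
    forall v, Q t v -> ~ forall j, (`|v 0%R j - x 0%R j| < u)%R).
  have [t0|_] := ltP 0%R t; last by exists 1%R.
  have [_ _ xQ _ _] := hf t t0; have [u u0 hu] := cube_missed xQ.
  by exists u; split => // _ v; exact: hu.
pose t_ := fix t_ n : R := if n is n'.+1 then Num.min (t_ n') (g (t_ n')) else 1%R.
have t0 n : (0 < t_ n)%R.
  by elim: n => [|n IH] //=; rewrite lt_min IH; have [] := hg (t_ n).
have tle m n : (m <= n)%N -> (t_ n <= t_ m)%R.
  elim: n => [|n IH]; first by rewrite leqn0 => /eqP ->.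
  rewrite leq_eqVlt => /orP[/eqP ->//|mn]; apply: le_trans (IH mn).
  by rewrite /= ge_min lexx.
have disj m n : (m < n)%N -> Q (t_ m) `&` Q (t_ n) = set0.
  move=> mn; rewrite -subset0 => v [vm vn].
  have [_ hg'] := hg (t_ m); apply: (hg' (t0 m) v vm) => j.
  have [_ _ _ + _] := hf _ (t0 n) => /(_ v vn j) /lt_le_trans; apply.
  by apply: le_trans (tle _ _ mn) _; rewrite /= ge_min lexx orbT.
have sum_le N : (N%:R * (e `^ p))%:E <= packing_sup p E `^ p.
  apply: le_trans (@disjoint_sum_le E nat `I_N (Q \o t_) (finite_II N) _ _).
  - apply: (@le_trans _ _ (\sum_(i \in `I_N) (e `^ p)%:E)); last first.
      apply: lee_fsum => [|i _]; first exact: finite_II.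
      have [_ _ _ _ h] := hf _ (t0 i).
      have -> : (e `^ p)%:E = e%:E `^ p by [].
      by apply: poweR_le_pos h; rewrite ?lee_fin // ltW.
    by rewrite -fsbig_ord sumEFin sumr_const card_ord mulr_natl.
  - by move=> i _; have [? ? _ _ _] := hf _ (t0 i); split => //; exists (f (t_ i)).1, (f (t_ i)).2.
  - move=> i j _ _ ij; have [|ji|] := ltngtP i j; [exact: disj| |by []].
    by rewrite setIC; exact: disj.
have : packing_sup p E `^ p < +oo by exact: poweR_lty.
have : 0 <= packing_sup p E `^ p by exact: poweR_ge0.
case: (packing_sup p E `^ p) sum_le => [S sum_le S0 _|//|//].
have ep : (0 < e `^ p)%R by exact: powR_gt0.
rewrite lee_fin in S0.
have [N _ hN] := natr_truncn_le (divr_ge0 S0 (ltW ep)).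
have := sum_le N; rewrite lee_fin => h.
by move: hN; rewrite ltr_pdivrMr // ltNge h.
Qed.

End packing_sums.

(** * Existence of one-sided limits *)

Section one_sided_limits.
Context (R : realType) (d k : nat).
Implicit Types (x y : Qd R d) (F : set_system (Qd R d)).

(** The limits are given by a family [c] of candidates because a class and its normalised
    representative share the same family for two different filters. *)
Definition side_lim F (u : Qd R d -> R) (c : Qd R d -> 'I_d -> bool -> R) :=
  forall x i b, valid i b x -> forall e, 0 < e ->
  exists2 t, 0 < t & F [set y | hball i b x t y -> `|u y - c x i b| <= e].

(** An interval of length [l] in [0, 1] that contains the points of [0, 1] at distance at
    most [l / 2] from [x]. *)
Definition clamp (x l : R) : R := Num.max 0 (Num.min (x - l / 2) (1 - l)).

Lemma clampP (x l : R) : 0 <= x <= 1 -> 0 < l <= 1 ->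
  [/\ 0 <= clamp x l, clamp x l + l <= 1, x - l <= clamp x l <= x &
    forall s, 0 <= s <= 1 -> `|s - x| <= l / 2 -> clamp x l <= s <= clamp x l + l].
Proof.
move=> /andP[x0 x1] /andP[l0 l1]; rewrite /clamp.
case: (leP (x - l / 2) (1 - l)) => h1.
  case: (leP 0 (x - l / 2)) => h2; split; try lra.
    by move=> s /andP[? ?]; rewrite ler_norml => /andP[? ?]; apply/andP; split; lra.
  by move=> s /andP[? ?]; rewrite ler_norml => /andP[? ?]; apply/andP; split; lra.
case: (leP 0 (1 - l)) => h2; split; try lra.
by move=> s /andP[? ?]; rewrite ler_norml => /andP[? ?]; apply/andP; split; lra.
Qed.

(** The cube of side [l] at distance [h] from [x] in the direction [(i, b)]. *)
Definition side_corner x (i : 'I_d) (b : bool) (l h : R) : 'rV[R]_d :=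
  \row_j (if j == i then (if b then x 0 i + h else x 0 i - h - l)
          else clamp (x 0 j) l).

Section side_cubes.
Context (x : Qd R d) (i : 'I_d) (b : bool) (l h : R).
Context (hh : 0 < h <= l) (l1 : l <= 1)
  (room : if b then 2 * l <= 1 - x 0 i else 2 * l <= x 0 i).

Let l0 : 0 < l. Proof. by move: hh => /andP[]; exact: lt_le_trans. Qed.

Let clP j : [/\ 0 <= clamp (x 0 j) l, clamp (x 0 j) l + l <= 1,
    x 0 j - l <= clamp (x 0 j) l <= x 0 j &
    forall s, 0 <= s <= 1 -> `|s - x 0 j| <= l / 2 ->
      clamp (x 0 j) l <= s <= clamp (x 0 j) l + l].
Proof. by apply: clampP; [exact: Qd01|rewrite l0 l1]. Qed.

Lemma side_cube_mem (y : Qd R d) : (forall j, `|y 0 j - x 0 j| <= l / 2) ->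
  (if b then x 0 i + h <= y 0 i else y 0 i <= x 0 i - h) ->
  cube (side_corner x i b l h) l (Qd_val y).
Proof.
move=> xy yi j; rewrite mxE; case: eqP => [->|_].
  have := xy i; rewrite ler_norml; move: yi hh => + /andP[+ _].
  clear; move: (Qd_val y 0 i) (Qd_val x 0 i) => u v.
  by case: (b) => ? ? /andP[? ?]; apply/andP; split; lra.
by have [_ _ _] := clP j; apply => //; exact: Qd01.
Qed.

Lemma side_cube_notin : ~ cube (side_corner x i b l h) l (Qd_val x).
Proof.
move=> /(_ i); rewrite mxE eqxx; move: hh => /andP[+ _].
by case: (b) => ? /andP[? ?]; lra.
Qed.

Lemma side_cube_unit : cube (side_corner x i b l h) l `<=` unit_cube R d.
Proof.
apply: cube_sub_unit => j; rewrite mxE; have [? ? _ _] := clP j.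
case: eqP => // _; have := Qd01 x i; move: room hh => + /andP[+ +] /andP[+ +].
by case: (b) => *; split; lra.
Qed.

Lemma side_cube_close v : cube (side_corner x i b l h) l v ->
  forall j, `|v 0 j - x 0 j| <= 2 * l.
Proof.
move=> av j; have := av j; rewrite mxE ler_norml; have [_ _ + _] := clP j.
move: hh => /andP[+ +] /andP[+ +]; case: eqP => [->|_].
  by case: (b) => ? ? ? ? /andP[? ?]; apply/andP; split; lra.
by move=> ? ? ? ? /andP[? ?]; apply/andP; split; lra.
Qed.

End side_cubes.

(** Points just beyond distance [h] from [x] lie in all the cubes at distance at most
    [h], which is how the polynomials on these cubes are compared. *)
Lemma thick_beyond F A x i b h : thick F -> F A -> 0 < h ->
  (if b then x 0 i + h < 1 else 0 < x 0 i - h) ->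
  exists y, [/\ A y, qball x (2 * h) y &
    if b then x 0 i + h < y 0 i else y 0 i < x 0 i - h].
Proof.
move=> tF FA h0 room.
pose v : 'rV[R]_d := \row_j (if j == i then (if b then x 0 i + h else x 0 i - h) else x 0 j).
have vi : v 0 i = if b then x 0 i + h else x 0 i - h by rewrite mxE eqxx.
have v01 : unit_cube R d v.
  move=> j; rewrite !mxE add0r; have := Qd01 x j; case: eqP => [->|//].
  by move: room; case: (b) => ? /andP[? ?]; apply/andP; split; lra.
have vv : valid i b (mkQd v01).
  by rewrite /valid mkQdE vi; case: (b) room.
have [y Ay [vy yi]] := thick_hball tF FA vv h0.
exists y; split => //; last by move: yi; rewrite mkQdE vi; case: (b).
move=> j; have := vy j; rewrite mkQdE mxE !ltr_norml => /andP[].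
by case: eqP => [->|_]; [case: (b)|] => ? ?; apply/andP; split; lra.
Qed.

Lemma five_steps (w1 w2 w3 w4 w5 w6 e : R) : `|w1 - w2| <= e -> `|w2 - w3| <= e ->
  `|w4 - w3| <= e -> `|w4 - w5| <= e -> `|w5 - w6| <= e -> `|w1 - w6| <= 5 * e.
Proof.
rewrite !ler_norml => /andP[? ?] /andP[? ?] /andP[? ?] /andP[? ?] /andP[? ?].
by apply/andP; split; lra.
Qed.

Section existence.
Context (p : R) (hp : 1 <= p) (hk : (0 < k)%N) F (tF : thick F)
  (u : Qd R d -> R) (M : R) (uM : F [set y | `|u y| <= M])
  (E : set 'rV[R]_d -> \bar R) (supE : (packing_sup p E < +oo)%E)
  (hE : forall a r e, 0 < r -> cube a r `<=` unit_cube R d ->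
    (E (cube a r) < e%:E)%E -> near_Pk k F u (cube a r) e).

(** Cubes that touch the half ball but avoid [x] carry good polynomial approximations
    [q] of [u]. These are bounded, hence nearly constant close to [x] at a scale that
    does not depend on the cube; letting the cubes approach [x] makes [u] nearly constant
    on the half ball. *)
Lemma side_oscillation x i b e : valid i b x -> 0 < e ->
  exists t c, 0 < t /\ F [set y | hball i b x t y -> `|u y - c| <= e].
Proof.
move=> vx e0.
pose e1 := Num.min (e / 5) 1.
have e10 : 0 < e1 by rewrite lt_min divr_gt0 // ltr01.
have e11 : e1 <= 1 by rewrite ge_min lexx orbT.
have e15 : 5 * e1 <= e by rewrite mulrC -ler_pdivlMr // ge_min lexx.
have [t1 t10 ht1] := E_vanishes hp x supE e10.
have [C C0 hC] := Pk_lipschitz R d hk.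
pose room := if b then 1 - x 0 i else x 0 i.
have room0 : 0 < room by move: vx; rewrite /valid /room; case: (b); rewrite ?subr_gt0.
pose l := Num.min (Num.min t1 room) 1 / 4.
have l0 : 0 < l by rewrite divr_gt0 // !lt_min t10 room0 ltr01.
have [l1 l2 l3] : [/\ 4 * l <= t1, 4 * l <= room & 4 * l <= 1].
  by rewrite /l mulrC divfK // !ge_min !lexx !orbT.
have [{}l1 {}l2 {}l3] : [/\ 2 * l < t1, 2 * l < room & l <= 1] by split; lra.
have room2 : if b then 2 * l <= 1 - x 0 i else 2 * l <= x 0 i.
  by move: l2; rewrite /room; case: (b) => /ltW.
pose a_ := side_corner x i b l.
have M0 : 0 <= M + 1.
  have [y uy _] := thick_meet tF uM ltr01 (@unit_cube_sub R d).
  by apply: addr_ge0 => //; apply: le_trans uy.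
have K0 : 0 < C * (M + 1) + 1 by rewrite ltr_wpDl // mulr_ge0.
pose t := Num.min (l / 2) (e1 * l / (2 * (C * (M + 1) + 1))).
have t0 : 0 < t by rewrite lt_min divr_gt0 //= divr_gt0 // mulr_gt0.
have tl : t <= l / 2 by rewrite ge_min lexx.
have tK : C * (M + 1) * (2 * t / l) <= e1.
  apply: (@le_trans _ _ ((C * (M + 1) + 1) * (2 * t / l))).
    have tl0 : 0 <= 2 * t / l by apply: divr_ge0; [apply: mulr_ge0 => //|]; exact: ltW.
    by rewrite ler_wpM2r // lerDl.
  rewrite mulrA ler_pdivrMr // mulrCA mulrA mulrC -ler_pdivlMr ?mulr_gt0 //.
  by rewrite /t ge_min lexx orbT.
have good h : 0 < h <= l -> exists q : Qd R d -> R,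
    F [set y | cube (a_ h) l (Qd_val y) -> `|u y - q y| <= e1] /\
    forall y z, cube (a_ h) l (Qd_val y) -> cube (a_ h) l (Qd_val z) ->
      qball x t y -> qball x t z -> `|q y - q z| <= e1.
  move=> hl; have Qu := side_cube_unit hl l3 room2.
  have [|q Pq hq] := hE l0 Qu (ht1 _ _ l0 Qu (side_cube_notin hl) _).
    by move=> v /(side_cube_close hl l3)av j; exact: le_lt_trans (av j) l1.
  exists q; split => //.
  have qM : forall y : Qd R d, cube (a_ h) l (Qd_val y) -> `|q y| <= M + 1.
    apply: (thick_Pk_bound hk tF Pq l0 Qu).
    apply: (thickS tF _ (thickI tF uM hq)) => y [/= uy uq] Qy.
    rewrite -[q y](subrK (u y)) addrC; apply: le_trans (ler_normD _ _) _.
    by apply: lerD => //; rewrite distrC; exact: le_trans (uq Qy) e11.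
  move=> y z Qy Qz xy xz; apply: le_trans tK; apply: hC qM _ _ Qy Qz _ => //.
  move=> j; rewrite -[y 0 j](subrK (x 0 j)) -addrA; apply: le_trans (ler_normD _ _) _.
  by rewrite mulr_natl mulr2n; apply: lerD; [|rewrite distrC]; exact: ltW.
pose h0 := t / 2.
have h00 : 0 < h0 by rewrite divr_gt0.
have h0t : 2 * h0 = t by rewrite mulrC divfK.
have h0l : 0 < h0 <= l by rewrite h00 /=; lra.
have Qball h y : 0 < h <= l -> qball x t y ->
    (if b then x 0 i + h <= y 0 i else y 0 i <= x 0 i - h) -> cube (a_ h) l (Qd_val y).
  move=> hl xy yh; apply: side_cube_mem => // j.
  exact: le_trans (ltW (xy j)) tl.
(* every member of [F] contains points that lie in all the cubes that are close to [x] *)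
have common A : F A -> exists y, [/\ A y, qball x t y &
    forall h, 0 < h <= h0 -> cube (a_ h) l (Qd_val y)].
  move=> FA; have [|y [Ay xy yi]] := @thick_beyond F A x i b h0 tF FA h00.
    have h2l : h0 < 2 * l by lra.
    by move: room2; case: (b) => ?; lra.
  rewrite h0t in xy; exists y; split => // h /andP[h1 h2]; apply: Qball => //.
    by rewrite h1 (le_trans h2) //; case/andP: h0l.
  by case: (b) yi => ?; lra.
have [q0 [hq0 q0c]] := good h0 h0l.
have [y0 [_ xy0 Qy0]] := common _ hq0.
have h00' : 0 < h0 <= h0 by rewrite h00 lexx.
have close h : 0 < h <= h0 ->
    F [set y | cube (a_ h) l (Qd_val y) -> qball x t y -> `|u y - q0 y0| <= e].
  move=> hh; have hhl : 0 < h <= l.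
    by case/andP: hh => -> hh0; apply: le_trans hh0 _; case/andP: h0l.
  have [q [hq qc]] := good h hhl.
  have [z [[/= z1 z2] xz Qz]] := common _ (thickI tF hq hq0).
  apply: (thickS tF _ hq) => y /= uq Qy xy; apply: le_trans e15.
  have k1 := uq Qy; have k2 := qc _ _ Qy (Qz h hh) xy xz.
  have k3 := z1 (Qz h hh); have k4 := z2 (Qz h0 h00').
  have k5 := q0c _ _ (Qz h0 h00') (Qy0 h0 h00') xz xy0.
  exact: five_steps k1 k2 k3 k4 k5.
exists t, (q0 y0); split => //.
pose h_ (n : nat) := h0 / n.+1%:R.
have hh_ n : 0 < h_ n <= h0.
  by rewrite divr_gt0 //= ler_pdivrMr // ler_peMr ?ler1n // ltW.
apply: (thickS tF _ (thick_bigcap tF (fun n => close (h_ n) (hh_ n)))) => y hy [xy yi].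
pose g := if b then y 0 i - x 0 i else x 0 i - y 0 i.
have g0 : 0 < g by rewrite /g; case: (b) yi; rewrite subr_gt0.
have [n n0 hn] := natr_truncn_le (divr_ge0 (ltW h00) (ltW g0)).
apply: (hy n) => //; apply: Qball => //.
  by case/andP: (hh_ n) => -> /le_trans; apply; case/andP: h0l.
have : h_ n <= g.
  rewrite /h_ ler_pdivrMr //; apply: ltW; move: hn; rewrite ltr_pdivrMr // => /lt_le_trans; apply.
  by rewrite [_ * g]mulrC ler_pM2l // ler_nat.
by rewrite /g; case: (b); [rewrite lerBrDl|rewrite !lerBrDr addrC].
Qed.

(** The intervals of radius [e] around the approximate values for [e] intersect pairwise,
    so the supremum of their left ends lies in all of them. *)
Lemma side_lim_exists : exists c, side_lim F u c.
Proof.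
pose good x i b e a := exists2 t, 0 < t & F [set y | hball i b x t y -> `|u y - a| <= e].
pose S x i b := [set z : R | exists e a, [/\ 0 < e, good x i b e a & z = a - e]].
have cross x i b e a e' a' : valid i b x -> good x i b e a -> good x i b e' a' ->
    a - e <= a' + e'.
  move=> vx [t t0 ht] [t' t'0 ht'].
  have [|y [/= y1 y2] xy] := thick_hball (t := Num.min t t') tF (thickI tF ht ht') vx.
    by rewrite lt_min t0.
  have m1 : Num.min t t' <= t by rewrite ge_min lexx.
  have m2 : Num.min t t' <= t' by rewrite ge_min lexx orbT.
  have := y1 (hball_le m1 xy); have := y2 (hball_le m2 xy).
  by rewrite !ler_norml => /andP[? ?] /andP[? ?]; lra.
exists (fun x i b => sup (S x i b)) => x i b vx e e0.
have e20 : 0 < e / 2 by lra.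
have [t [a [t0 ha]]] := side_oscillation vx e20.
have ga : good x i b (e / 2) a by exists t.
have Sa : S x i b (a - e / 2) by exists (e / 2), a.
have Sub : ubound (S x i b) (a + e / 2).
  by move=> _ [e' [a' [e'0 ga' ->]]]; exact: cross ga' ga.
have h1 : sup (S x i b) <= a + e / 2 by apply: ge_sup => //; exists (a - e / 2).
have h2 : a - e / 2 <= sup (S x i b).
  by apply: ub_le_sup => //; exists (a + e / 2).
exists t => //; apply: (thickS tF _ ha) => y h xy; have := h xy.
by rewrite !ler_norml => /andP[? ?]; apply/andP; split; lra.
Qed.

End existence.
End one_sided_limits.

(** * Functions with one-sided limits *)

Section side_limit_theory.
Context (R : realType) (d : nat).
Implicit Types (x y : Qd R d) (F : set_system (Qd R d)).
Implicit Types (c : Qd R d -> 'I_d -> bool -> R) (u f : Qd R d -> R).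

Lemma side_lim_uniform F u c x e : thick F -> side_lim F u c -> 0 < e ->
  exists2 t, 0 < t & forall i b, valid i b x ->
    F [set y | hball i b x t y -> `|u y - c x i b| <= e].
Proof.
move=> tF uc e0.
have /(_ _)/cid2 h (ib : 'I_d * bool) : exists2 t, 0 < t & valid ib.1 ib.2 x ->
    F [set y | hball ib.1 ib.2 x t y -> `|u y - c x ib.1 ib.2| <= e].
  have [vx|vx] := boolP (valid ib.1 ib.2 x); last by exists 1.
  by have [t t0 ht] := uc x ib.1 ib.2 vx e e0; exists t.
have [t t0 ht] := exists_le_all (fun ib => s2valP (h ib)).
exists t => // i b vx; apply: (thickS tF _ (s2valP' (h (i, b)) vx)) => y hy xy.
exact: hy (hball_le (ht (i, b)) xy).
Qed.

(** The half ball contains a half ball, in any direction, around each of its points. *)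
Lemma side_lim_close F u c x i b t e : thick F -> side_lim F u c ->
  F [set y | hball i b x t y -> `|u y - c x i b| <= e] ->
  forall y j b', hball i b x t y -> valid j b' y -> `|c y j b' - c x i b| <= e.
Proof.
move=> tF uc ht y j b' xy vy; apply/ler_addgt0Pr => e' e'0.
have [t' t'0 ht'] := uc y j b' vy e' e'0.
have [s s0 hs] := hball_open xy.
have [|z [/= z1 z2] yz] := thick_hball (t := Num.min t' s) tF (thickI tF ht ht') vy.
  by rewrite lt_min t'0.
have m1 : Num.min t' s <= t' by rewrite ge_min lexx.
have m2 : Num.min t' s <= s by rewrite ge_min lexx orbT.
have [ys _] := hball_le m2 yz.
have := z1 (hs _ ys); have := z2 (hball_le m1 yz).
by rewrite !ler_norml => /andP[? ?] /andP[? ?]; apply/andP; split; lra.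
Qed.

(** In dimension at least two, half balls in different coordinate directions
    overlap. *)
Lemma side_lim_dim2 F u c x i b j b' : (2 <= d)%N -> thick F -> side_lim F u c ->
  valid i b x -> valid j b' x -> c x i b = c x j b'.
Proof.
move=> d2 tF uc.
have main i1 b1 j1 b2 : i1 != j1 -> valid i1 b1 x -> valid j1 b2 x ->
    c x i1 b1 = c x j1 b2.
  move=> ij v1 v2; apply/eqP; rewrite -subr_eq0 -normr_le0.
  apply/ler_addgt0Pr => e e0; rewrite add0r.
  have [t t0 ht] := side_lim_uniform x tF uc (divr_gt0 e0 (ltr0n R 2)).
  pose s l := if l == i1 then b1 else if l == j1 then b2 else x 0 l < 1.
  have sx : points_in s (Qd_val x) 0 1.
    move=> l; rewrite /s !mxE add0r.
    case: eqP => [->|_]; first by move: v1; rewrite /valid; case: (b1).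
    case: eqP => [->|_]; first by move: v2; rewrite /valid; case: (b2).
    by have /andP[? ?] := Qd01 x l; case: ltP => //; lra.
  have [y [[/= y1 y2] xy _ sy]] := thick_near tF (thickI tF (ht _ _ v1) (ht _ _ v2))
    ltr01 (@unit_cube_sub R d) (Qd_in x) sx t0.
  have h1 : hball i1 b1 x t y by split => //; have := sy i1; rewrite /s eqxx.
  have h2 : hball j1 b2 x t y.
    by split => //; have := sy j1; rewrite /s eq_sym (negbTE ij) eqxx.
  have := y1 h1; have := y2 h2.
  by rewrite !ler_norml => /andP[? ?] /andP[? ?]; apply/andP; split; lra.
move=> vi vj; have [ij|ij] := eqVneq i j; last exact: main.
have [l il] : exists l, i != l.
  have d0 : (0 < d)%N by exact: ltnW.
  have [->|i0] := eqVneq i (Ordinal d0); last by exists (Ordinal d0).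
  by exists (Ordinal d2).
have [b3 v3] := valid_exists l x.
by rewrite (main _ _ _ _ il vi v3) (main _ _ _ _ _ v3 vj) // eq_sym -ij.
Qed.

(** In every dimension these are the values of [P f] ([P_side_mean] below). A direction
    that leaves the unit cube is replaced by the opposite one. *)
Definition side_mean (i0 : 'I_d) c x :=
  ((if valid i0 true x then c x i0 true else c x i0 false) +
   (if valid i0 false x then c x i0 false else c x i0 true)) / 2.

Lemma side_mean_close i0 c x a e : (forall b, valid i0 b x -> `|c x i0 b - a| <= e) ->
  `|side_mean i0 c x - a| <= e.
Proof.
move=> h; rewrite /side_mean.
have [b vb] := valid_exists i0 x.
have h' b1 b2 : (valid i0 b1 x || valid i0 b2 x) ->
    `|(if valid i0 b1 x then c x i0 b1 else c x i0 b2) - a| <= e.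
  by case: ifP => [v _|_ /= v]; exact: h.
have v1 : valid i0 true x || valid i0 false x by case: b vb => -> //; rewrite orbT.
have := h' _ _ v1; rewrite orbC in v1; have := h' _ _ v1.
by rewrite !ler_norml => /andP[? ?] /andP[? ?]; apply/andP; split; lra.
Qed.

Lemma side_mean_eq i0 c x a : (forall b, valid i0 b x -> c x i0 b = a) ->
  side_mean i0 c x = a.
Proof.
move=> h; apply/eqP; rewrite -subr_eq0 -normr_le0; apply: side_mean_close => b /h ->.
by rewrite subrr normr0.
Qed.

Lemma side_mean_lim i0 F u c : thick F -> side_lim F u c ->
  side_lim (@sure R d) (side_mean i0 c) c.
Proof.
move=> tF uc x i b vx e e0; have [t t0 ht] := uc x i b vx e e0.
exists t => // y xy; apply: side_mean_close => b' vy.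
exact: side_lim_close tF uc ht _ _ _ xy vy.
Qed.

Lemma side_mean_near i0 F u c x e : thick F -> side_lim F u c -> 0 < e ->
  exists2 t, 0 < t & F [set y | qball x t y -> y <> x -> `|u y - side_mean i0 c y| <= e].
Proof.
move=> tF uc e0.
have [t t0 ht] := side_lim_uniform x tF uc (divr_gt0 e0 (ltr0n R 2)).
exists t => //.
have hF i b : F [set y | hball i b x t y -> `|u y - c x i b| <= e / 2].
  have [vx|vx] := boolP (valid i b x); first exact: ht.
  by apply: thickT => // y xy; move: vx; rewrite (valid_hball xy).
have hall (s : seq ('I_d * bool)) : F [set y | forall ib, ib \in s ->
    hball ib.1 ib.2 x t y -> `|u y - c x ib.1 ib.2| <= e / 2].
  elim: s => [|ib s IH]; first exact: thickT.
  apply: (thickS tF _ (thickI tF (hF ib.1 ib.2) IH)) => y /= [h1 h2] jb.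
  by rewrite in_cons => /orP[/eqP ->//|js]; exact: h2.
apply: (thickS tF _ (hall (enum {: 'I_d * bool}))) => y /= hy xy yx.
have [i [b xyi]] := neq_hball xy yx.
have h1 := hy (i, b) (mem_enum _ _) xyi.
have h2 : `|side_mean i0 c y - c x i b| <= e / 2.
  apply: side_mean_close => b' vy.
  exact: side_lim_close tF uc (hF i b) _ _ _ xyi vy.
move: h1 h2; rewrite !ler_norml => /andP[? ?] /andP[? ?].
by apply/andP; split; lra.
Qed.

Lemma Qd_finite_cover (t : Qd R d -> R) : (forall x, 0 < t x) ->
  exists s : seq (Qd R d), forall y, exists2 x, x \in s & qball x (t x) y.
Proof.
move=> t0; have : compact (unit_cube R d).
  have h := @rV_compact R d (fun j => `[0%R, 1%R]%classic)
    (fun j => @segment_compact _ _ _).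
  suff -> : unit_cube R d =
    [set v | forall j, `[0%R, 1%R]%classic (v ord0 j)] by exact: h.
  by apply/seteqP; split => v av j; have := av j; rewrite /= in_itv /= !mxE add0r.
rewrite compact_cover => /(_ _ setT (fun x : Qd R d => (ball (Qd_val x) (t x))°)
  (fun x _ => open_interior _))[].
  by move=> v hv; exists (mkQd hv) => //; apply: (nbhsx_ballx v); exact: t0.
move=> D _ QD; exists (finmap.enum_fset D) => y.
have [x xD /interior_subset [_ xy]] := QD _ (Qd_in y).
by exists x => // j; have := xy 0 j; rewrite /ball /= distrC.
Qed.

(** Compactness turns a local property into a global one. *)
Lemma thick_local F (A : set (Qd R d)) : thick F ->
  (forall x, exists2 t, 0 < t & F [set y | qball x t y -> A y]) -> F A.
Proof.
move=> tF /(_ _)/cid2 h; have [s hs] := Qd_finite_cover (fun x => s2valP (h x)).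
have hall (r : seq (Qd R d)) : F [set y | forall x, x \in r -> qball x (s2val (h x)) y -> A y].
  elim: r => [|x r IH]; first exact: thickT.
  apply: (thickS tF _ (thickI tF (s2valP' (h x)) IH)) => y /= [h1 h2] z.
  by rewrite in_cons => /orP[/eqP ->//|zr]; exact: h2.
apply: (thickS tF _ (hall s)) => y /= hy.
by have [x xs xy] := hs y; exact: hy xy.
Qed.

(** Near each point [u] is close to its normalisation off that point; the unit cube is
    covered by finitely many such neighbourhoods. *)
Lemma side_mean_eqF i0 F u c : thick F -> (forall x, F [set y | y <> x]) ->
  side_lim F u c -> F [set y | u y = side_mean i0 c y].
Proof.
move=> tF Fpt uc.
have hn (n : nat) : F [set y | `|u y - side_mean i0 c y| <= n.+1%:R^-1].
  apply: thick_local => // x.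
  have [|t t0 ht] := side_mean_near i0 x tF uc (e := n.+1%:R^-1).
    by rewrite invr_gt0.
  exists t => //; apply: (thickS tF _ (thickI tF ht (Fpt x))) => y /= [h1 h2] xy.
  exact: h1.
apply: (thickS tF _ (thick_bigcap tF hn)) => y hy.
apply/eqP; rewrite -subr_eq0 -normr_le0; apply/ler_addgt0Pr => e e0; rewrite add0r.
have [n n0 hn'] := natr_truncn_le (divr_ge0 ler01 (ltW e0)).
apply: le_trans (hy n I) _; rewrite invf_ple ?posrE //; move: hn'; rewrite div1r => /ltW.
by move=> /le_trans; apply; rewrite ler_nat.
Qed.

(** Only finitely many points carry a jump larger than [e], since none does in a
    punctured neighbourhood of any point. *)
Lemma jump_finite f c e : side_lim (@sure R d) f c -> 0 < e ->
  finite_set [set y | exists i b, valid i b y /\ e < `|f y - c y i b|].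
Proof.
move=> fc e0; have tS := @thick_sure R d.
have /(_ _)/cid2 h x : exists2 t, 0 < t & forall y, qball x t y -> y <> x ->
    forall i b, valid i b y -> `|f y - c y i b| <= e.
  have [t t0 ht] := side_lim_uniform x tS fc (divr_gt0 e0 (ltr0n R 2)).
  exists t => // y xy yx i b vy; have [j [b' xyj]] := neq_hball xy yx.
  have vx := valid_hball xyj.
  have h1 := ht j b' vx y xyj.
  have := side_lim_close tS fc (ht j b' vx) xyj vy; move: h1.
  rewrite !ler_norml => /andP[? ?] /andP[? ?].
  by apply/andP; split; lra.
have [s hs] := Qd_finite_cover (fun x => s2valP (h x)).
apply: (sub_finite_set _ (finite_seq s)) => y /= [i [b [vy]]]; rewrite ltNge => /negP ly.
have [x xs xy] := hs y; apply: contrapT => ys; apply: ly.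
apply: (s2valP' (h x) y xy) => // yx; apply: ys; by rewrite yx.
Qed.

Lemma jump_countable f c : side_lim (@sure R d) f c ->
  countable [set y | exists i b, valid i b y /\ f y <> c y i b].
Proof.
move=> fc.
rewrite (_ : mkset _ = \bigcup_(n in [set: nat])
   [set y | exists i b, valid i b y /\ n.+1%:R^-1 < `|f y - c y i b|]).
  apply: bigcup_countable => // n _; apply: finite_set_countable.
  by apply: jump_finite => //; rewrite invr_gt0.
apply/seteqP; split => [y [i [b [vy fy]]]|y [n _ [i [b [vy fy]]]]].
  have f0 : 0 < `|f y - c y i b| by rewrite normr_gt0 subr_eq0; apply/eqP.
  have [n n0 hn] := natr_truncn_le (divr_ge0 ler01 (ltW f0)).
  exists n => //; exists i, b; split => //.
  rewrite invf_plt ?posrE //; move: hn; rewrite div1r => /lt_le_trans; apply.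
  by rewrite ler_nat.
exists i, b; split => // fyc; move: fy; rewrite fyc subrr normr0 invr_lt0.
by rewrite ltNge ler0n.
Qed.

Lemma side_lim_measurable (hd : (0 < d)%N) f c : side_lim (@sure R d) f c ->
  measurable_fun [set: QdL R d] (f : QdL R d -> R).
Proof.
move=> fc; apply: (measurable_countable_discontinuities hd (jump_countable fc)).
move=> x Jx e e0.
have [t t0 ht] := side_lim_uniform x (@thick_sure R d) fc (divr_gt0 e0 (ltr0n R 2)).
exists t => // y xy; have [->|yx] := pselect (y = x); first by rewrite subrr normr0.
have [i [b xyi]] := neq_hball xy yx; have vx := valid_hball xyi.
have -> : f x = c x i b by apply: contrapT => fx; apply: Jx; exists i, b.
by apply: le_lt_trans (ht i b vx y xyi) _; lra.
Qed.

Lemma almost_neq (hd : (0 < d)%N) x : @almost R d [set y | y <> x].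
Proof. by apply: (outer_null_almost (A := [set x])); apply: outer_countable => //; exact: countable1. Qed.

Lemma side_lim_almost f c : side_lim (@sure R d) f c -> side_lim (@almost R d) f c.
Proof.
move=> fc x i b vx e e0; have [t t0 ht] := fc x i b vx e e0; exists t => //.
exact: sure_almost.
Qed.

End side_limit_theory.

(** * The projection *)

Section projection.
Context (R : realType) (d : nat) (hd : (0 < d)%N).
Implicit Types (x y : Qd R d) (f : Qd R d -> R).

Let i0 : 'I_d := Ordinal hd.

Lemma lim_of_close (G : set_system (Qd R d)) f (l : R) : ProperFilter G ->
  (forall e, 0 < e -> G [set y | `|f y - l| <= e]) -> lim (f @ G) = l.
Proof.
move=> PG h; apply: cvg_lim => //; apply/cvgrPdist_le => e e0.
by apply: filterS (h e e0) => y /=; rewrite distrC.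
Qed.

Lemma within_proper x (D : set (Qd R d)) :
  (forall t, 0 < t -> exists2 y, qball x t y & D y) -> ProperFilter (within D (nbhs x)).
Proof.
move=> h; apply: Build_ProperFilter_ex => A; rewrite /within /= => /nbhs_QdP[t t0 tA].
by have [y xy Dy] := h t t0; exists y; exact: tA.
Qed.

Lemma hball_nonempty x i b t : valid i b x -> 0 < t -> exists y, hball i b x t y.
Proof.
move=> vx t0; have FT : (@sure R d) setT by [].
by have [y _ xy] := thick_hball (@thick_sure R d) FT vx t0; exists y.
Qed.

(** In dimension one a half ball is a one-sided neighbourhood; in higher dimension the
    half balls cover the punctured ball and the limits along them agree. *)
Lemma P_side_mean f c : side_lim (@sure R d) f c -> P f = side_mean i0 c.
Proof.
move=> fc; apply/funext => x; rewrite /P; have tS := @thick_sure R d.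
have [b0 vb0] := valid_exists i0 x.
have [d2|d1] := leqP 2 d.
  rewrite (side_mean_eq (a := c x i0 b0)); last first.
    by move=> b vb; exact: side_lim_dim2 d2 tS fc _ _.
  apply: lim_of_close.
    apply: within_proper => t t0; have [y xy] := hball_nonempty vb0 t0.
    by exists y; [case: xy|apply/eqP; exact: hball_neq xy].
  move=> e e0; have [t t0 ht] := side_lim_uniform x tS fc e0.
  apply/nbhs_QdP; exists t => // y xy /eqP yx.
  have [i [b xyi]] := neq_hball xy yx; have vx := valid_hball xyi.
  by rewrite (side_lim_dim2 d2 tS fc vb0 vx); exact: ht.
have ii0 (i : 'I_d) : i = i0.
  by apply/val_inj; case: i => m /= md; move: d1; rewrite ltnS => d1; lia.
have side (D : set (Qd R d)) b : valid i0 b x ->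
    (forall y, D y <-> if b then x 0 i0 < y 0 i0 else y 0 i0 < x 0 i0) ->
    lim (f @ within D (nbhs x)) = c x i0 b.
  move=> vb DE; apply: lim_of_close.
    apply: within_proper => t t0; have [y [xy yi]] := hball_nonempty vb t0.
    by exists y => //; apply/DE.
  move=> e e0; have [t t0 ht] := fc x i0 b vb e e0.
  by apply/nbhs_QdP; exists t => // y xy /DE yi; exact: ht.
have right : valid i0 true x -> right_lim f x = c x i0 true.
  move=> v; apply: side => // y; split => [/(_ i0)//|h i]; by rewrite (ii0 i).
have left : valid i0 false x -> left_lim f x = c x i0 false.
  move=> v; apply: side => // y; split => [/(_ i0)//|h i]; by rewrite (ii0 i).
have /andP[x0 x1] := Qd01 x i0.
have allE (a : R) : [forall i, Qd_val x 0 i == a] = (x 0 i0 == a).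
  by apply/forallP/idP => [/(_ i0)//|h i]; rewrite (ii0 i).
rewrite !allE /side_mean.
case: eqP => [xi0|/eqP xi0].
  have v : valid i0 true x by rewrite /valid xi0.
  have nv : ~~ valid i0 false x by rewrite /valid xi0 ltxx.
  by rewrite v (negbTE nv) right //; lra.
case: eqP => [xi1|/eqP xi1].
  have v : valid i0 false x by rewrite /valid xi1.
  have nv : ~~ valid i0 true x by rewrite /valid xi1 ltxx.
  by rewrite v (negbTE nv) left //; lra.
have v1 : valid i0 true x by rewrite /valid lt_neqAle xi1.
have v2 : valid i0 false x by rewrite /valid lt_neqAle eq_sym xi0.
by rewrite v1 v2 left // right // addrC.
Qed.

End projection.

(** * Approximation of side limits *)

Section essential_errors.
Context (R : realType) (d k : nat) (hk : (0 < k)%N).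
Implicit Types (x y : Qd R d) (f u : Qd R d -> R).

(** A half ball that points into a cube meets it in a set on which [u] is close to the
    polynomial, so the limit is as close. *)
Lemma side_lim_error F u c q a r x i b e : thick F -> side_lim F u c -> @Pk R d k q ->
  0 < r -> cube a r `<=` unit_cube R d ->
  F [set y | cube a r (Qd_val y) -> `|u y - q y| <= e] -> cube a r (Qd_val x) ->
  (if b then x 0 i < a 0 i + r else a 0 i < x 0 i) -> `|c x i b - q x| <= e.
Proof.
move=> tF uc Pq r0 ar uq ax xb; apply/ler_addgt0Pr => e' e'0.
have e'2 : 0 < e' / 2 by lra.
have vx : valid i b x.
  have [a0 a1] := unit_cubeE r0 ar i; move: xb; rewrite /valid.
  by case: (b); lra.
have [t t0 ht] := uc x i b vx _ e'2.
have [t' t'0 ht'] := Pk_continuous hk x Pq e'2.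
have [s sx si] := points_in_exists1 r0 ax xb.
have [|y [[/= y1 y2] xy ay sy]] := thick_near (t := Num.min t t') tF
  (thickI tF ht uq) r0 ar ax sx; first by rewrite lt_min t0.
have m1 : Num.min t t' <= t by rewrite ge_min lexx.
have m2 : Num.min t t' <= t' by rewrite ge_min lexx orbT.
have h1 : hball i b x t y by split; [exact: qball_le m1 _ xy|have := sy i; rewrite si].
have := y1 h1; have := y2 ay; have := ht' y (qball_le m2 xy).
rewrite ltr_norml !ler_norml => /andP[? ?] /andP[? ?] /andP[? ?].
by apply/andP; split; lra.
Qed.

Section scalar.
Context (hd : (0 < d)%N).
Let i0 := Ordinal hd.

Lemma side_mean_error F u c q a r x e : thick F -> side_lim F u c -> @Pk R d k q ->
  0 < r -> cube a r `<=` unit_cube R d ->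
  F [set y | cube a r (Qd_val y) -> `|u y - q y| <= e] ->
  a 0 i0 < x 0 i0 < a 0 i0 + r -> cube a r (Qd_val x) ->
  `|side_mean i0 c x - q x| <= e.
Proof.
move=> tF uc Pq r0 ar uq /andP[x1 x2] ax; apply: side_mean_close => b _.
apply: (side_lim_error tF uc Pq r0 ar uq ax).
by case: b.
Qed.

Lemma side_lim_error_jump F u c q a r x e e' (f : R) : thick F -> side_lim F u c ->
  @Pk R d k q -> 0 < r -> cube a r `<=` unit_cube R d ->
  F [set y | cube a r (Qd_val y) -> `|u y - q y| <= e] ->
  cube a r (Qd_val x) -> (forall b, valid i0 b x -> `|f - c x i0 b| <= e') ->
  `|f - q x| <= e + e'.
Proof.
move=> tF uc Pq r0 ar uq ax fx.
have [s sx] := points_in_exists r0 ax.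
have h := side_lim_error tF uc Pq r0 ar uq ax (sx i0).
have vx : valid i0 (s i0) x.
  have [a0 a1] := unit_cubeE r0 ar i0; have := sx i0; rewrite /valid.
  by case: (s i0); lra.
have := fx _ vx; move: h; rewrite !ler_norml => /andP[? ?] /andP[? ?].
by apply/andP; split; lra.
Qed.

End scalar.

Lemma E_esssup_ae f u Q : ae_eq (leb R d) setT (f : QdL R d -> R) (u : QdL R d -> R) ->
  E_esssup k f Q = E_esssup k u Q.
Proof.
move=> fu; rewrite /E_esssup; congr ereal_inf; apply: eq_imagel => q _.
rewrite unlock /Lnorm; case: ifP => // _; apply: ess_sup_inf.eq_ess_sup.
apply: (thickS (@thick_almost R d) _ fu) => x /= /(_ I) fx.
by rewrite /= /patch; case: ifP => // _; rewrite /= fx.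
Qed.

End essential_errors.

(** * Lower semicontinuity of the error, isometry in higher dimension *)

Lemma midpoint_powR (R : realType) (p a b : R) : 1 <= p -> 0 <= a -> 0 <= b ->
  ((a + b) / 2) `^ p <= (a `^ p + b `^ p) / 2.
Proof.
move=> p1 a0 b0.
have inp (z : R) : 0 <= z -> z \in `[0, +oo[%classic by move=> z0; apply: mem_set; rewrite /= in_itv /= z0.
have h01 : 0 <= (2^-1 : R) <= 1 by lra.
have h : (2^-1 * a + (1 - 2^-1) * b) `^ p <= 2^-1 * a `^ p + (1 - 2^-1) * b `^ p.
  exact: (@convex_powR R p p1 (Itv01 (andP h01).1 (andP h01).2) a b (inp _ a0) (inp _ b0)).
have e : 2^-1 * a + (1 - 2^-1) * b = (a + b) / 2 by lra.
by rewrite e in h; lra.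
Qed.

Lemma ge0_lee_ext (R : realType) (X Y : \bar R) : (0 <= Y)%E ->
  (forall e : R, (Y < e%:E)%E -> (X <= e%:E)%E) -> (X <= Y)%E.
Proof.
case: Y => [y _ h| _ _|//]; last by rewrite leey.
apply/lee_addgt0Pr => e e0; rewrite -EFinD; apply: h.
by rewrite lte_fin ltrDl.
Qed.

Section isometry.
Context (R : realType) (d k : nat) (p : R) (hd : (0 < d)%N) (hk : (0 < k)%N).
Implicit Types (x y : Qd R d) (f u : Qd R d -> R) (c : Qd R d -> 'I_d -> bool -> R).

Let i0 := Ordinal hd.

Lemma E_esssup_le_E_sup f a r : 0 < r -> cube a r `<=` unit_cube R d ->
  (E_esssup k f (cube a r) <= E_sup k f (cube a r))%E.
Proof.
move=> r0 ar.
have ax : exists x : Qd R d, cube a r (Qd_val x).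
  have av := cubexx a (ltW r0); by exists (mkQd (ar _ av)).
apply: ge0_lee_ext; first exact: E_sup_ge0.
move=> e he; apply: near_Pk_E_esssup.
  by rewrite -lee_fin; apply: le_trans (ltW he); exact: E_sup_ge0.
by have [q Pq hq] := E_sup_near_Pk he; exists q => //; exact: sure_almost.
Qed.

Lemma isometry_dim2 f c : 1 <= p -> (2 <= d)%N -> side_lim (@sure R d) f c ->
  f = side_mean i0 c ->
  (packing_sup p (E_sup k f) <= packing_sup p (E_esssup k f))%E.
Proof.
move=> hp d2 fc ff; apply: packing_sup_mono => // a r r0 ar; split.
  apply: E_sup_ge0; have av := cubexx a (ltW r0); by exists (mkQd (ar _ av)).
apply: ge0_lee_ext; first exact: E_esssup_ge0.
move=> e /E_esssup_near_Pk[q Pq hq]; apply: near_Pk_E_sup; exists q => // x ax.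
rewrite -[e]addr0.
apply: (side_lim_error_jump hk (hd := hd) (@thick_almost R d) (side_lim_almost fc) Pq r0 ar hq ax).
move=> b vb; rewrite ff (side_mean_eq (a := c x i0 b)) ?subrr ?normr0 // => b' vb'.
exact: side_lim_dim2 d2 (@thick_sure R d) fc _ _.
Qed.

End isometry.

Section isometry_dim1.
Context (R : realType) (d k : nat) (p : R) (hd : (0 < d)%N) (hk : (0 < k)%N).
Implicit Types (x y : Qd R d) (f u : Qd R d -> R) (c : Qd R d -> 'I_d -> bool -> R).

Let i0 := Ordinal hd.
Context (d1 : forall i : 'I_d, i = i0).

(** The right neighbourhoods of zero. *)
Definition small : set_system R :=
  [set A | exists2 t, 0 < t & forall s, 0 < s < t -> A s].

Lemma small_filter : ProperFilter small.
Proof.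
apply: Build_ProperFilter_ex => [A [t t0 tA]|].
  by exists (t / 2); apply: tA; apply/andP; split; lra.
split; first by exists 1.
- move=> A B [t t0 tA] [t' t'0 tB]; exists (Num.min t t'); first by rewrite lt_min t0.
  by move=> s /andP[s0]; rewrite lt_min => /andP[? ?]; split; [apply: tA|apply: tB]; apply/andP.
- by move=> A B AB [t t0 tA]; exists t => // s st; apply: AB; exact: tA.
Qed.

#[local] Existing Instance small_filter.

Lemma smallI A B : small A -> small B -> small (A `&` B).
Proof. exact: filterI. Qed.

Lemma small_seq (T : eqType) (s : seq T) (A : T -> set R) :
  (forall z, z \in s -> small (A z)) -> small [set t | forall z, z \in s -> A z t].
Proof.
elim: s => [_|z s IH h]; first by exists 1.
have h1 : small (A z) by apply: h; rewrite mem_head.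
have h2 : small [set t | forall z, z \in s -> A z t].
  by apply: IH => z' zs; apply: h; rewrite in_cons zs orbT.
apply: filterS (filterI h1 h2) => t [/= t1 t2] z'.
by rewrite in_cons => /orP[/eqP ->//|]; exact: t2.
Qed.

Lemma small_lt (t : R) : 0 < t -> small [set s | 0 < s < t].
Proof. by move=> t0; exists t. Qed.

Lemma Qd_eq1 x y : x 0 i0 = y 0 i0 -> x = y.
Proof. by move=> xy; apply: Qd_inj => i; rewrite (d1 i). Qed.

Lemma cube1E a r (v : 'rV[R]_d) : cube a r v <-> a 0 i0 <= v 0 i0 <= a 0 i0 + r.
Proof. by split => [/(_ i0)//|h i]; rewrite (d1 i). Qed.

Lemma Pk_univariate q : @Pk R d k q ->
  exists2 P : {poly R}, (size P <= k)%N & forall x, q x = P.[x 0 i0].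
Proof.
move=> /Pk_evalm[m mk qE].
have [P Pk PE] := evalm_line 0 (delta_mx 0 i0) mk; exists P => // x.
rewrite qE -PE; congr evalm; apply/rowP => j.
by rewrite (d1 j) !mxE eqxx mulr1 add0r.
Qed.

(** Lower semicontinuity of the error for pointwise convergence. A polynomial that
    approximates a bounded function well has bounded values at the nodes, so if the
    error of the limit exceeds [e], then compactness of the set of these values makes
    a violation at finitely many points, hence for all functions close to the limit. *)
Lemma E_sup_lsc f (f_ : R -> Qd R d -> R) (M : R) a r e :
  0 < r -> cube a r `<=` unit_cube R d ->
  (forall x e', 0 < e' -> small [set t | `|f_ t x - f x| <= e']) ->
  small [set t | forall x, `|f_ t x| <= M] ->
  (e%:E < E_sup k f (cube a r))%E ->
  small [set t | forall P : {poly R}, (size P <= k)%N ->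
    ~ forall x, cube a r (Qd_val x) -> `|f_ t x - P.[x 0 i0]| <= e].
Proof.
move=> r0 ar ff fM eE.
pose lag (j : 'I_k) : {poly R} := tnth (qpoly.lagrange k (@node R k)) j.
pose V (v : 'rV[R]_k) x := \sum_(j < k) v 0 j * (lag j).[(x 0 i0 - a 0 i0) / r].
pose M' := M + `|e|.
pose K := [set v : 'rV[R]_k | forall j, `[- M', M']%classic (v ord0 j)].
have cK : compact K.
  exact: (@rV_compact R k (fun j => `[- M', M']%classic) (fun j => @segment_compact _ _ _)).
move/compact_near_coveringP : cK => /(_ R small
  (fun t v => exists2 x : Qd R d, cube a r (Qd_val x) & e < `|f_ t x - V v x|)) cK.
have V_Pk v : @Pk R d k (V v).
  pose P := (\sum_(j < k) (v 0 j)%:P * lag j) \Po (r^-1 *: 'X + (- (a 0 i0 / r))%:P).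
  have Pk : (size P <= k)%N.
    apply: (size_comp_affine _ _ hk); apply: leq_trans (size_sum _ _ _) _.
    apply/bigmax_leqP => j _; rewrite mul_polyC.
    apply: leq_trans (size_scale_leq _ _) _.
    by rewrite /lag (qpoly.size_lagrange_ hk (@node_inj R k hk)).
  have -> : V v = fun x => P.[x 0 i0]; last exact: Pk_coord.
  apply/funext => x; rewrite /V /P horner_comp horner_sum; apply: eq_bigr => j _.
  rewrite hornerM hornerC !hornerE; congr (_ * _.[_]).
  by field; lra.
have {}cK : small [set t | forall v, K v -> exists2 x : Qd R d, cube a r (Qd_val x) & e < `|f_ t x - V v x|].
  apply: cK => v Kv.
  have [x ax ex] : exists2 x : Qd R d, cube a r (Qd_val x) & e < `|f x - V v x|.
    apply: contrapT => h; move: eE; rewrite ltNge => /negP; apply.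
    apply: near_Pk_E_sup; exists (V v) => // x ax.
    by rewrite leNgt; apply/negP => ex; apply: h; exists x.
  pose S := \sum_(j < k) `|(lag j).[(x 0 i0 - a 0 i0) / r]|.
  have S0 : 0 <= S by apply: sumr_ge0.
  pose h := (`|f x - V v x| - e) / 4.
  have h0 : 0 < h by rewrite /h; lra.
  have hS : 0 < h / (S + 1) by rewrite divr_gt0 // ltr_wpDl.
  exists (ball v (h / (S + 1)), [set t | `|f_ t x - f x| <= h]) => /=.
    by split; [exact: nbhsx_ballx|exact: ff].
  move=> [w t] /= [[_ vw] ft]; exists x => //.
  have hV : `|V v x - V w x| <= h.
    rewrite /V -sumrB; apply: le_trans (ler_norm_sum _ _ _) _.
    apply: (@le_trans _ _ (h / (S + 1) * S)).
      rewrite /S mulr_sumr; apply: ler_sum => j _.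
      rewrite -mulrBl normrM ler_wpM2r //.
      by have := vw 0 j; rewrite /ball /= => /ltW.
    have q1 : (S + 1)^-1 * S <= 1 by rewrite mulrC ler_pdivrMr; lra.
    by rewrite -mulrA ler_piMr // ltW.
  have -> : f_ t x - V w x = (f_ t x - f x) + (f x - V v x) + (V v x - V w x) by ring.
  have k1 := lerB_normD (f x - V v x) ((f_ t x - f x) + (V v x - V w x)).
  have k2 := ler_normD (f_ t x - f x) (V v x - V w x).
  rewrite (_ : _ + _ + _ = (f x - V v x) + ((f_ t x - f x) + (V v x - V w x))); last by ring.
  by move: h0 hV ft k1 k2; rewrite /h; lra.
apply: filterS (filterI cK fM) => t [/= h1 h2] P Pk hP.
pose P' := P \Po (r *: 'X + (a 0 i0)%:P).
have P'k : (size P' <= k)%N by exact: (size_comp_affine _ _ hk).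
have [|x ax] := h1 (\row_j P'.[node R k j]).
  move=> j; rewrite /= in_itv /= mxE -ler_norml.
  have n01 := node01 R j.
  pose w : 'rV[R]_d := \row_i (a 0 i0 + r * node R k j).
  have aw : cube a r w.
    apply/cube1E; rewrite mxE; have /andP[n0 n1] := n01.
    have : 0 <= r * node R k j by rewrite mulr_ge0 // ltW.
    have : r * node R k j <= r by rewrite ler_piMr // ltW.
    by move=> *; apply/andP; split; lra.
  have := hP (mkQd (ar _ aw)) aw; have := h2 (mkQd (ar _ aw)).
  rewrite mkQdE mxE /P' horner_comp !hornerE [_ + a 0 i0]addrC.
  have := ler_norm e; rewrite /M' !ler_norml => ? /andP[? ?] /andP[? ?].
  by apply/andP; split; lra.
apply/negP; rewrite -leNgt; have := hP x ax; congr (`|_ - _| <= e).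
have {1}-> : x 0 i0 = (r *: 'X + (a 0 i0)%:P).[(x 0 i0 - a 0 i0) / r].
  by rewrite hornerD hornerZ hornerX hornerC mulrC divfK ?gt_eqF // subrK.
rewrite -horner_comp -/P' (horner_interpolation _ hk P'k).
by apply: eq_bigr => j _; rewrite mxE.
Qed.

End isometry_dim1.

(** * Isometry in dimension one *)

Section shrinking.
Context (R : realType) (d : nat).
Implicit Types (x y : Qd R d).

(** The contraction of the unit cube with factor [1 - t] that fixes its upper ([b]
    true) or lower corner. *)
Definition shrink (b : bool) (t : R) (v : 'rV[R]_d) : 'rV[R]_d :=
  \row_j ((1 - t) * v 0 j + (if b then t else 0)).

Lemma shrink_unit b t v : 0 <= t <= 1 -> unit_cube R d v -> unit_cube R d (shrink b t v).
Proof.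
move=> /andP[t0 t1] v01 j; have := v01 j; rewrite !mxE !add0r => /andP[v0 v1].
have : 0 <= (1 - t) * v 0 j by apply: mulr_ge0; lra.
have : (1 - t) * v 0 j <= 1 - t by rewrite ler_piMr //; lra.
by case: b => *; apply/andP; split; lra.
Qed.

Definition shrinkQ b t x : Qd R d :=
  match pselect (unit_cube R d (shrink b t (Qd_val x))) with
  | left h => mkQd h
  | right _ => x
  end.

Lemma shrinkQE b t x : 0 <= t <= 1 -> Qd_val (shrinkQ b t x) = shrink b t (Qd_val x).
Proof.
move=> ht; rewrite /shrinkQ; case: pselect => // h; exfalso; apply: h.
exact: shrink_unit (Qd_in x).
Qed.

Lemma shrink_cube b t a r : t < 1 ->
  shrink b t @` cube a r = cube (shrink b t a) ((1 - t) * r).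
Proof.
move=> t1; have t0 : 0 < 1 - t by lra.
apply/seteqP; split => [_ [v av <-] j|w aw].
  have /andP[? ?] := av j; rewrite !mxE.
  have : (1 - t) * a 0 j <= (1 - t) * v 0 j by rewrite ler_pM2l.
  have : (1 - t) * v 0 j <= (1 - t) * (a 0 j + r) by rewrite ler_pM2l.
  by rewrite mulrDr => *; apply/andP; split; lra.
exists (\row_j ((w 0 j - (if b then t else 0)) / (1 - t))); last first.
  by apply/rowP => j; rewrite !mxE [(1 - t) * _]mulrC divfK ?gt_eqF // subrK.
move=> j; have := aw j; rewrite !mxE; set s := (if b then t else 0) => /andP[? ?].
rewrite ler_pdivlMr // ler_pdivrMr //; apply/andP; split; first by rewrite mulrC; lra.
by rewrite mulrDl [r * _]mulrC [a 0 j * _]mulrC; lra.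
Qed.

Lemma shrink_inj b t : t < 1 -> injective (shrink b t).
Proof.
move=> t1 v w /rowP vw; apply/rowP => j; have := vw j; rewrite !mxE => /addIr.
by apply: mulfI; rewrite gt_eqF //; lra.
Qed.

Lemma shrink_packing_sum (p : R) (E : set 'rV[R]_d -> \bar R) pi b t : 1 <= p -> packing pi ->
  0 <= t < 1 -> (\sum_(Q \in pi) E (shrink b t @` Q) `^ p <= packing_sup p E `^ p)%E.
Proof.
move=> hp hpi /andP[t0 t1]; have [fpi cpi _] := hpi; have t10 : 0 < 1 - t by lra.
apply: (nonoverlapping_sum_le hp) => // [Q piQ|Q Q' a r piQ piQ' r0 aQ aQ'].
  have [[a [r [r0 ->]]] ar] := cpi Q piQ; split.
    by exists (shrink b t a), ((1 - t) * r); rewrite shrink_cube // mulr_gt0.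
  by move=> _ [v av <-]; apply: shrink_unit; [lra|exact: ar].
pose a' : 'rV[R]_d := \row_j ((a 0 j - (if b then t else 0)) / (1 - t)).
have aE : cube a r = shrink b t @` cube a' (r / (1 - t)).
  rewrite shrink_cube //; congr cube; last by rewrite mulrC divfK ?gt_eqF.
  by apply/rowP => j; rewrite !mxE [(1 - t) * _]mulrC divfK ?gt_eqF // subrK.
have sub Q0 : cube a r `<=` shrink b t @` Q0 -> cube a' (r / (1 - t)) `<=` Q0.
  move=> h v av; have : (shrink b t @` cube a' (r / (1 - t))) (shrink b t v) by exists v.
  by rewrite -aE => /h[w Qw /(shrink_inj t1) <-].
by apply: (packing_eq hpi piQ piQ' _ (sub _ aQ) (sub _ aQ')); rewrite divr_gt0.
Qed.

End shrinking.

Section isometry_dim1_proof.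
Context (R : realType) (d k : nat) (p : R) (hd : (0 < d)%N) (hk : (0 < k)%N).
Implicit Types (x y : Qd R d).

Let i0 := Ordinal hd.
Context (d1 : forall i : 'I_d, i = i0).
Context (f : Qd R d -> R) (c : Qd R d -> 'I_d -> bool -> R).
Context (fc : side_lim (@sure R d) f c) (fm : f = side_mean i0 c).

#[local] Existing Instance small_filter.

(** The two terms of [side_mean], which are the limits of [f] along the contractions. *)
Definition inward c' x (b : bool) : R := if valid i0 b x then c' x i0 b else c' x i0 (~~ b).

Lemma shrinkQ_fixed b t x : 0 <= t <= 1 -> ~~ valid i0 b x -> shrinkQ b t x = x.
Proof.
move=> ht vx; apply: (Qd_eq1 d1); rewrite shrinkQE // mxE.
have /andP[? ?] := Qd01 x i0; move: vx; rewrite /valid.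
case: b; rewrite -leNgt => ?.
  have -> : x 0 i0 = 1 by lra.
  by lra.
have -> : x 0 i0 = 0 by lra.
by lra.
Qed.

Lemma shrinkQ_hball b t s x : 0 < t < 1 -> t < s -> valid i0 b x ->
  hball i0 b x s (shrinkQ b t x).
Proof.
move=> /andP[t0 t1] ts vx; have /andP[? ?] := Qd01 x i0.
have ht : 0 <= t <= 1 by lra.
have e1 : Qd_val (shrinkQ b t x) 0 i0 - x 0 i0 = t * (if b then 1 - x 0 i0 else - x 0 i0).
  by rewrite shrinkQE // mxE; case: (b); ring.
split.
  move=> j; rewrite (d1 j) e1 normrM (ger0_norm (ltW t0)).
  apply: le_lt_trans ts; apply: ler_piMr; first exact: ltW.
  by case: (b); rewrite ler_norml; apply/andP; split; lra.
move: vx e1; rewrite /valid; case: (b) => vx e1.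
  have : 0 < t * (1 - x 0 i0) by rewrite mulr_gt0 //; lra.
  by lra.
have : 0 < t * x 0 i0 by rewrite mulr_gt0.
by lra.
Qed.

Lemma small01 : small [set t : R | 0 < t < 1].
Proof. exact: small_lt. Qed.

Lemma shrinkQ_lim b x e : 0 < e ->
  small [set t : R | `|f (shrinkQ b t x) - inward c x b| <= e].
Proof.
move=> e0; have [vx|vx] := boolP (valid i0 b x).
  have [s s0 hs] := fc vx e0.
  apply: filterS (filterI small01 (small_lt s0)) => t /= [t01 /andP[_ ts]].
  by rewrite /inward vx; apply: hs; exact: shrinkQ_hball.
apply: filterS small01 => t /= /andP[t0 t1].
rewrite shrinkQ_fixed //; last by lra.
rewrite fm (side_mean_eq (a := inward c x b)) ?subrr ?normr0 ?ltW // => b' vb'.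
by rewrite /inward (negbTE vx); case: b b' vx vb' => -[] // /negP.
Qed.

(** The jumps of [f] at the image of [x] vanish in the limit, even if [f] jumps at
    [x]. *)
Lemma shrinkQ_jump b x e : 0 < e ->
  small [set t : R | forall b', valid i0 b' (shrinkQ b t x) ->
    `|f (shrinkQ b t x) - c (shrinkQ b t x) i0 b'| <= e].
Proof.
move=> e0; have [vx|vx] := boolP (valid i0 b x).
  have e2 : 0 < e / 2 by lra.
  have [s s0 hs] := fc vx e2.
  apply: filterS (filterI small01 (small_lt s0)) => t /= [t01 /andP[_ ts]] b' vb'.
  have xy := shrinkQ_hball t01 ts vx; have h1 := hs _ xy.
  have := side_lim_close (@thick_sure R d) fc hs xy vb'.
  by move: h1; rewrite !ler_norml => /andP[? ?] /andP[? ?]; apply/andP; split; lra.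
apply: filterS small01 => t /= /andP[t0 t1] b'.
rewrite shrinkQ_fixed //; last by lra.
move=> vb'; rewrite fm (side_mean_eq (a := c x i0 b')) ?subrr ?normr0 ?ltW // => b2 vb2.
by case: b b' b2 vx vb' vb2 => -[] -[] // /negP.
Qed.

Context (M : R) (fM : forall x, `|f x| <= M).

Lemma E_sup_bounded a r : 0 < r -> cube a r `<=` unit_cube R d ->
  (0 <= E_sup k f (cube a r))%E /\ (E_sup k f (cube a r) <= M%:E)%E.
Proof.
move=> r0 ar; split.
  apply: E_sup_ge0; have av := cubexx a (ltW r0); by exists (mkQd (ar _ av)).
apply: near_Pk_E_sup; exists (fun x => (0 : {poly R}).[x 0 i0]).
  by apply: Pk_coord; rewrite size_poly0.
by move=> x _; rewrite horner0 subr0.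
Qed.

(** The means of the two rescaled functions tend to [f] pointwise, so by lower
    semicontinuity their errors are eventually almost as large as that of [f]; the mean of
    approximations on the two shrunk copies bounds these errors from above. *)
Lemma E_sup_shrink a r (eta : R) : 0 < r -> cube a r `<=` unit_cube R d -> 0 < eta < 1 ->
  small [set t : R | ((1 - eta)%:E * E_sup k f (cube a r) <=
    (E_esssup k f (shrink true t @` cube a r) +
     E_esssup k f (shrink false t @` cube a r)) * (2^-1)%:E)%E].
Proof.
move=> r0 ar /andP[eta0 eta1].
have [E0 EM] := E_sup_bounded r0 ar.
have Efin : E_sup k f (cube a r) \is a fin_num.
  by rewrite ge0_fin_numE //; apply: le_lt_trans EM _; rewrite ltry.
move: E0 EM; rewrite -(fineK Efin); set E := fine _; rewrite !lee_fin => E0 EM.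
have [E00|E00] := leP E 0.
  have -> : E = 0 by lra.
  apply: filterS small01 => t _ /=; rewrite mule0 mule_ge0 //.
  by rewrite adde_ge0 // E_esssup_ge0.
pose e := (1 - eta / 2) * E.
pose e2 := eta * E / 8.
have etaE : 0 < eta * E by rewrite mulr_gt0.
have e20 : 0 < e2 by rewrite /e2; lra.
have eE : (e%:E < E_sup k f (cube a r))%E.
  by rewrite -(fineK Efin) lte_fin /e; fold E; lra.
pose f_ t x := (f (shrinkQ true t x) + f (shrinkQ false t x)) / 2.
have ff x e' : 0 < e' -> small [set t : R | `|f_ t x - f x| <= e'].
  move=> e'0; apply: filterS (filterI (shrinkQ_lim true x e'0) (shrinkQ_lim false x e'0)) => t /= [].
  have -> : f x = (inward c x true + inward c x false) / 2 by rewrite {1}fm.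
  rewrite /f_ !ler_norml => /andP[? ?] /andP[? ?].
  by apply/andP; split; lra.
have f_M : small [set t : R | forall x, `|f_ t x| <= M].
  apply: filterS small01 => t _ x; rewrite /f_.
  have := fM (shrinkQ true t x); have := fM (shrinkQ false t x).
  by rewrite !ler_norml => /andP[? ?] /andP[? ?]; apply/andP; split; lra.
have lsc := E_sup_lsc hk d1 r0 ar ff f_M eE.
pose lo : 'rV[R]_d := a; pose hi : 'rV[R]_d := \row_j (a 0 j + r).
have alo : cube a r lo by apply: cubexx; exact: ltW.
have ahi : cube a r hi by move=> j; rewrite mxE; lra.
pose xlo := mkQd (ar _ alo); pose xhi := mkQd (ar _ ahi).
have jump b := smallI (shrinkQ_jump b xlo e20) (shrinkQ_jump b xhi e20).
have all := smallI (smallI small01 lsc) (smallI (jump true) (jump false)).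
apply: filterS all => t /=.
move=> [[/andP[t0 t1] {}lsc] [[jlt jht] [jlf jhf]]].
have t01 : 0 <= t <= 1 by lra.
have r'0 : 0 < (1 - t) * r by rewrite mulr_gt0 //; lra.
(* an essential approximation on a shrunk copy is an approximation everywhere there, up
   to the jumps at the two end points *)
have upgrade b (e' : R) : (E_esssup k f (shrink b t @` cube a r) < e'%:E)%E ->
    exists2 P : {poly R}, (size P <= k)%N & forall x, cube a r (Qd_val x) ->
      `|f (shrinkQ b t x) - P.[x 0 i0]| <= e' + e2.
  have [jl jh] : (forall b', valid i0 b' (shrinkQ b t xlo) ->
      `|f (shrinkQ b t xlo) - c (shrinkQ b t xlo) i0 b'| <= e2) /\
      (forall b', valid i0 b' (shrinkQ b t xhi) ->
      `|f (shrinkQ b t xhi) - c (shrinkQ b t xhi) i0 b'| <= e2) by case: (b).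
  rewrite shrink_cube // => /E_esssup_near_Pk[q Pq hq].
  have ar' : cube (shrink b t a) ((1 - t) * r) `<=` unit_cube R d.
    by rewrite -shrink_cube // => _ [v av <-]; apply: shrink_unit => //; exact: (ar v av).
  have [P Pk PE] := Pk_univariate d1 Pq.
  pose s := if b then t else 0.
  exists (P \Po ((1 - t) *: 'X + s%:P)); first exact: (size_comp_affine _ _ hk Pk).
  move=> x ax.
  have -> : (P \Po ((1 - t) *: 'X + s%:P)).[x 0 i0] = q (shrinkQ b t x).
    by rewrite PE horner_comp shrinkQE // mxE hornerD hornerZ hornerX hornerC.
  have ax' : cube (shrink b t a) ((1 - t) * r) (Qd_val (shrinkQ b t x)).
    by rewrite -shrink_cube // shrinkQE //; exists (Qd_val x).
  have endpoint (z : Qd R d) : x = z -> (forall b', valid i0 b' (shrinkQ b t z) ->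
      `|f (shrinkQ b t z) - c (shrinkQ b t z) i0 b'| <= e2) ->
      `|f (shrinkQ b t x) - q (shrinkQ b t x)| <= e' + e2.
    move=> xz hz; subst z.
    exact: (side_lim_error_jump hk (hd := hd) (@thick_almost R d) (side_lim_almost fc) Pq r'0 ar' hq ax' hz).
  have /andP[x1 x2] := ax i0.
  have [xa|xa] := eqVneq (x 0 i0) (a 0 i0); first by apply: (endpoint xlo) => //; exact: (Qd_eq1 d1).
  have [xr|xr] := eqVneq (x 0 i0) (a 0 i0 + r).
    by apply: (endpoint xhi) => //; apply: (Qd_eq1 d1); rewrite mkQdE mxE.
  rewrite {1}fm; apply: (@le_trans _ _ e'); last by lra.
  apply: (side_mean_error hk (hd := hd) (@thick_almost R d) (side_lim_almost fc) Pq r'0 ar' hq _ ax').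
  rewrite shrinkQE // !mxE.
  have k1 : a 0 i0 < x 0 i0 by rewrite lt_neqAle eq_sym xa.
  have k2 : x 0 i0 < a 0 i0 + r by rewrite lt_neqAle xr.
  have : (1 - t) * a 0 i0 < (1 - t) * x 0 i0 by rewrite ltr_pM2l //; lra.
  have : (1 - t) * x 0 i0 < (1 - t) * (a 0 i0 + r) by rewrite ltr_pM2l //; lra.
  by rewrite mulrDr => *; apply/andP; split; lra.
rewrite -EFinM.
have pos b := E_esssup_ge0 k f (shrink b t @` cube a r).
have infinite (X : \bar R) : (0 <= X -> (+oo + X) * (2^-1)%:E = +oo)%E.
  move=> X0; rewrite addye; last by rewrite gt_eqF // (lt_le_trans _ X0) // ltNyr.
  by rewrite gt0_mulye // lte_fin.
have := pos true; have := pos false; have := upgrade true; have := upgrade false.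
case: (E_esssup k f (shrink false t @` cube a r)) => [e3||];
  case: (E_esssup k f (shrink true t @` cube a r)) => [e1||] // up3 up1 p3 p1;
  try by [rewrite infinite ?leey | rewrite addeC infinite ?leey].
rewrite -EFinD -EFinM lee_fin leNgt; apply/negP => lt.
have [|P1 P1k hP1] := up1 (e1 + e2); first by rewrite lte_fin ltrDl.
have [|P3 P3k hP3] := up3 (e3 + e2); first by rewrite lte_fin ltrDl.
apply: (lsc (2^-1 *: (P1 + P3))).
  apply: leq_trans (size_scale_leq _ _) _; apply: leq_trans (size_polyD _ _) _.
  by rewrite geq_max P1k.
move=> x ax; rewrite hornerZ hornerD /f_; have := hP1 x ax; have := hP3 x ax.
move: lt; rewrite /e /e2 !ler_norml => lt /andP[? ?] /andP[? ?].
by apply/andP; split; lra.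
Qed.

(** The factor [1 - eta] leaves room for the error terms, relative to the finitely many
    cubes of the packing; it disappears at the end. *)
Lemma isometry_dim1 : 1 <= p ->
  (packing_sup p (E_sup k f) <= packing_sup p (E_esssup k f))%E.
Proof.
move=> hp; apply: packing_sup_le => //; first exact: packing_sup_ge0.
move=> pi hpi; have [fpi cpi _] := hpi.
have pge0 : 0 <= p by exact: le_trans ler01 hp.
have pn0 : p != 0 by rewrite gt_eqF // (lt_le_trans ltr01).
have S0 := packing_sup_ge0 p (E_esssup k f).
have [Sfin|] := boolP (packing_sup p (E_esssup k f) \is a fin_num); last first.
  by rewrite ge0_fin_numE // -leNgt leye_eq => /eqP ->; rewrite poweRyr ?leey.
have cubes b t : 0 <= t < 1 -> forall Q, pi Q ->
    (0 <= E_esssup k f (shrink b t @` Q) < +oo)%E.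
  move=> t01 Q piQ; rewrite E_esssup_ge0 /=.
  have [[a [r [r0 Qa]]] ar] := cpi Q piQ; rewrite Qa in ar *.
  rewrite shrink_cube; last by lra.
  apply: (@le_lt_trans _ _ (packing_sup p (E_esssup k f))); last by rewrite ltey_eq Sfin.
  apply: E_le_packing_sup => //; [by rewrite mulr_gt0 //; lra| |exact: E_esssup_ge0].
  by rewrite -shrink_cube => [_ [v av <-]|]; [apply: shrink_unit; [lra|exact: ar]|lra].
pose s := fine (packing_sup p (E_esssup k f)).
have s0 : 0 <= s by rewrite fine_ge0.
pose E Q := fine (E_sup k f Q).
have EE Q : pi Q -> E_sup k f Q = (E Q)%:E /\ 0 <= E Q.
  move=> piQ; have [[a [r [r0 Qa]]] ar] := cpi Q piQ.
  rewrite /E Qa in ar *; have [h1 h2] := E_sup_bounded r0 ar.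
  rewrite fineK ?fine_ge0 // ge0_fin_numE //.
  by apply: le_lt_trans h2 _; rewrite ltry.
have main eta : 0 < eta < 1 -> \sum_(Q \in pi) ((1 - eta) * E Q) `^ p <= s `^ p.
  move=> eta01.
  have /filter_ex[t [/andP[t0 t1] ht]] : small ([set t : R | 0 < t < 1] `&`
      [set t : R | forall Q, Q \in fset_set pi -> ((1 - eta)%:E * E_sup k f Q <=
    (E_esssup k f (shrink true t @` Q) + E_esssup k f (shrink false t @` Q)) * (2^-1)%:E)%E]).
    apply: filterI; first exact: small01.
    apply: (@small_seq R _ (finmap.enum_fset (fset_set pi))) => Q.
    rewrite in_fset_set // => /set_mem piQ; have [[a [r [r0 Qa]]] ar] := cpi Q piQ.
    by rewrite Qa in ar *; exact: E_sup_shrink.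
  have t01 : 0 <= t < 1 by lra.
  pose e b Q := fine (E_esssup k f (shrink b t @` Q)).
  have ee b Q : pi Q -> E_esssup k f (shrink b t @` Q) = (e b Q)%:E /\ 0 <= e b Q.
    move=> piQ; have /andP[h1 h2] := cubes b t t01 Q piQ.
    by rewrite /e fineK ?fine_ge0 // ge0_fin_numE.
  have sum b : \sum_(Q \in pi) e b Q `^ p <= s `^ p.
    have := shrink_packing_sum (E_esssup k f) b hp hpi t01.
    rewrite -(fineK Sfin) poweR_EFin -/s -lee_fin -fsumEFin //; apply: le_trans.
    apply: lee_fsum => // Q /(ee b)[-> _].
    by rewrite poweR_EFin.
  apply: (@le_trans _ _ (\sum_(Q \in pi) (2^-1 * e true Q `^ p + 2^-1 * e false Q `^ p))).
    rewrite -lee_fin -!fsumEFin //; apply: lee_fsum => // Q piQ; rewrite lee_fin.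
    have [EQ E0] := EE Q piQ; have [e1 e10] := ee true Q piQ; have [e2 e20] := ee false Q piQ.
    have := ht Q; rewrite in_fset_set // mem_set // EQ e1 e2 -!EFinD -!EFinM lee_fin => /(_ isT) h.
    apply: (@le_trans _ _ (((e true Q + e false Q) / 2) `^ p)).
      apply: ge0_ler_powR => //; rewrite ?nnegrE //.
      - by rewrite mulr_ge0 //; lra.
      - by lra.
    by rewrite -mulrDr [leRHS]mulrC; exact: (midpoint_powR hp e10 e20).
  rewrite fsbig_split //=.
  have half b : \sum_(Q \in pi) 2^-1 * e b Q `^ p <= 2^-1 * s `^ p.
    by rewrite -mulr_fsumr ler_pM2l ?invr_gt0 // sum.
  apply: le_trans (lerD (half true) (half false)) _.
  have halves (z : R) : 2^-1 * z + 2^-1 * z <= z by lra.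
  exact: halves.
have -> : (\sum_(Q \in pi) E_sup k f Q `^ p = (\sum_(Q \in pi) E Q `^ p)%:E)%E.
  rewrite -fsumEFin //; apply: eq_fsbigr => Q /set_mem piQ.
  by have [-> _] := EE Q piQ; rewrite poweR_EFin.
rewrite -(fineK Sfin) poweR_EFin lee_fin -/s; set T := \sum_(Q \in pi) _ in main *.
have T0 : 0 <= T by apply: fsumr_ge0 => Q _; exact: powR_ge0.
pose t := T `^ p^-1; have t0 : 0 <= t by exact: powR_ge0.
have tT : t `^ p = T by rewrite -powRrM mulVf // powRr1.
rewrite -tT; apply: ge0_ler_powR => //; rewrite leNgt; apply/negP => st.
have tp : 0 < t by exact: le_lt_trans st.
pose eta := (t - s) / (2 * t).
have eta01 : 0 < eta < 1.
  rewrite /eta divr_gt0 /= ?subr_gt0 // ?mulr_gt0 //.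
  by rewrite ltr_pdivrMr ?mulr_gt0 //; lra.
have := main eta eta01.
have -> : \sum_(Q \in pi) ((1 - eta) * E Q) `^ p = ((1 - eta) * t) `^ p.
  rewrite powRM //; last by lra.
  rewrite tT mulr_fsumr; apply: eq_fsbigr => Q /set_mem piQ.
  by rewrite powRM //; [lra|have [] := EE Q piQ].
apply/negP; rewrite -ltNge; apply: gt0_ltr_powR; rewrite ?nnegrE //.
- exact: lt_le_trans hp.
- by apply: mulr_ge0 => //; lra.
- have -> : (1 - eta) * t = (t + s) / 2 by rewrite /eta; field; lra.
  by lra.
Qed.

End isometry_dim1_proof.

(** * The kernel as a sequence space *)

Section ell_p.
Context (R : realType) (d k : nat) (p : R) (hd : (0 < d)%N) (hk : (0 < k)%N) (hp : 1 <= p).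
Implicit Types (x y : Qd R d) (f : Qd R d -> R).

Let i0 := Ordinal hd.
Let pge0 : 0 <= p. Proof. exact: le_trans ler01 hp. Qed.
Let pgt0 : 0 < p. Proof. exact: lt_le_trans hp. Qed.
Let pn0 : p != 0. Proof. by rewrite gt_eqF. Qed.

Local Notation c0 := (fun (_ : Qd R d) (_ : 'I_d) (_ : bool) => 0 : R).

(** A polynomial [e]-close to [f] on a cube around [x] is at most [e] at [x], because [f]
    tends to zero there. *)
Lemma value_le_E f x a r : side_lim (@sure R d) f c0 -> 0 < r ->
  cube a r `<=` unit_cube R d -> cube a r (Qd_val x) ->
  ((`|f x| / 2)%:E <= E_sup k f (cube a r))%E.
Proof.
move=> f0 r0 ar ax; apply: ge0_lee_ext; first by apply: E_sup_ge0; exists x.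
move=> e /E_sup_near_Pk[q Pq hq]; rewrite lee_fin.
have [s sx] := points_in_exists r0 ax.
have := side_lim_error hk (@thick_sure R d) f0 Pq r0 ar hq ax (sx i0).
rewrite sub0r normrN => qx; have := hq x ax.
by have := lerB_dist (f x) (q x); lra.
Qed.

(** The image of the unit cube under the homothety of centre [x] and ratio [l]: it
    contains [x] and stays in the unit cube even if [x] is on the boundary. *)
Definition cube_at x (l : R) : set 'rV[R]_d := cube (\row_j ((1 - l) * x 0 j)) l.

Lemma cube_at_mem x l : 0 <= l -> cube_at x l (Qd_val x).
Proof.
move=> l0 j; rewrite mxE; have /andP[x0 x1] := Qd01 x j.
have : 0 <= l * x 0 j by rewrite mulr_ge0.
have : l * x 0 j <= l by rewrite ler_piMr.
by rewrite mulrBl mul1r => *; apply/andP; split; lra.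
Qed.

Lemma cube_at_unit x l : 0 <= l <= 1 -> cube_at x l `<=` unit_cube R d.
Proof.
move=> /andP[l0 l1]; apply: cube_sub_unit => j; rewrite mxE.
have /andP[x0 x1] := Qd01 x j; split; first by rewrite mulr_ge0 //; lra.
have : (1 - l) * x 0 j <= 1 - l by rewrite ler_piMr //; lra.
by lra.
Qed.

Lemma cube_at_close x l v j : 0 <= l -> cube_at x l v -> `|v 0 j - x 0 j| <= l.
Proof.
move=> l0 /(_ j); rewrite mxE; have /andP[x0 x1] := Qd01 x j.
have : 0 <= l * x 0 j by rewrite mulr_ge0.
have : l * x 0 j <= l by rewrite ler_piMr.
rewrite mulrBl mul1r ler_norml => ? ? /andP[? ?].
by apply/andP; split; lra.
Qed.

Lemma disjoint_cubes_at (D : {fset Qd R d}) : exists l, 0 < l <= 1 /\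
  forall x y, x \in D -> y \in D -> x <> y -> cube_at x l `&` cube_at y l = set0.
Proof.
have /(_ _)/cid2 h (z : D * D) : exists2 g : R, 0 < g & val z.1 <> val z.2 ->
    exists j, 3 * g <= `|(val z.1 : Qd R d) 0 j - (val z.2 : Qd R d) 0 j|.
  have [xy|/Qd_neq[j xy]] := pselect (val z.1 = val z.2); first by exists 1.
  exists (`|(val z.1 : Qd R d) 0 j - (val z.2 : Qd R d) 0 j| / 3).
    by rewrite divr_gt0 // normr_gt0 subr_eq0.
  by move=> _; exists j; lra.
have [l l0 hl] := exists_le_all (fun z => s2valP (h z)).
exists (Num.min l 1); split; first by rewrite lt_min l0 ltr01 /= ge_min lexx orbT.
move=> x y xD yD xy; rewrite -subset0 => v [].
have m0 : 0 < Num.min l 1 by rewrite lt_min l0 ltr01.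
have ml : Num.min l 1 <= l by rewrite ge_min lexx.
have := s2valP' (h ([` xD]%fset, [` yD]%fset)) => /= /(_ xy)[j].
have := hl ([` xD]%fset, [` yD]%fset) => /=; set g := s2val _ => lg hg.
move=> /(cube_at_close j (ltW m0)) + /(cube_at_close j (ltW m0)).
have : x 0 j - y 0 j = - (v 0 j - x 0 j) + (v 0 j - y 0 j) by ring.
move: hg => /[swap] ->; have := ler_normD (- (v 0 j - x 0 j)) (v 0 j - y 0 j).
rewrite normrN; set n1 := `|v 0 j - x 0 j|; set n2 := `|v 0 j - y 0 j|.
by lra.
Qed.

Lemma side_lim0_ellp f : side_lim (@sure R d) f c0 ->
  (V_seminorm k p f < +oo)%E -> ellp p f.
Proof.
move=> f0; rewrite /V_seminorm; set S := packing_sup _ _ => Soo.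
have S0 : (0 <= S)%E by exact: packing_sup_ge0.
apply: poweR_lty; apply: (@le_lt_trans _ _ ((2 `^ p)%:E * S `^ p)%E); last first.
  by rewrite lte_mul_pinfty ?lee_fin ?powR_ge0 // poweR_lty.
apply: ge_ereal_sup => _ [X [fX _] <-].
have [l [/andP[l0 l1] lX]] := disjoint_cubes_at (fset_set X).
have l01 : 0 <= l <= 1 by rewrite ltW.
apply: (@le_trans _ _ ((2 `^ p)%:E * \sum_(x \in X) E_sup k f (cube_at x l) `^ p)%E).
  rewrite ge0_mule_fsumr; last by move=> ?; exact: poweR_ge0.
  apply: lee_fsum => // x Xx.
  have h : ((`|f x| / 2)%:E <= E_sup k f (cube_at x l))%E.
    apply: value_le_E => //; first exact: cube_at_unit.
    by apply: cube_at_mem; exact: ltW.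
  apply: (@le_trans _ _ ((2 `^ p)%:E * (`|f x| / 2)%:E `^ p)%E).
    rewrite poweR_EFin -EFinM lee_fin -powRM ?divr_ge0 //.
    by rewrite mulrC divfK // pnatr_eq0.
  by apply: lee_wpmul2l; rewrite ?lee_fin ?powR_ge0 //; apply: poweR_le_pos => //; rewrite lee_fin divr_ge0.
apply: lee_wpmul2l; first by rewrite lee_fin powR_ge0.
apply: (disjoint_sum_le hp) => // [x Xx|x y Xx Xy].
  by split; [exists (\row_j ((1 - l) * Qd_val x 0 j)), l|exact: cube_at_unit].
by apply: lX; rewrite in_fset_set // mem_set.
Qed.

Lemma ellp_sum f : ellp p f -> exists2 T : R, 0 <= T & forall X : set (Qd R d),
  finite_set X -> (\sum_(x \in X) (`|f x| `^ p)%:E <= T%:E)%E.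
Proof.
rewrite /ellp /=; set I := esum _ _ => Ioo.
have I0 : (0 <= I)%E by apply: esum_ge0 => x _; rewrite lee_fin powR_ge0.
have Ifin : I \is a fin_num.
  rewrite ge0_fin_numE // ltNge; apply/negP => Iy.
  by move: Ioo; rewrite (eqP (_ : I == +oo%E)) ?poweRyr ?invr_eq0 // -leye_eq.
exists (fine I); first by rewrite fine_ge0.
by move=> X fX; rewrite fineK //; apply: ereal_sup_ubound; exists X.
Qed.

Lemma ellp_finite f e : ellp p f -> 0 < e -> finite_set [set x | e < `|f x|].
Proof.
move=> /ellp_sum[T T0 hT] e0; apply: contrapT => /infinite_set_fset h.
have ep : 0 < e `^ p by exact: powR_gt0.
have [n n0 hn] := natr_truncn_le (divr_ge0 T0 (ltW ep)).
have [B BA nB] := h n.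
have : ((n%:R * e `^ p)%:E <= T%:E)%E.
  apply: le_trans (hT [set` B] (finite_fset B)).
  apply: (@le_trans _ _ (\sum_(x \in [set` B]) (e `^ p)%:E)%E); last first.
    apply: lee_fsum => [|x xB]; first exact: finite_fset.
    have /= xe := BA x xB; rewrite lee_fin.
    by apply: ge0_ler_powR => //; rewrite ?nnegrE; exact: ltW.
  rewrite fsbig_finite //= set_fsetK sumEFin lee_fin big_const_seq count_predT iter_addr_0.
  by rewrite -[leRHS]mulr_natl ler_pM2r // ler_nat.
by rewrite lee_fin leNgt -ltr_pdivrMr // hn.
Qed.

Lemma finite_avoid (Z : set (Qd R d)) x : finite_set Z -> exists2 t, 0 < t &
  forall y, qball x t y -> y <> x -> ~ Z y.
Proof.
move=> /finite_seqP[s ->].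
elim: s => [|z s [t t0 ht]]; first by exists 1.
have [zx|/Qd_neq[j zj]] := pselect (z = x).
  exists t => // y xy yx /=; rewrite in_cons => /orP[/eqP yz|]; first by rewrite yz in yx.
  exact: ht.
exists (Num.min t `|Qd_val z 0 j - x 0 j|).
  by rewrite lt_min t0 normr_gt0 subr_eq0.
move=> y xy yx /=; rewrite in_cons => /orP[/eqP yz|].
  by have := xy j; rewrite yz lt_min ltxx andbF.
apply: ht => // i; have := xy i; by rewrite lt_min => /andP[].
Qed.

Lemma ellp_side_lim0 f : ellp p f -> side_lim (@sure R d) f c0.
Proof.
move=> lf x i b _ e e0; have [t t0 ht] := finite_avoid x (ellp_finite lf e0).
exists t => // y xy; rewrite subr0 leNgt; apply/negP => fy.
by have [xy' _] := xy; apply: (ht y xy' (hball_neq xy)).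
Qed.

Lemma ellp_bounded f : ellp p f -> exists M, forall x, `|f x| <= M.
Proof.
move=> /ellp_sum[T T0 hT]; exists (T `^ p^-1) => x.
have := hT [set x] (finite_set1 x); rewrite fsbig_set1 lee_fin => h.
rewrite -[leLHS](@powRr1 _ `|f x|) // -(mulfV pn0) powRrM.
by apply: ge0_ler_powR => //; rewrite ?nnegrE ?invr_ge0 ?powR_ge0.
Qed.

(** A point lies in at most [2 ^ d] cubes of a packing, since two of them that extend
    from the point into the same orthant overlap. *)
Lemma packing_points_sum f T pi (x_ : set 'rV[R]_d -> Qd R d) : packing pi ->
  (forall X : set (Qd R d), finite_set X -> (\sum_(x \in X) (`|f x| `^ p)%:E <= T%:E)%E) ->
  (forall Q, pi Q -> Q (Qd_val (x_ Q))) ->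
  (\sum_(Q \in pi) (`|f (x_ Q)| `^ p)%:E <= (2 ^+ d * T)%:E)%E.
Proof.
move=> hpi hT hx; have [fpi cpi _] := hpi.
have /(_ _)/cid sg Q : exists s : {ffun 'I_d -> bool}, pi Q ->
    exists a r, [/\ 0 < r, Q = cube a r & points_in s (Qd_val (x_ Q)) a r].
  have [piQ|nQ] := pselect (pi Q); last by exists [ffun=> true].
  have [[a [r [r0 Qa]]] _] := cpi Q piQ.
  have := hx Q piQ; rewrite {1}Qa => /(points_in_exists r0)[s sx].
  by exists (finfun s) => _; exists a, r; split => // j; rewrite ffunE; exact: sx.
pose sigma Q := sval (sg Q).
have sigma_inj Q Q' : pi Q -> pi Q' -> sigma Q = sigma Q' -> x_ Q = x_ Q' -> Q = Q'.
  move=> piQ piQ' ss xx.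
  have [a [r [r0 Qa sx]]] := svalP (sg Q) piQ.
  have [a' [r' [r'0 Qa' sx']]] := svalP (sg Q') piQ'.
  rewrite -/(sigma Q) in sx; rewrite -/(sigma Q') -ss -xx in sx'.
  have ax := hx Q piQ; rewrite {1}Qa in ax.
  have ax' := hx Q' piQ'; rewrite {1}Qa' -xx in ax'.
  have [e e0 he] := corner_sub r0 ax sx.
  have [e' e'0 he'] := corner_sub r'0 ax' sx'.
  have m0 : 0 < Num.min e e' by rewrite lt_min e0.
  apply: (packing_eq (a := corner (sigma Q) (Qd_val (x_ Q)) (Num.min e e')) hpi piQ piQ' m0).
    by rewrite [X in _ `<=` X]Qa; apply: he; rewrite m0 ge_min lexx.
  by rewrite [X in _ `<=` X]Qa'; apply: he'; rewrite m0 ge_min lexx orbT.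
rewrite fsbig_finite //= (partition_big sigma predT) //=.
apply: (@le_trans _ _ (\sum_(s : {ffun 'I_d -> bool}) T%:E)%E); last first.
  by rewrite sumEFin sumr_const card_ffun card_bool card_ord lee_fin -[T *+ _]mulr_natl natrX.
apply: lee_sum => s _; rewrite -big_filter.
set r := [seq Q <- _ | _].
have rpi Q : Q \in r -> pi Q /\ sigma Q = s.
  by rewrite mem_filter in_fset_set // => /andP[/eqP ? /set_mem].
rewrite fsbig_seq; last by rewrite filter_uniq // finmap.fset_uniq.
rewrite -(reindex_fsbig x_ [set` r] (x_ @` [set` r]) (fun x => (`|f x| `^ p)%:E)); last first.
  split; [by move=> Q rQ; exists Q| |by []].
  move=> Q Q' /set_mem /rpi[piQ sQ] /set_mem /rpi[piQ' sQ'].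
  by apply: sigma_inj => //; rewrite sQ.
by apply: hT; apply: finite_image; exact: finite_seq.
Qed.

(** Each error is at most twice the value at a well chosen point of the cube. *)
Lemma ellp_V f : ellp p f -> V k p f.
Proof.
move=> lf; have [M fM] := ellp_bounded lf; have [T T0 hT] := ellp_sum lf.
split.
  by exists M; split => [|M' MM' x _]; [exact: num_real|exact: le_trans (fM x) (ltW MM')].
pose B : \bar R := ((2 `^ p)%:E * (2 ^+ d * T)%:E)%E.
have B0 : (0 <= B)%E by rewrite mule_ge0 // lee_fin ?powR_ge0 // mulr_ge0 // exprn_ge0.
apply: (@le_lt_trans _ _ (B `^ p^-1)%E); last by rewrite poweR_lty // ltry.
apply: packing_sup_le => //; first exact: poweR_ge0.
move=> pi hpi; rewrite poweRVK //.
have [fpi cpi _] := hpi.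
have Epos Q : pi Q -> (exists x : Qd R d, Q (Qd_val x)) /\ (0 <= E_sup k f Q)%E.
  move=> /cpi[[a [r [r0 ->]]] ar]; have av := cubexx a (ltW r0).
  have ex : exists x : Qd R d, cube a r (Qd_val x) by exists (mkQd (ar _ av)).
  by split => //; exact: E_sup_ge0.
have E_le Q (m : R) : (forall x : Qd R d, Q (Qd_val x) -> `|f x| <= m) -> (E_sup k f Q <= m%:E)%E.
  move=> fm; apply: near_Pk_E_sup; exists (fun x => (0 : {poly R}).[x 0 i0]).
    by apply: Pk_coord; rewrite size_poly0.
  by move=> x Qx; rewrite horner0 subr0; exact: fm.
have /(_ _)/cid x_ Q : exists x, pi Q -> Q (Qd_val x) /\ (E_sup k f Q <= (2 * `|f x|)%:E)%E.
  have [piQ|nQ] := pselect (pi Q); last by exists point.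
  have [[x0 Qx0] E0] := Epos Q piQ; apply: contrapT => h.
  have {}h x : Q (Qd_val x) -> ((2 * `|f x|)%:E < E_sup k f Q)%E.
    by move=> Qx; rewrite ltNge; apply/negP => le; apply: h; exists x.
  have EM : (E_sup k f Q <= M%:E)%E by exact: E_le.
  have Efin : E_sup k f Q \is a fin_num.
    by rewrite ge0_fin_numE //; apply: le_lt_trans EM _; rewrite ltry.
  move: E0 h (E_le Q); rewrite -(fineK Efin); set e := fine _ => E0 h le.
  have : (e%:E <= (e / 2)%:E)%E.
    by apply: le => x /h; rewrite lte_fin; lra.
  rewrite lee_fin => ee; have := h x0 Qx0; rewrite lte_fin.
  by have := normr_ge0 (f x0); lra.
apply: (@le_trans _ _ ((2 `^ p)%:E * \sum_(Q \in pi) (`|f (sval (x_ Q))| `^ p)%:E)%E).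
  rewrite ge0_mule_fsumr; last by move=> ?; rewrite lee_fin powR_ge0.
  apply: lee_fsum => // Q piQ; have [_ h] := svalP (x_ Q) piQ.
  rewrite -EFinM -powRM //; apply: le_trans (poweR_le_pos _ _ h) _ => //.
  by have [] := Epos Q piQ.
apply: lee_wpmul2l; first by rewrite lee_fin powR_ge0.
apply: packing_points_sum => // Q piQ.
by have [] := svalP (x_ Q) piQ.
Qed.

End ell_p.

(** * A monomial of positive finite seminorm *)

Section volume.
Context (R : realType) (d : nat).

(** The interiors are disjoint measurable sets, each of measure at least a fixed multiple
    of the volume of the cube. *)
Lemma packing_volume (pi : set (set 'rV[R]_d)) (side : set 'rV[R]_d -> R) : packing pi ->
  (forall Q, pi Q -> 0 < side Q /\ exists a, Q = cube a (side Q)) ->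
  \sum_(Q \in pi) side Q ^+ d <= 8 ^+ d.
Proof.
move=> hpi hs; have [fpi cpi tpi] := hpi.
pose F (Q : set 'rV[R]_d) : set (QdL R d) := [set x : Qd R d | Q° (Qd_val x)].
have mF Q : measurable (F Q).
  apply: measurable_open_Qd => x Qx.
  have := Qx; rewrite /F /= => /nbhs_interior/nbhs_ballP[t /= t0 tQ]; exists t => // y xy.
  by apply: tQ; split => // i j; rewrite ord1 /ball /= distrC; exact: xy.
have tF : trivIset pi F.
  move=> Q Q' piQ piQ' [x [Qx Q'x]]; apply: tpi => //.
  by exists (Qd_val x).
have FQ Q : pi Q -> (((side Q / 8) ^+ d)%:E <= leb R d (F Q))%E.
  move=> piQ; have [s0 [a Qa]] := hs Q piQ; set s := side Q in s0 Qa *.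
  have [_ Q1] := cpi Q piQ.
  have s2 : 0 < s / 2 by lra.
  have -> : s / 8 = (s / 2) / 4 by lra.
  apply: le_trans (outer_cube_ge (\row_j (a 0 j + s / 4)) s2) _.
  rewrite /leb /= /lebesgue_outer_Qd; apply: le_lebesgue_outer => v av.
  have iv : Q° v.
    apply/nbhs_ballP; exists (s / 4) => /=; first by lra.
    move=> w [_ vw]; rewrite Qa => j; have := av j; have := vw 0 j.
    rewrite /ball /= !mxE ltr_norml => /andP[? ?] /andP[? ?].
    by apply/andP; split; lra.
  by exists (mkQd (Q1 _ (interior_subset iv))).
suff : ((\sum_(Q \in pi) (side Q / 8) ^+ d)%:E <= 1%:E)%E.
  rewrite lee_fin.
  have -> : \sum_(Q \in pi) (side Q / 8) ^+ d = (8 ^+ d)^-1 * \sum_(Q \in pi) side Q ^+ d.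
    by rewrite mulr_fsumr; apply: eq_fsbigr => Q _; rewrite exprMn exprVn mulrC.
  by rewrite mulrC ler_pdivrMr ?exprn_gt0 // mul1r.
apply: (@le_trans _ _ (leb R d (\bigcup_(Q in pi) F Q))).
  by rewrite measure_fin_bigcup // -fsumEFin //; exact: lee_fsum.
apply: (@le_trans _ _ (lebesgue_outer (cube (0 : 'rV[R]_d) 1))).
  rewrite /leb /= /lebesgue_outer_Qd; apply: le_lebesgue_outer => _ [x _ <-].
  exact: Qd_in.
by apply: le_trans (outer_cube_le _ ltr01) _; rewrite expr1n.
Qed.

End volume.

Section monomial.
Context (R : realType) (d k : nat) (p : R) (hd : (0 < d)%N) (hk : (0 < k)%N) (hp : 1 <= p)
  (hdp : d%:R / p <= k%:R).
Implicit Types (x y : Qd R d) (f : Qd R d -> R).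

Let i0 := Ordinal hd.
Let pge0 : 0 <= p. Proof. exact: le_trans ler01 hp. Qed.
Let pgt0 : 0 < p. Proof. exact: lt_le_trans hp. Qed.
Let pn0 : p != 0. Proof. by rewrite gt_eqF. Qed.

Definition monomial x : R := x 0 i0 ^+ k.

Lemma monomial_side_lim : side_lim (@sure R d) monomial (fun x _ _ => monomial x).
Proof.
move=> x i b vx e e0; have [C C0 hC] := poly_bounded_lipschitz ('X^k : {poly R}).
have C1 : 0 < C + 1 by lra.
exists (e / (C + 1)); first by rewrite divr_gt0.
move=> y [xy _]; have [_] := hC _ _ (Qd01 y i0) (Qd01 x i0).
rewrite !hornerXn => /le_trans; apply.
have h := xy i0.
apply: (@le_trans _ _ ((C + 1) * (e / (C + 1)))).
  by apply: ler_pM => //; [lra|exact: ltW].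
by rewrite mulrC divfK // gt_eqF.
Qed.

Lemma monomial_le1 x : `|monomial x| <= 1.
Proof.
have /andP[x0 x1] := Qd01 x i0.
by rewrite /monomial ger0_norm ?exprn_ge0 // exprn_ile1.
Qed.

(** Subtracting [(x 0 i0 - a 0 i0) ^+ k] from the monomial leaves a polynomial of degree
    less than [k]. *)
Lemma E_sup_monomial_le a r : 0 < r -> cube a r `<=` unit_cube R d ->
  (E_sup k monomial (cube a r) <= (r ^+ k)%:E)%E.
Proof.
move=> r0 ar; apply: near_Pk_E_sup.
pose P : {poly R} := 'X^k - ('X - (a 0 i0)%:P) ^+ k.
exists (fun x => P.[x 0 i0]).
  apply: Pk_coord; rewrite -ltnS.
  have sXn : size ('X^k : {poly R}) = k.+1 by rewrite size_polyXn.
  have sXa : size (('X - (a 0 i0)%:P) ^+ k : {poly R}) = k.+1 by rewrite size_exp_XsubC.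
  have Pk1 : (size P <= k.+1)%N.
    by rewrite (leq_trans (size_polyD _ _)) // geq_max sXn size_polyN sXa leqnn.
  rewrite ltnNge; apply/negP => kP.
  have sP : size P = k.+1 by apply/eqP; rewrite eqn_leq Pk1.
  have := lead_coef_eq0 P; rewrite /lead_coef sP /= coefB.
  have m1 : ('X^k : {poly R})`_k = 1 by rewrite coefXn eqxx.
  have m2 : (('X - (a 0 i0)%:P) ^+ k)`_k = 1.
    have := monic_exp k (monicXsubC (a 0 i0)).
    by rewrite monicE /lead_coef sXa => /eqP.
  by rewrite m1 m2 subrr eqxx => /esym/eqP P0; rewrite P0 size_poly0 in sP.
move=> x ax; rewrite /monomial hornerD hornerN hornerXn horner_exp hornerXsubC.
rewrite opprB addrCA subrr addr0 normrX lerXn2r ?nnegrE ?(ltW r0) //.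
by have /andP[? ?] := ax i0; rewrite ger0_norm; lra.
Qed.

Lemma monomial_V : V k p monomial.
Proof.
split.
  exists 1; split => [|M' MM' x _]; first exact: num_real.
  exact: le_trans (monomial_le1 x) (ltW MM').
apply: (@le_lt_trans _ _ ((8 ^+ d)%:E `^ p^-1)%E); last first.
  by rewrite poweR_EFin ltry.
apply: packing_sup_le => //; first exact: poweR_ge0.
move=> pi hpi; rewrite poweRVK ?lee_fin ?exprn_ge0 //.
have [fpi cpi tpi] := hpi.
have /(_ _)/cid side Q : exists s, pi Q -> 0 < s /\ exists a, Q = cube a s.
  have [piQ|nQ] := pselect (pi Q); last by exists 0.
  by have [[a [r [r0 Qa]]] _] := cpi Q piQ; exists r => _; split => //; exists a.
apply: (@le_trans _ _ (\sum_(Q \in pi) (sval (side Q) ^+ d)%:E)%E); last first.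
  rewrite fsumEFin // lee_fin; apply: packing_volume => // Q piQ.
  exact: (svalP (side Q)).
apply: lee_fsum => // Q piQ; have [s0 [a Qa]] := svalP (side Q) piQ.
set s := sval (side Q) in s0 Qa *.
have [_ ar] := cpi Q piQ; rewrite Qa in ar *.
have s1 : s <= 1 by exact: (cube_side_le1 i0 s0 ar).
have ax : exists x : Qd R d, cube a s (Qd_val x).
  have av := cubexx a (ltW s0); by exists (mkQd (ar _ av)).
apply: (@le_trans _ _ ((s ^+ k)%:E `^ p)%E).
  by apply: poweR_le_pos => //; [exact: E_sup_ge0|exact: E_sup_monomial_le].
rewrite poweR_EFin lee_fin -(powR_mulrn k (ltW s0)) -(powR_mulrn d (ltW s0)) -powRrM.
have dkp : d%:R <= k%:R * p by rewrite -ler_pdivrMr.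
by have := ger_powR (introT andP (conj s0 s1)) dkp.
Qed.

Lemma monomial_norm_gt0 : (0 < V_seminorm k p monomial)%E.
Proof.
have [c c0 hc] := monomial_far R k.
apply: (@lt_le_trans _ _ c%:E); first by rewrite lte_fin.
apply: (@le_trans _ _ (E_sup k monomial (cube 0 1))); last first.
  apply: E_le_packing_sup => //.
  by apply: E_sup_ge0; exists point; exact: Qd_in.
apply: le_ereal_inf_tmp => _ [q Pq <-].
have [m mk qE] := Pk_evalm Pq.
have [P Pk PE] := evalm_line 0 (delta_mx 0 i0) mk.
have [s s01 hs] := hc P Pk.
have v01 : unit_cube R d (s *: delta_mx 0 i0).
  move=> j; rewrite !mxE add0r /=; have /andP[? ?] := s01.
  by case: (j == i0); rewrite ?mulr1 ?mulr0 ?lexx ?ler01 //; apply/andP.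
apply: ereal_sup_ge; exists (`|monomial (mkQd v01) - q (mkQd v01)|%:E).
  by exists (mkQd v01) => //; exact: v01.
have -> : q (mkQd v01) = P.[s] by rewrite qE mkQdE -PE add0r.
by rewrite lee_fin /monomial mkQdE !mxE !eqxx mulr1.
Qed.

(** One inequality suffices, since the other follows from it for the inverse factor. *)
Lemma V_seminorm_scale f a : 0 < a ->
  (V_seminorm k p (fun x => (a * f x)%R) <= a%:E * V_seminorm k p f)%E.
Proof.
move=> a0; rewrite /V_seminorm; apply: packing_sup_le => //.
  by apply: mule_ge0; [rewrite lee_fin ltW|exact: packing_sup_ge0].
move=> pi hpi; have [fpi cpi _] := hpi.
have aE0 : (0 <= a%:E)%E by rewrite lee_fin ltW.
rewrite (poweRM _ aE0 (packing_sup_ge0 _ _)).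
apply: (@le_trans _ _ (a%:E `^ p * \sum_(Q \in pi) E_sup k f Q `^ p)%E); last first.
  by apply: lee_wpmul2l; [exact: poweR_ge0|exact: packing_sum_le].
rewrite ge0_mule_fsumr; last by move=> ?; exact: poweR_ge0.
apply: lee_fsum => // Q piQ.
have ex : exists x : Qd R d, Q (Qd_val x).
  have [[b [r [r0 ->]]] ar] := cpi Q piQ; have av := cubexx b (ltW r0).
  by exists (mkQd (ar _ av)).
have E0 := E_sup_ge0 k f ex.
rewrite -(poweRM _ aE0 E0); apply: poweR_le_pos => //; first exact: E_sup_ge0.
apply: ge0_lee_ext; first exact: mule_ge0.
move=> e he; have : (E_sup k f Q < (e / a)%:E)%E.
  by rewrite mulrC EFinM lte_pdivlMl.
move=> /E_sup_near_Pk[q Pq hq]; apply: near_Pk_E_sup.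
exists (fun x => a * q x + 0 * q x); first exact: Pk_lincomb.
move=> x Qx; rewrite mul0r addr0 -mulrBr normrM gtr0_norm // mulrC -ler_pdivlMr //.
exact: hq.
Qed.

End monomial.

(** * Classes of functions *)

Section classes.
Context (R : realType) (d : nat).
Implicit Types (f g : Qd R d -> R) (u : aeclass R d).

Local Notation "f =ae g" := (ae_eq (leb R d) setT (f : QdL R d -> R) (g : QdL R d -> R))
  (at level 70).

Lemma to_mfunE f : measurable_fun [set: QdL R d] (f : QdL R d -> R) ->
  (to_mfun f : QdL R d -> R) = f.
Proof. by move=> mf; rewrite /to_mfun; case: pselect. Qed.

Lemma ae_eq_L f : measurable_fun [set: QdL R d] (f : QdL R d -> R) -> f =ae L f.
Proof.
move=> mf; have : (L f == \pi_(aeclass R d)%qT (to_mfun f)) by [].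
rewrite -{1}[L f]reprK => /eqP/eqmodP/asboolP h.
apply: (thickS (@thick_almost R d) _ h) => x h0 _.
have e : L f x = to_mfun f x := h0 I.
by rewrite e to_mfunE.
Qed.

Lemma L_unique f u : measurable_fun [set: QdL R d] (f : QdL R d -> R) ->
  f =ae u -> L f = u.
Proof.
move=> mf fu; rewrite -[u]reprK; apply/eqmodP; apply/asboolP.
apply: (thickS (@thick_almost R d) _ fu) => x h0 _.
have e : f x = u x := h0 I.
by rewrite to_mfunE.
Qed.

Lemma L_eqP f g : measurable_fun [set: QdL R d] (f : QdL R d -> R) ->
  measurable_fun [set: QdL R d] (g : QdL R d -> R) ->
  L f = L g <-> almost [set x | f x = g x].
Proof.
move=> mf mg; split=> [fg|fg].
  have := ae_eq_L mf; rewrite fg => h.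
  apply: (thickS (@thick_almost R d) _ (thickI (@thick_almost R d) h (ae_eq_L mg))).
  by move=> x /= [/(_ I) -> /(_ I) ->].
apply: L_unique => //.
apply: (thickS (@thick_almost R d) _ (thickI (@thick_almost R d) fg (ae_eq_L mg))).
by move=> x /= [-> /(_ I) ->].
Qed.

Lemma Linfty_bounded u : Linfty u <-> exists M, almost [set x | `|u x| <= M].
Proof.
have uT : (EFin \o u) = (EFin \o u) \_ [set x : QdL R d | [set: 'rV[R]_d] (Qd_val x)].
  by apply/funext => x; rewrite /patch mem_set.
rewrite /Linfty /= /finite_norm uT; split => [|[M uM]].
  set N := Lnorm _ _ _ => Noo; have N0 : (0 <= N)%E by exact: Lnorm_ge0.
  exists (fine N); have := (@Lnorm_infty_le R d u setT (fine N) (fine_ge0 N0)).1.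
  rewrite -/N fineK ?ge0_fin_numE // => /(_ (lexx _)).
  by apply: (thickS (@thick_almost R d)) => x /= h; exact: h.
apply: (@le_lt_trans _ _ (Num.max 0 M)%:E); last by rewrite ltry.
apply/(@Lnorm_infty_le R d u setT); first by rewrite le_max lexx.
apply: (thickS (@thick_almost R d) _ uM) => x /= h _.
by rewrite le_max h orbT.
Qed.

End classes.

(** * The spaces and the maps between them *)

Section main_lemmas.
Context (R : realType) (d k : nat) (p : R) (hd : (0 < d)%N) (hk : (0 < k)%N) (hp : 1 <= p).
Implicit Types (f g : Qd R d -> R) (u : aeclass R d).

Let i0 := Ordinal hd.

Lemma V_bounded f : V k p f -> exists M, forall x, `|f x| <= M.
Proof.
move=> [[M [_ hM]] _]; exists (M + 1) => x.
by apply: hM => //; rewrite ltrDl.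
Qed.

Lemma bounded_V f M : (forall x, `|f x| <= M) -> (V_seminorm k p f < +oo)%E -> V k p f.
Proof.
move=> fM Vf; split => //; exists M; split; first exact: num_real.
by move=> M' MM' x _; exact: le_trans (fM x) (ltW MM').
Qed.

Lemma V_side_lim f : V k p f -> exists c, side_lim (@sure R d) f c.
Proof.
move=> Vf; have [M fM] := V_bounded Vf; have [_ Voo] := Vf.
exact: (side_lim_exists hp hk (@thick_sure R d) (fM : sure [set x | _]) Voo
  (fun a r e _ _ h => E_sup_near_Pk h)).
Qed.

Lemma V_measurable f : V k p f -> measurable_fun [set: QdL R d] (f : QdL R d -> R).
Proof. by move=> /V_side_lim[c]; exact: side_lim_measurable. Qed.

Lemma bounded_Linfty f M : measurable_fun [set: QdL R d] (f : QdL R d -> R) ->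
  (forall x, `|f x| <= M) -> Linfty (L f).
Proof.
move=> mf fM; apply/Linfty_bounded; exists M.
by apply: (thickS (@thick_almost R d) _ (ae_eq_L mf)) => x /= /(_ I) <-.
Qed.

Lemma Vinf_seminorm_L f : measurable_fun [set: QdL R d] (f : QdL R d -> R) ->
  Vinf_seminorm k p (L f) = packing_sup p (E_esssup k (f : QdL R d -> R)).
Proof.
move=> mf; rewrite /Vinf_seminorm; congr packing_sup; apply/funext => Q.
by apply/esym/E_esssup_ae; exact: ae_eq_L.
Qed.

Lemma Vinf_le_V f : V k p f -> (Vinf_seminorm k p (L f) <= V_seminorm k p f)%E.
Proof.
move=> Vf; rewrite Vinf_seminorm_L; last exact: V_measurable.
apply: packing_sup_mono => // a r r0 ar; split; first exact: E_esssup_ge0.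
exact: E_esssup_le_E_sup.
Qed.

Lemma V_Vinf f : V k p f -> Vinf k p (L f).
Proof.
move=> Vf; have [M fM] := V_bounded Vf; have [_ Voo] := Vf; split.
  exact: bounded_Linfty (V_measurable Vf) fM.
exact: le_lt_trans (Vinf_le_V Vf) Voo.
Qed.

(** With [E_esssup_le_E_sup], this makes [L] isometric on normalised functions. *)
Lemma isometry f c M : side_lim (@sure R d) f c -> f = side_mean i0 c ->
  (forall x, `|f x| <= M) ->
  (V_seminorm k p f <= packing_sup p (E_esssup k (f : QdL R d -> R)))%E.
Proof.
move=> fc fm fM; have [d2|d1] := leqP 2 d.
  exact: (isometry_dim2 hk hp d2 fc fm).
apply: (isometry_dim1 hk _ fc fm fM hp).
by move=> i; apply/val_inj; case: i => m /= md; lia.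
Qed.

(** A class has essential side limits, and their means form a representative of it. *)
Lemma Vinf_normalised u : Vinf k p u -> exists f c M,
  [/\ side_lim (@sure R d) f c, f = side_mean i0 c, forall x, `|f x| <= M & L f = u].
Proof.
move=> [/Linfty_bounded[M uM] uoo].
have tA := @thick_almost R d.
have [c uc] := side_lim_exists hp hk tA uM uoo (fun a r e _ _ h => E_esssup_near_Pk h).
have fc := side_mean_lim i0 tA uc.
exists (side_mean i0 c), c, M; split => //.
  move=> x; rewrite -[side_mean i0 c x]subr0.
  apply: side_mean_close => b vb; rewrite subr0; apply/ler_addgt0Pr => e e0.
  have [t t0 ht] := uc x i0 b vb e e0.
  have [y [/= y1 y2] xy] := thick_hball tA (thickI tA ht uM) vb t0.
  have := y1 xy; have := lerB_dist (c x i0 b) (u y); rewrite distrC; lra.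
apply: L_unique; first exact: side_lim_measurable fc.
by apply: (thickS tA _ (side_mean_eqF i0 tA (almost_neq hd) uc)) => x /= -> _.
Qed.

Lemma normalised_V f c M : side_lim (@sure R d) f c -> f = side_mean i0 c ->
  (forall x, `|f x| <= M) -> Vinf k p (L f) ->
  V k p f /\ Vinf_seminorm k p (L f) = V_seminorm k p f.
Proof.
move=> fc fm fM [_ Loo]; have mf := side_lim_measurable hd fc.
have le : (V_seminorm k p f <= Vinf_seminorm k p (L f))%E.
  by rewrite Vinf_seminorm_L //; exact: isometry fc fm fM.
have Vf : V k p f by apply: bounded_V fM _; exact: le_lt_trans le Loo.
by split => //; apply/eqP; rewrite eq_le le Vinf_le_V.
Qed.

(** The normalisation changes neither the side limits nor the class. *)
Lemma P_V f : V k p f -> exists c M, [/\ P f = side_mean i0 c, side_lim (@sure R d) f c,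
  side_lim (@sure R d) (P f) c, forall x, `|P f x| <= M & L (P f) = L f].
Proof.
move=> Vf; have [c fc] := V_side_lim Vf; have [M fM] := V_bounded Vf.
have tS := @thick_sure R d; have tA := @thick_almost R d.
have Pf := P_side_mean hd fc; have Pc := side_mean_lim i0 tS fc.
exists c, M; rewrite Pf; split => //.
  move=> x; rewrite -[side_mean i0 c x]subr0.
  apply: side_mean_close => b vb; rewrite subr0; apply/ler_addgt0Pr => e e0.
  have [t t0 ht] := fc x i0 b vb e e0.
  have [y xy] := hball_nonempty vb t0.
  have := ht y xy; have := fM y; have := lerB_dist (c x i0 b) (f y).
  by rewrite distrC; lra.
apply/L_eqP; [exact: side_lim_measurable Pc|exact: V_measurable|].
apply: (thickS tA _ (side_mean_eqF i0 tA (almost_neq hd) (side_lim_almost fc))).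
by move=> x /= ->.
Qed.

Lemma NV_isometry f : NV k p f -> V k p f /\ Vinf_seminorm k p (L f) = V_seminorm k p f.
Proof.
move=> [g Vg <-]; have [c [M [Pg gc Pgc PM LP]]] := P_V Vg.
by apply: (normalised_V Pgc Pg PM); rewrite LP; exact: V_Vinf.
Qed.

Lemma Vinf_NV u : Vinf k p u -> exists2 f, NV k p f & L f = u.
Proof.
move=> Vu; have [f [c [M [fc fm fM Lf]]]] := Vinf_normalised Vu.
have [|Vf _] := normalised_V fc fm fM; first by rewrite Lf.
by exists f => //; exists f => //; rewrite (P_side_mean hd fc) -fm.
Qed.

(** The zeros of [g] accumulate at every point from every direction, so the limits of
    [g], which are also those of [f], vanish. *)
Lemma kernel_side_lim F f g c : thick F -> side_lim F g c -> F [set x | g x = 0] ->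
  side_lim (@sure R d) f c -> side_lim (@sure R d) f (fun _ _ _ => 0).
Proof.
move=> tF gc g0 fc x i b vx e e0.
suff c0 : c x i b = 0.
  by have [t t0 ht] := fc x i b vx e e0; exists t => // y /ht; rewrite c0.
apply/eqP; rewrite -normr_le0; apply/ler_addgt0Pr => e' e'0; rewrite add0r.
have [t t0 ht] := gc x i b vx e' e'0.
have [y [/= y1 y2] xy] := thick_hball tF (thickI tF ht g0) vx t0.
by have := y1 xy; rewrite y2 sub0r normrN.
Qed.

Lemma P_zero f : side_lim (@sure R d) f (fun _ _ _ => 0) -> P f = cst 0.
Proof.
by move=> f0; rewrite (P_side_mean hd f0); apply/funext => x; exact: side_mean_eq.
Qed.

Lemma V_ellp_equiv f : V k p f ->
  [/\ L f = L (cst 0) -> side_lim (@sure R d) f (fun _ _ _ => 0),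
      P f = cst 0 -> side_lim (@sure R d) f (fun _ _ _ => 0) &
      side_lim (@sure R d) f (fun _ _ _ => 0) -> P f = cst 0 /\ L f = L (cst 0)].
Proof.
move=> Vf; have [c [M [Pf fc Pc PM LP]]] := P_V Vf; split.
- move=> /(L_eqP (V_measurable Vf) (measurable_cst _)) f0.
  exact: kernel_side_lim (@thick_almost R d) (side_lim_almost fc) f0 fc.
- move=> Pf0; apply: kernel_side_lim (@thick_sure R d) Pc _ fc.
  by move=> x /=; rewrite Pf0.
- by move=> f0; have Pf0 := P_zero f0; rewrite -LP Pf0.
Qed.

Lemma kerL_kerP : @kerL R d k p = @kerP R d k p.
Proof.
apply/seteqP; split => f [Vf h]; split => //; have [h1 h2 h3] := V_ellp_equiv Vf.
  by have [] := h3 (h1 h).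
by have [] := h3 (h2 h).
Qed.

Lemma kerP_ellp : @kerP R d k p = @ellp R d p.
Proof.
apply/seteqP; split => [f [Vf h]|f lf].
  have [_ h2 _] := V_ellp_equiv Vf; have [_ Voo] := Vf.
  exact: (side_lim0_ellp hd hk hp (h2 h) Voo).
split; first exact: ellp_V.
by apply: P_zero; exact: (ellp_side_lim0 hp lf).
Qed.

Lemma L_norm_eq1 : d%:R / p <= k%:R -> L_norm d k p = 1%E.
Proof.
move=> hdp; apply/eqP; rewrite eq_le; apply/andP; split.
  by apply: ge_ereal_sup => _ [f [Vf f1] <-]; exact: le_trans (Vinf_le_V Vf) f1.
pose g := @monomial R d k hd.
have [_ goo] := @monomial_V R d k p hd hp hdp.
have g0 := @monomial_norm_gt0 R d k p hd hp.
have gfin : V_seminorm k p g \is a fin_num by rewrite ge0_fin_numE // ltW.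
pose N := fine (V_seminorm k p g).
have NE : V_seminorm k p g = N%:E by rewrite fineK.
have N0 : 0 < N by rewrite -lte_fin -NE.
pose h x := N^-1 * g x.
have hM x : `|h x| <= N^-1.
  rewrite normrM gtr0_norm ?invr_gt0 //; apply: ler_piMr; last exact: monomial_le1.
  by rewrite invr_ge0 ltW.
have h1 : (V_seminorm k p h <= 1)%E.
  apply: le_trans (V_seminorm_scale k hp g _) _; first by rewrite invr_gt0.
  by rewrite NE -EFinM mulVf // gt_eqF.
have h2 : (1 <= V_seminorm k p h)%E.
  have gh : g = fun x => N * h x.
    by apply/funext => x; rewrite /h mulrA mulfV ?mul1r // gt_eqF.
  have := V_seminorm_scale k hp h N0; rewrite -gh NE => hN.
  by rewrite -(@lee_pmul2l _ N%:E) // mule1.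
have Vh : V k p h by apply: (bounded_V hM); apply: le_lt_trans h1 _; rewrite ltry.
have hc : side_lim (@sure R d) h (fun x _ _ => h x).
  move=> x i b vx e e0; have eN : 0 < e * N by rewrite mulr_gt0.
  have [t t0 ht] := monomial_side_lim k hd vx eN; exists t => // y xy.
  by rewrite -mulrBr normrM gtr0_norm ?invr_gt0 // mulrC ler_pdivrMr //; exact: ht.
apply: le_trans h2 _; apply: ereal_sup_ubound; exists h => //.
have hm : h = side_mean i0 (fun x _ _ => h x).
  by apply/funext => x; apply/esym; exact: side_mean_eq.
by have [] := normalised_V hc hm hM (V_Vinf Vh).
Qed.

End main_lemmas.

Unset Implicit Arguments.

(** * The theorem *)

Theorem theorem2p5 (R : realType) (d k : nat) (p : R)
    (hd : (0 < d)%N) (hk : (0 < k)%N) (hp : 1 <= p)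
    (hdp : d%:R / p <= k%:R) :
  (* V_p^k consists of Lebesgue measurable functions, L maps each of them to
     its class in L_infty, and L is linear *)
  (forall f : Qd R d -> R, V k p f ->
     [/\ measurable_fun [set: QdL R d] (f : QdL R d -> R),
         Linfty (L f) &
         ae_eq (leb R d) setT (f : QdL R d -> R) (L f : QdL R d -> R)]) /\
  (forall (a : R) (f g : Qd R d -> R), V k p f -> V k p g ->
     ae_eq (leb R d) setT (L (fun x => a * f x + g x) : QdL R d -> R)
                          (fun x : QdL R d => a * L f x + L g x)) /\
  (* (a) *)
  (@L R d @` @V R d k p = @Vinf R d k p /\ L_norm d k p = 1%E) /\
  (* (b) *)
  (@kerL R d k p = @kerP R d k p /\ @kerP R d k p = @ellp R d p /\
   @ellp R d p `<=` @V R d k p) /\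
  (* (c) *)
  (@NV R d k p `<=` @V R d k p /\
   @L R d @` @NV R d k p = @Vinf R d k p /\
   forall f, @NV R d k p f -> Vinf_seminorm k p (L f) = V_seminorm k p f).
Proof.
have tA := @thick_almost R d.
split; last split; last split; last split.
- move=> f Vf; have mf := V_measurable hd hk hp Vf.
  split; [exact: mf| |exact: ae_eq_L].
  by have [] := V_Vinf hd hk hp Vf.
- move=> a f g Vf Vg.
  have mf := V_measurable hd hk hp Vf; have mg := V_measurable hd hk hp Vg.
  have mfg : measurable_fun [set: QdL R d] ((fun x : Qd R d => a * f x + g x) : QdL R d -> R).
    exact: (measurable_realfun.measurable_funD
      (measurable_realfun.measurable_funM (measurable_cst _) mf) mg).
  apply: (thickS tA _ (thickI tA (ae_eq_L mfg) (thickI tA (ae_eq_L mf) (ae_eq_L mg)))).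
  by move=> x [/= h1 [h2 h3]] _; rewrite -(h1 I) -(h2 I) -(h3 I).
- split; last exact: L_norm_eq1.
  apply/seteqP; split => [_ [f Vf <-]|u /(Vinf_NV hd hk hp)[f NVf <-]].
    exact: V_Vinf.
  by exists f => //; have [] := NV_isometry hd hk hp NVf.
- by split; [exact: kerL_kerP|split; [exact: kerP_ellp|exact: ellp_V]].
- split; last split.
  + by move=> f /(NV_isometry hd hk hp)[].
  + apply/seteqP; split => [_ [f /(NV_isometry hd hk hp)[Vf _] <-]|u].
      exact: V_Vinf.
    by move=> /(Vinf_NV hd hk hp)[f NVf <-]; exists f.
  + by move=> f /(NV_isometry hd hk hp)[].
Qed.
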